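(* Let $\tilde{\mathcal N}_h\subset\mathcal N_h$ be any subset of the set of nodes of the generalized finite element space $V_h\subset H^2_0(\Omega)$, let $\tilde V_h=\{v\in V_h: v(p)=0\ \forall p\in\mathcal N_h\setminus\tilde{\mathcal N}_h\}$, let $\tilde A_h:\tilde V_h\to\tilde V_h'$ be given by $\langle\tilde A_h v,w\rangle=a(v,w)$, and let $B_{\rm OL}=\sum_{j=1}^J I_jA_j^{-1}I_j^t:\tilde V_h'\to\tilde V_h$ be the one-level additive Schwarz preconditioner associated with the overlapping subdomains $D_1,\dots,D_J$ (all as specified in the context). Then $$\kappa(B_{\rm OL}\tilde A_h)=\frac{\lambda_{\max}(B_{\rm OL}\tilde A_h)}{\lambda_{\min}(B_{\rm OL}\tilde A_h)}\le C\,\delta^{-4},$$ where $\delta$ $(\ge h)$ measures the overlap among the subdomains $D_1,\dots,D_J$ and the positive constant $C$ is independent of $h$, $H$, $J$, $\delta$ and $\tilde{\mathcal N}_h$.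
   Context: Setting. $\Omega\subset\mathbb R^2$ is a bounded polygonal domain, and $a(v,w)=\int_\Omega D^2v:D^2w\,dx=\int_\Omega\sum_{i,j=1}^2\frac{\partial^2 v}{\partial x_i\partial x_j}\frac{\partial^2 w}{\partial x_i\partial x_j}\,dx$ for $v,w\in H^2_0(\Omega)$. Constants called $C$ (with or without subscripts) are positive and generic; $A\approx B$ means that $A$ and $B$ bound each other up to such constants, uniform over the family of discretizations and decompositions considered. Partition of unity method. $\{\Omega_i\}_{i=1}^n$ is an open cover of $\bar\Omega$ by open rectangles (patches) whose diameters are comparable to a mesh size $h$, and $\phi_1,\dots,\phi_n\in W^2_\infty(\mathbb R^2)$ are nonnegative functions (tensor products of one-dimensional flat-top functions) with $\mathrm{supp}\,\phi_i\subset\Omega_i$, $\sum_{i=1}^n\phi_i=1$ on $\Omega$, and $|\phi_i|_{W^m_\infty(\mathbb R^2)}\le C(\mathrm{diam}\,\Omega_i)^{-m}$ for $0\le m\le 2$. The flat-top region $\Omega_i^{\rm flat}\subset\Omega_i$ is the set where $\phi_i=1$. $V_i$ is a space of biquadratic polynomials on $\Omega_i$ satisfying the homogeneous Dirichlet boundary conditions of $H^2_0(\Omega)$ on $\partial\Omega$; its degrees of freedom are values at nodes lying in $\Omega_i^{\rm flat}$. The generalized finite element space is $V_h=\sum_{i=1}^n\phi_iV_i\subset H^2_0(\Omega)$. $\mathcal N_h$ is the set of all nodes corresponding to the degrees of freedom of the local basis functions; its cardinality is $\dim V_h$, and a function in $V_h$ is determined by its values on $\mathcal N_h$. The interpolation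 operator $\Pi_h:H^2_0(\Omega)\to V_h$ is $\Pi_h\zeta=\sum_{i=1}^n(\Pi_i\zeta)\phi_i$, where $\Pi_i$ is the nodal interpolation operator for $V_i$. The discretization has the known property $$\sum_{m=0}^1h^m|\zeta-\Pi_h\zeta|_{H^m(\Omega)}+h^2|\Pi_h\zeta|_{H^2(\Omega)}\le C_\Pi h^2|\zeta|_{H^2(\Omega)}\qquad\forall\,\zeta\in H^2_0(\Omega),$$ with $C_\Pi$ independent of $h$. Truncated space. For $\tilde{\mathcal N}_h\subset\mathcal N_h$, the truncation operator $\tilde T_h:V_h\to V_h$ is defined by $(\tilde T_hv)(p)=v(p)$ if $p\in\tilde{\mathcal N}_h$ and $(\tilde T_hv)(p)=0$ if $p\in\mathcal N_h\setminus\tilde{\mathcal N}_h$; it is a projection onto $\tilde V_h=\tilde T_hV_h$. $\langle\cdot,\cdot\rangle$ denotes the canonical duality pairing between a space and its dual. (The condition number is meaningful when $\tilde V_h\ne\{0\}$.) Domain decomposition. $D_1,\dots,D_J$ are overlapping subdomains forming a decomposition of $\Omega$ with $\mathrm{diam}\,D_j\approx H$ for all $j$; any point of $\Omega$ belongs to at most $N_c$ of the subdomains ($N_c$ a fixed number); the boundaries of $D_1,\dots,D_J$ are aligned with the boundaries of the patches underlying $V_h$. There is a partition of unity $\psi_1,\dots,\psi_J\in W^2_\infty(\mathbb R^2)$ with $\sum_{j=1}^J\psi_j=1$ on $\bar\Omega$, $\psi_j\ge0$, $\psi_j=0$ on $\Omega\setminus\bar D_j$, and $|\psi_j|_{W^k_\infty(\Omega)}\le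 C_\dag\delta^{-k}$ for $k=0,1,2$ and $1\le j\le J$, where $\delta\ge h$ measures the overlap among the subdomains (as an overlap width, $\delta$ is at most comparable to $H$). Preconditioner. For $1\le j\le J$, $\tilde V_j$ is the subspace of $\tilde V_h$ of functions vanishing at all nodes outside $D_j$, $A_j:\tilde V_j\to\tilde V_j'$ is defined by $\langle A_jv,w\rangle=a(v,w)$ for all $v,w\in\tilde V_j$, $I_j:\tilde V_j\to\tilde V_h$ is the natural injection and $I_j^t:\tilde V_h'\to\tilde V_j'$ its transpose. $\lambda_{\max}$ and $\lambda_{\min}$ denote the largest and smallest eigenvalues. *)

(* Defs.v *)
From HB Require Import structures.
From mathcomp Require Import all_boot all_order all_algebra.
From mathcomp Require Import all_classical all_reals all_analysis.
From mathcomp Require Import ess_sup_inf.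
Set Implicit Arguments.
Unset Strict Implicit.
Unset Printing Implicit Defensive.
Import Order.TTheory GRing.Theory Num.Theory numFieldNormedType.Exports.
Local Open Scope classical_set_scope.
Local Open Scope ring_scope.

Notation plane R := (R * R)%type.

Section Geometry.
Context {R : realType}.
Implicit Types (A : set (plane R)) (p q : plane R).

Definition edist p q : R :=
  Num.sqrt ((p.1 - q.1) ^+ 2 + (p.2 - q.2) ^+ 2).

Definition diam A : R := sup [set edist x.1 x.2 | x in A `*` A].

Definition boundary A : set (plane R) := closure A `\` A°.

Definition segment p q : set (plane R) :=
  [set (1 - t) *: p + t *: q | t in `[0, 1]%classic].

Definition open_rectangle lo hi : set (plane R) :=
  [set x | lo.1 < x.1 < hi.1 /\ lo.2 < x.2 < hi.2].

(* Cracks (slits along segments) are not excluded. *)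
Definition bounded_polygonal_domain A : Prop :=
  [/\ open A, connected A, A !=set0, bounded_set A &
    exists2 s : seq (plane R * plane R), {in s, forall e, e.1 != e.2} &
      boundary A = \bigcup_(e in [set` s]) segment e.1 e.2].

End Geometry.

Section SobolevSpaces.
Context {R : realType}.
Implicit Types (D : set (plane R)) (f g : plane R -> R) (s : seq 'I_2).

Definition area := (@lebesgue_measure R \x @lebesgue_measure R)%E.

Definition unit_vec (i : 'I_2) : plane R := if i == 0 then (1, 0) else (0, 1).

Definition partial (i : 'I_2) f : plane R -> R := fun x => 'D_(unit_vec i) f x.

(* A sequence s = [:: i1; ...; im] of directions stands for the differential
   operator d/dx_i1 ... d/dx_im of order m = size s. *)
Definition partials s f : plane R -> R := foldr partial f s.

Fixpoint Ck (k : nat) f : Prop :=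
  continuous f /\
  (if k is k'.+1 then
     forall i : 'I_2, (forall x, derivable f x (unit_vec i)) /\ Ck k' (partial i f)
   else True).

Definition test_function D (chi : plane R -> R) : Prop :=
  let supp := closure [set x | chi x != 0] in
  [/\ forall k, Ck k chi, compact supp & supp `<=` D].

Definition loc_integrable D f : Prop :=
  measurable_fun D f /\
  forall K, compact K -> K `<=` D -> area.-integrable K (EFin \o f).

Definition is_weak_deriv D s f g : Prop :=
  [/\ loc_integrable D f, loc_integrable D g &
    forall chi, test_function D chi ->
      \int[area]_(x in D) (f x * partials s chi x) =
      (-1) ^+ size s * \int[area]_(x in D) (g x * chi x)].

Definition has_weak_deriv D s f : Prop := exists g, is_weak_deriv D s f g.

(* Determined almost everywhere on D when has_weak_deriv D s f holds. *)
Definition weak_deriv D s f : plane R -> R :=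
  xget 0 [set g | is_weak_deriv D s f g].

Definition square_integrable D f : Prop :=
  measurable_fun D f /\ area.-integrable D (fun x => (f x ^+ 2)%:E).

Definition Hspace D (k : nat) : set (plane R -> R) :=
  [set f | forall s, (size s <= k)%N ->
    has_weak_deriv D s f /\ square_integrable D (weak_deriv D s f)].

Definition Hsemi D (m : nat) f : R :=
  Num.sqrt (\sum_(s : m.-tuple 'I_2)
    \int[area]_(x in D) (weak_deriv D s f x) ^+ 2).

Definition Hnorm D (k : nat) f : R :=
  Num.sqrt (\sum_(m < k.+1) Hsemi D m f ^+ 2).

(* H^2_0(D), the closure of the test functions in H^2(D).  A class is
   represented by its continuous representative (it has one, by the Sobolev
   embedding in dimension 2), extended by 0 outside D; this representative is
   unique, so point values are meaningful and equality of classes is equality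
   of functions. *)
Definition H20 D : set (plane R -> R) :=
  [set f | [/\ continuous f, forall x, ~ D x -> f x = 0, Hspace D 2 f &
    forall e : R, 0 < e ->
      exists2 chi, test_function D chi & Hnorm D 2 (f - chi) < e]].

Definition Winf_semi D (m : nat) f : \bar R :=
  \big[maxe/0%E]_(s : m.-tuple 'I_2)
    ess_sup area (fun x => `|(weak_deriv D s f \_ D) x|%:E).

(* W^2_oo(R^2), through continuous representatives *)
Definition W2inf : set (plane R -> R) :=
  [set f | [/\ continuous f,
    forall s, (size s <= 2)%N -> has_weak_deriv setT s f &
    forall m, (m <= 2)%N -> (Winf_semi setT m f < +oo)%E]].

Definition bilin D (v w : plane R -> R) : R :=
  \int[area]_(x in D) \sum_(i < 2) \sum_(j < 2)
    (weak_deriv D [:: i; j] v x * weak_deriv D [:: i; j] w x).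

End SobolevSpaces.

Section PartitionOfUnityMethod.
Context {R : realType}.
Implicit Types (Omega : set (plane R)) (v zeta : plane R -> R).

Definition linear_subspace (V : set (plane R -> R)) : Prop :=
  V 0 /\ forall (a : R) u v, V u -> V v -> V (a *: u + v).

Definition biquadratic : set (plane R -> R) :=
  [set p | exists c : 'I_3 -> 'I_3 -> R,
    forall x, p x = \sum_(i < 3) \sum_(j < 3) c i j * x.1 ^+ i * x.2 ^+ j].

Definition flat_top (f : R -> R) : Prop :=
  (forall t, 0 <= f t <= 1) /\
  exists a b c d : R, [/\ a < b, b < c, c < d,
    forall t, b <= t <= c -> f t = 1 & forall t, ~ (a < t < d) -> f t = 0].

Record gfem := Gfem {
  patch_count : nat;
  patch_lo : 'I_patch_count -> plane R;
  patch_hi : 'I_patch_count -> plane R;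
  phi : 'I_patch_count -> plane R -> R;
  local_space : 'I_patch_count -> set (plane R -> R);
  local_nodes : 'I_patch_count -> set (plane R) }.

Implicit Types G : gfem.

Definition patch G (i : 'I_(patch_count G)) : set (plane R) :=
  open_rectangle (patch_lo i) (patch_hi i).

Definition flat_region G (i : 'I_(patch_count G)) : set (plane R) :=
  patch i `&` [set x | phi i x = 1].

Definition nodes G : set (plane R) := \bigcup_(i in setT) local_nodes (g := G) i.

(* V_h = sum_i phi_i V_i, as a space of functions on Omega, extended by 0 to
   the plane (the functions phi_i need not vanish outside Omega). *)
Definition Vh Omega G : set (plane R -> R) :=
  [set v | exists2 p : 'I_(patch_count G) -> plane R -> R,
    forall i, local_space i (p i) &
    v = (fun x => \sum_i phi i x * p i x) \_ Omega].

Definition local_interp G (i : 'I_(patch_count G)) zeta : plane R -> R :=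
  xget 0 [set p | local_space i p /\ {in local_nodes i, p =1 zeta}].

Definition interp Omega G zeta : plane R -> R :=
  (fun x => \sum_(i < patch_count G) local_interp i zeta x * phi i x) \_ Omega.

Record gfem_spec Omega (h Cq Cphi CPi : R) G : Prop := {
  patch_nondeg : forall i : 'I_(patch_count G),
    (patch_lo i).1 < (patch_hi i).1 /\ (patch_lo i).2 < (patch_hi i).2;
  patch_cover : closure Omega `<=` \bigcup_(i in setT) patch (G := G) i;
  patch_diam : forall i : 'I_(patch_count G),
    h / Cq <= diam (patch i) <= Cq * h;
  phi_W2inf : forall i : 'I_(patch_count G), W2inf (phi i);
  phi_tensor : forall i : 'I_(patch_count G), exists f g : R -> R,
    [/\ flat_top f, flat_top g & forall x, phi i x = f x.1 * g x.2];
  phi_ge0 : forall (i : 'I_(patch_count G)) x, 0 <= phi i x;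
  phi_supp : forall i : 'I_(patch_count G), [set x | phi i x != 0] `<=` patch i;
  phi_sum1 : forall x, Omega x -> \sum_(i < patch_count G) phi i x = 1;
  phi_bound : forall (i : 'I_(patch_count G)) m, (m <= 2)%N ->
    (Winf_semi setT m (phi i) <= (Cphi * diam (patch i) ^- m)%:E)%E;
  local_space_linear : forall i : 'I_(patch_count G),
    linear_subspace (local_space i);
  local_space_biquadratic : forall i : 'I_(patch_count G),
    local_space i `<=` biquadratic;
  (* both v and its normal derivative vanish on the Dirichlet boundary, i.e.,
     v and its gradient do *)
  local_space_dirichlet : forall (i : 'I_(patch_count G)) p x,
    local_space i p -> (boundary Omega `&` patch i) x ->
    p x = 0 /\ forall k, partial k p x = 0;
  (* V_i carries homogeneous Dirichlet conditions, so no point of the boundary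
     of Omega is a degree of freedom *)
  local_nodes_flat : forall i : 'I_(patch_count G),
    local_nodes i `<=` Omega `&` flat_region i;
  local_nodes_finite : forall i : 'I_(patch_count G),
    finite_set (local_nodes i);
  local_nodes_unisolvent : forall (i : 'I_(patch_count G)) (c : plane R -> R),
    exists! p, local_space i p /\ {in local_nodes i, p =1 c};
  Vh_conforming : Vh Omega G `<=` H20 Omega;
  interp_stable : forall zeta, H20 Omega zeta ->
    \sum_(m < 2) h ^+ m * Hsemi Omega m (zeta - interp Omega G zeta)
      + h ^+ 2 * Hsemi Omega 2 (interp Omega G zeta)
    <= CPi * h ^+ 2 * Hsemi Omega 2 zeta }.

Definition truncated_space Omega G (N : set (plane R)) : set (plane R -> R) :=
  [set v | Vh Omega G v /\ forall p, (nodes G `\` N) p -> v p = 0].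

End PartitionOfUnityMethod.

Arguments gfem R : clear implicits.

Section DomainDecomposition.
Context {R : realType}.
Implicit Types (Omega : set (plane R)).

Record decomposition := Decomposition {
  sub_count : nat;
  subdomain : 'I_sub_count -> set (plane R);
  psi : 'I_sub_count -> plane R -> R }.

Implicit Types P : decomposition.

Record decomposition_spec Omega (G : gfem R) (h H delta CH Cdelta Cdag : R)
    (Nc : nat) P : Prop := {
  sub_open : forall j : 'I_(sub_count P), open (subdomain j);
  sub_connected : forall j : 'I_(sub_count P), connected (subdomain j);
  (* D_j is a subset of Omega that, inside Omega, lies on one side of its
     boundary *)
  sub_regular : forall j : 'I_(sub_count P),
    subdomain j = Omega `&` (closure (subdomain j))°;
  sub_cover : Omega = \bigcup_(j in setT) subdomain (d := P) j;
  sub_diam : forall j : 'I_(sub_count P), H / CH <= diam (subdomain j) <= CH * H;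
  sub_overlap : forall x, Omega x ->
    (#|[pred j : 'I_(sub_count P) | `[< subdomain j x >]]| <= Nc)%N;
  sub_aligned : forall j : 'I_(sub_count P),
    Omega `&` boundary (subdomain j)
      `<=` \bigcup_(i in setT) boundary (patch (G := G) i);
  psi_W2inf : forall j : 'I_(sub_count P), W2inf (psi j);
  psi_sum1 : forall x, closure Omega x -> \sum_(j < sub_count P) psi j x = 1;
  psi_ge0 : forall (j : 'I_(sub_count P)) x, 0 <= psi j x;
  psi_supp : forall (j : 'I_(sub_count P)) x,
    (Omega `\` closure (subdomain j)) x -> psi j x = 0;
  psi_bound : forall (j : 'I_(sub_count P)) k, (k <= 2)%N ->
    (Winf_semi Omega k (psi j) <= (Cdag * delta ^- k)%:E)%E;
  delta_ge : h <= delta;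
  delta_le : delta <= Cdelta * H }.

End DomainDecomposition.

Arguments decomposition R : clear implicits.

Section Schwarz.
Context {R : realType}.
Implicit Types (Omega : set (plane R)) (V : set (plane R -> R)).

(* An element of the dual V' of a subspace V is given by a functional l on
   functions, of which only the values on V matter. *)
Notation functional := ((plane R -> R) -> R).

(* The operator V -> V' with <A v, w> = a(v, w); on each subspace it is given
   by the same formula. *)
Definition stiffness Omega (v : plane R -> R) : functional := bilin Omega v.

(* The inverse V' -> V of that operator.  Only the values of l on V are used,
   so stiffness_inv Omega V l is A^-1 applied to the restriction of l to V. *)
Definition stiffness_inv Omega V (l : functional) : plane R -> R :=
  xget 0 [set u | V u /\ forall w, V w -> stiffness Omega u w = l w].

Definition local_subspace Omega (G : gfem R) N (D : set (plane R)) :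
    set (plane R -> R) :=
  [set v | truncated_space Omega G N v /\
           forall p, nodes G p -> ~ D p -> v p = 0].

(* B_OL = sum_j I_j A_j^-1 I_j^t: the injections I_j are inclusions of sets of
   functions and their transposes I_j^t are restrictions of functionals, so
   both are silent here. *)
Definition one_level Omega (G : gfem R) N (P : decomposition R)
    (l : functional) : plane R -> R :=
  \sum_(j < sub_count P)
    stiffness_inv Omega (local_subspace Omega G N (subdomain j)) l.

Definition eigenvalues V (T : (plane R -> R) -> (plane R -> R)) : set R :=
  [set l | exists v, [/\ V v, v <> 0 & T v = l *: v]].

Definition is_largest (S : set R) (l : R) : Prop := S l /\ ubound S l.
Definition is_smallest (S : set R) (l : R) : Prop := S l /\ lbound S l.

End Schwarz.

(* Main.v *)
(* By the theory of additive Schwarz methods, the condition number is at most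
   K C0 as soon as every v in the truncated space is a sum of functions w_j of
   the local subspaces with sum_j a(w_j, w_j) <= C0 a(v, v), and
   a(sum_j w_j, sum_j w_j) <= K sum_j a(w_j, w_j) for all such functions.

   For the second property, a function of the j-th local subspace vanishes on
   every patch without a node in D_j.  The nodes of different patches are
   separated by a multiple of h, because phi_i decreases from 1 to 0 between
   them, and each patch has at most 9 nodes; so almost every point only sees a
   bounded number of the subdomains.

   For the first property, w_j = Pi_h (psi_j v).  The H^2 seminorm of psi_j v is
   estimated by the Leibniz rule, and the lower order terms by the Poincare
   inequality, which gives C0 of order delta^-4.  Here v is first replaced by a
   test function chi close to v in H^2, then psi_j chi by a mollification of it;
   the errors at the nodes tend to 0, and Pi_h only depends on nodal values. *)
From HB Require Import structures.
Require Import Defs.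
From mathcomp Require Import all_boot all_order all_algebra.
From mathcomp Require Import all_classical all_reals all_analysis.
From mathcomp Require Import ess_sup_inf measurable_realfun.
From mathcomp Require Import ring lra.
Import Order.TTheory GRing.Theory Num.Theory numFieldNormedType.Exports.
Local Open Scope classical_set_scope.
Local Open Scope ring_scope.
Set Implicit Arguments.
Unset Strict Implicit.
Unset Printing Implicit Defensive.

(** * Measure theory in the plane *)

(** The obstacle is regularity. The interpolation property is assumed on [H20] only, a closure of
    test functions, while [psi j] has just two bounded weak derivatives, so membership of
    [psi j * v] in [H20] is not at hand. It is never established: the energy estimate is made for a
    mollification of [psi j * chi], which is a test function obeying the Leibniz bound of the
    product, and the interpolant of [psi j * v] differs from that of the mollification only through
    nodal values. Constants depending on the mesh enter only there, multiplied by an error that is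
    free to tend to 0. The exponent 4 comes from the second derivatives of [psi j], squared. The
    remaining terms carry [delta^-2] and [delta^0], and an upper bound of [delta] in terms of the
    size of [Omega] brings them to [delta^-4]. The Poincare inequality is used on all of [Omega], so
    its constant depends on [Omega] alone. The number of subdomains stays out of the constants
    because overlaps are counted almost everywhere; for the closures of the subdomains this rests on
    their boundaries lying in patch boundaries, which have zero area. *)

Notation mplane R := ((measurableTypeR R * measurableTypeR R)%type).
Notation pmeasurable D := (@measurable _ (mplane _) D).
Notation pmeasurable_fun D f := (@measurable_fun _ _ (mplane _) _ D f).

#[global] Instance ae_area_filter (R : realType) : Filter (almost_everywhere (@area R)) :=
  @ae_filter_ringOfSetsType _ (mplane R) R area.

Section PlaneMeasure.
Context {R : realType}.
Implicit Types (D K : set (plane R)) (f g : plane R -> R).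

Lemma nbhs_square (x : plane R) (U : set (plane R)) : nbhs x U ->
  exists2 e : R, 0 < e & forall y : plane R, `|x.1 - y.1| < e -> `|x.2 - y.2| < e -> U y.
Proof.
move=> /nbhs_ballP[e /= e0 xeU]; exists e => // y y1 y2.
by apply: xeU; split.
Qed.

Definition closed_box (lo hi : plane R) : set (plane R) :=
  `[lo.1, hi.1]%classic `*` `[lo.2, hi.2]%classic.

Lemma open_rectangleE (lo hi : plane R) :
  open_rectangle lo hi = `]lo.1, hi.1[%classic `*` `]lo.2, hi.2[%classic.
Proof. by apply/seteqP; split => x /=; rewrite !in_itv. Qed.

Lemma open_rectangle_sub_box (lo hi : plane R) : open_rectangle lo hi `<=` closed_box lo hi.
Proof.
by move=> x [/andP[a b] /andP[c d]]; split; rewrite /= in_itv/= !ltW.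
Qed.

Lemma measurable_rectangle (lo hi : plane R) : pmeasurable (open_rectangle lo hi).
Proof. by rewrite open_rectangleE; exact: measurableX. Qed.

Lemma compact_closed_box (lo hi : plane R) : compact (closed_box lo hi).
Proof. by apply: compact_setX; exact: segment_compact. Qed.

Definition rat_lo (k : rat * rat * (rat * rat)) : plane R := (ratr k.1.1, ratr k.2.1).
Definition rat_hi (k : rat * rat * (rat * rat)) : plane R := (ratr k.1.2, ratr k.2.2).

(** There are countably many rational boxes: measurability of open sets and almost everywhere
    statements on them reduce to statements on one box. *)
Lemma open_rat_box (U : set (plane R)) x : open U -> U x ->
  exists2 k, open_rectangle (rat_lo k) (rat_hi k) x & closed_box (rat_lo k) (rat_hi k) `<=` U.
Proof.
move=> oU Ux; have [e e0 xeU] := nbhs_square (open_nbhs_nbhs (conj oU Ux)).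
have ratlt (t : R) : exists p : rat * rat,
    [/\ t - e < ratr p.1, ratr p.1 < t, t < ratr p.2 & ratr p.2 < t + e].
  have /rat_in_itvoo[a] : t - e < t by lra.
  have /rat_in_itvoo[b] : t < t + e by lra.
  rewrite !in_itv/= => /andP[? ?] /andP[? ?].
  by exists (a, b).
have [[a b] /= [a1 a2 b1 b2]] := ratlt x.1.
have [[c d] /= [c1 c2 d1 d2]] := ratlt x.2.
exists ((a, b), (c, d)); first by split => /=; apply/andP.
move=> y [/=]; rewrite !in_itv/= => /andP[? ?] /andP[? ?].
by apply: xeU; rewrite ltr_norml; apply/andP; split; lra.
Qed.

Lemma open_measurable2 (U : set (plane R)) : open U -> pmeasurable U.
Proof.
move=> oU.
pose F k := if `[< closed_box (rat_lo k) (rat_hi k) `<=` U >]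
  then open_rectangle (rat_lo k) (rat_hi k) else set0.
have -> : U = \bigcup_k F k.
  apply/seteqP; split => [x Ux|x [k _]]; last first.
    by rewrite /F; case: asboolP => // + bx; apply; exact: open_rectangle_sub_box.
  have [k kx kU] := open_rat_box oU Ux.
  by exists k => //; rewrite /F; case: asboolP.
apply: countable_bigcupT_measurable => // k; rewrite /F.
by case: asboolP => // _; exact: measurable_rectangle.
Qed.

Lemma closed_measurable2 (U : set (plane R)) : closed U -> pmeasurable U.
Proof.
by move=> cU; rewrite -[U]setCK; apply: measurableC; apply: open_measurable2; exact: closed_openC.
Qed.

Lemma compact_closed2 K : compact K -> closed K.
Proof. by apply: compact_closed; exact: norm_hausdorff. Qed.

Lemma compact_measurable2 K : compact K -> pmeasurable K.
Proof. by move=> /compact_closed2/closed_measurable2. Qed.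

Lemma continuous_measurable2 f D : continuous f -> pmeasurable D -> pmeasurable_fun D f.
Proof.
move=> cf mD; apply: (measurability _ (RGenOInfty.measurableE R)).
move=> _ [_ [a ->] <-]; apply: measurableI => //.
apply: open_measurable2; apply: open_comp; last exact: interval_open.
by move=> x _; exact: cf.
Qed.

Definition square (M : R) : set (plane R) := `[- M, M]%classic `*` `[- M, M]%classic.

Lemma measurable_square M : pmeasurable (square M).
Proof. exact: measurableX. Qed.

Lemma area_square M : (area (square M) < +oo)%E.
Proof.
rewrite /area product_measure1E//.
have : (@lebesgue_measure R [set` `[- M, M]%R] < +oo)%E.
  by rewrite lebesgue_measure_itv; case: ifP => // _; rewrite ltry.
by move=> h; rewrite lte_mul_pinfty// (ge0_fin_numE (measure_ge0 _ _)).
Qed.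

Lemma bounded_sub_square D : bounded_set D -> exists2 M, 0 < M & D `<=` square M.
Proof.
move=> /ex_strict_bound_gt0[M M0 DM]; exists M => // x Dx.
have : `|x| < M := DM _ Dx; rewrite prod_normE/= gt_max => /andP[].
rewrite !ltr_norml => /andP[? ?] /andP[? ?].
by split; rewrite /= in_itv/=; lra.
Qed.

Lemma compact_sub_square K : compact K -> exists2 M, 0 < M & K `<=` square M.
Proof. by move=> /compact_bounded; exact: bounded_sub_square. Qed.

Lemma compact_area K : compact K -> (area K < +oo)%E.
Proof.
move=> cK; have [M _ KM] := compact_sub_square cK.
apply: le_lt_trans (area_square M); apply: le_measure; rewrite ?inE//.
- exact: compact_measurable2.
- exact: measurable_square.
Qed.

Lemma compact_bounded_fun K f : compact K -> continuous f ->
  exists2 M, 0 < M & forall x, K x -> `|f x| <= M.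
Proof.
move=> cK cf; have : compact (f @` K).
  by apply: continuous_compact => //; exact: continuous_subspaceT.
move=> /compact_bounded /ex_strict_bound_gt0[M M0 fM]; exists M => // x Kx.
by apply/ltW/fM; exists x.
Qed.

Lemma integrable_le D f g : pmeasurable D -> pmeasurable_fun D f ->
  area.-integrable D (EFin \o g) -> (forall x, D x -> `|f x| <= `|g x|) ->
  area.-integrable D (EFin \o f).
Proof.
move=> mD mf ig fg; apply: le_integrable ig => //; first exact/measurable_EFinP.
Qed.

Lemma integrable_scale D (c : R) f : pmeasurable D -> area.-integrable D (EFin \o f) ->
  area.-integrable D (EFin \o (fun x => c * f x)).
Proof. by move=> mD fi; exact: (integrableZl mD c fi). Qed.

Lemma integrable_add D f g : pmeasurable D -> area.-integrable D (EFin \o f) ->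
  area.-integrable D (EFin \o g) -> area.-integrable D (EFin \o (fun x => f x + g x)).
Proof. by move=> mD fi gi; exact: (integrableD mD fi gi). Qed.

Lemma integrable_sub D f g : pmeasurable D -> area.-integrable D (EFin \o f) ->
  area.-integrable D (EFin \o g) -> area.-integrable D (EFin \o (fun x => f x - g x)).
Proof. by move=> mD fi gi; exact: (integrableB mD fi gi). Qed.

Lemma loc_integrableM D g f K : pmeasurable D -> loc_integrable D g ->
  continuous f -> compact K -> K `<=` D -> (forall x, ~ K x -> f x = 0) ->
  area.-integrable D (EFin \o (fun x => g x * f x)).
Proof.
move=> mD [mg ig] cf cK KD f0.
have mK := compact_measurable2 cK.
have [M M0 fM] := compact_bounded_fun cK cf.
have -> : EFin \o (fun x => g x * f x) = (EFin \o (fun x => g x * f x)) \_ K.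
  by apply/funext => x; rewrite /patch; case: ifPn => // /negP; rewrite inE /= => /f0 ->; rewrite mulr0.
apply/integrable_restrict => //; rewrite setIidr//.
have := integrableZl mK M (ig _ cK KD); apply: le_integrable => //.
  apply/measurable_EFinP; apply: measurable_funM.
    by apply: measurable_funS mg.
  exact: continuous_measurable2.
move=> x Kx; rewrite /= lee_fin !normrM mulrC ler_wpM2r//.
by rewrite (le_trans (fM _ Kx))// ler_norm.
Qed.
End PlaneMeasure.

(** * Smooth functions and test functions *)

Section SmoothFunctions.
Context {R : realType}.
Implicit Types (f g : plane R -> R) (x y : plane R) (i : 'I_2).

Lemma Ck_continuous k f : Ck k f -> continuous f.
Proof. by case: k => [|k] []. Qed.

Lemma Ck_derivable k f : Ck k.+1 f -> forall x i, derivable f x (unit_vec i).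
Proof. by move=> [_ h] x i; have [] := h i. Qed.

Lemma Ck_partial k f i : Ck k.+1 f -> Ck k (partial i f).
Proof. by move=> [_ /(_ i)[]]. Qed.

Lemma Ck_is_derive k f : Ck k.+1 f -> forall x i, is_derive x (unit_vec i) f (partial i f x).
Proof. by move=> h x i; apply: DeriveDef => //; exact: (Ck_derivable h). Qed.

Lemma partialE i f df : (forall x, is_derive x (unit_vec i) f (df x)) -> partial i f = df.
Proof. by move=> h; apply/funext => x; rewrite /partial derive_val. Qed.

Lemma CkSP k f (df : 'I_2 -> plane R -> R) : continuous f ->
  (forall i x, is_derive x (unit_vec i) f (df i x)) -> (forall i, Ck k (df i)) -> Ck k.+1 f.
Proof.
move=> cf h hk; split => // i; split; first by move=> x; have [] := h i x.
by rewrite (partialE (h i)).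
Qed.

Lemma CkW k f : Ck k.+1 f -> Ck k f.
Proof.
elim: k f => [|k ih] f; first by case.
move=> h; split; first exact: Ck_continuous h.
move=> i; split; first by move=> x; exact: (Ck_derivable h).
exact/ih/Ck_partial.
Qed.

Lemma Ck_cst k (c : R) : Ck k (fun=> c).
Proof.
elim: k c => [|k ih] c; first by split => // x; exact: cvg_cst.
apply: (CkSP (df := fun _ _ => 0)) => //; by move=> x; exact: cvg_cst.
Qed.

Lemma CkD k f g : Ck k f -> Ck k g -> Ck k (fun x => f x + g x).
Proof.
elim: k f g => [|k ih] f g hf hg; have cf := Ck_continuous hf; have cg := Ck_continuous hg.
  by split => // x; apply: cvgD; [exact: cf|exact: cg].
apply: (CkSP (df := fun i x => partial i f x + partial i g x)).
- by move=> x; apply: cvgD; [exact: cf|exact: cg].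
- by move=> i x; exact: (is_deriveD (Ck_is_derive hf x i) (Ck_is_derive hg x i)).
- by move=> i; apply: ih; exact: Ck_partial.
Qed.

Lemma CkM k f g : Ck k f -> Ck k g -> Ck k (fun x => f x * g x).
Proof.
elim: k f g => [|k ih] f g hf hg; have cf := Ck_continuous hf; have cg := Ck_continuous hg.
  by split => // x; apply: cvgM; [exact: cf|exact: cg].
apply: (CkSP (df := fun i x => f x * partial i g x + g x * partial i f x)).
- by move=> x; apply: cvgM; [exact: cf|exact: cg].
- by move=> i x; exact: (is_deriveM (Ck_is_derive hf x i) (Ck_is_derive hg x i)).
- by move=> i; apply: CkD; apply: ih; first [exact: CkW|exact: Ck_partial].
Qed.

Lemma CkZ k (c : R) f : Ck k f -> Ck k (fun x => c * f x).
Proof. by move=> hf; apply: CkM => //; exact: Ck_cst. Qed.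

Lemma partialM k f g i : Ck k.+1 f -> Ck k.+1 g ->
  partial i (fun x => f x * g x) = fun x => f x * partial i g x + g x * partial i f x.
Proof. by move=> hf hg; apply: partialE => x; exact: (is_deriveM (Ck_is_derive hf x i) (Ck_is_derive hg x i)). Qed.

Lemma partial_cst i (c : R) : partial i (fun=> c) = fun=> 0.
Proof. by apply: partialE => x; exact: is_derive_cst. Qed.

Lemma partialZ k (c : R) f i : Ck k.+1 f ->
  partial i (fun x => c * f x) = fun x => c * partial i f x.
Proof.
move=> hf; rewrite (partialM _ (Ck_cst k.+1 c) hf) partial_cst.
by apply/funext => x; rewrite mulr0 addr0.
Qed.

(** The difference quotient at [h] is minus the one at [- h]. Reflections occur because a
    convolution kernel, seen as a function of the integration variable [y], is [k (x - y)]. *)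
Lemma is_derive_reflect (p : plane R) v f y (df : R) :
  is_derive (p - y) v f df -> is_derive y v (fun y => f (p - y)) (- df).
Proof.
move=> [/cvg_ex[l fl] fE].
have ll : l = df by rewrite -fE; apply/esym/cvg_lim.
have : h^-1 *: ((f \o (fun y => p - y) \o shift y) (h *: v) - f (p - y)) @[h --> 0^'] --> - df.
  rewrite -ll.
  have -> : (fun h : R => h^-1 *: ((f \o (fun y => p - y) \o shift y) (h *: v) - f (p - y))) =
    (fun h => - (h^-1 *: ((f \o shift (p - y)) (h *: v) - f (p - y)))) \o -%R.
    apply/funext => h /=; rewrite invrN scaleNr opprK; congr (_ *: (f _ - _)).
    by rewrite scaleNr addrC opprD addrA addrAC.
  have c1 : (fun h : R => - h) @ (0 : R)^' `=>` ((0 : R)^').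
    move=> A /nbhs_ballP[e /= e0 eA]; apply/nbhs_ballP; exists e => // h he h0.
    by apply: eA; rewrite /= ?oppr_eq0//; move: he; rewrite /ball/= !sub0r opprK normrN.
  have fl' : - (h^-1 *: ((f \o shift (p - y)) (h *: v) - f (p - y))) @[h --> 0^'] --> - l.
    by apply: cvgN; exact: fl.
  exact: (cvg_comp _ _ c1 fl').
by move=> h; apply: DeriveDef; [apply/cvg_ex; exists (- df)|exact/cvg_lim].
Qed.

Lemma Ck_reflect k f (p : plane R) : Ck k f -> Ck k (fun y => f (p - y)).
Proof.
elim: k f => [|k ih] f hf; have cf := Ck_continuous hf.
  split => // y; apply: continuous_comp; last exact: cf.
  by apply: cvgB; [exact: cvg_cst|exact: cvg_id].
apply: (CkSP (df := fun i y => - partial i f (p - y))).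
- move=> y; apply: continuous_comp; last exact: cf.
  by apply: cvgB; [exact: cvg_cst|exact: cvg_id].
- by move=> i x; exact: (is_derive_reflect (Ck_is_derive hf _ i)).
- move=> i; under eq_fun do rewrite -mulN1r; apply: CkZ; apply: ih.
  exact: Ck_partial.
Qed.

Lemma partial_reflect k f (p : plane R) i : Ck k.+1 f ->
  partial i (fun y => f (p - y)) = fun y => - partial i f (p - y).
Proof.
by move=> hf; apply: partialE => x; exact: (is_derive_reflect (Ck_is_derive hf _ i)).
Qed.

(** The sign is the one in the definition of a weak derivative; the two cancel in [weak_conv]. *)
Lemma partials_reflect (s : seq 'I_2) f (p : plane R) : (forall k, Ck k f) ->
  partials s (fun y => f (p - y)) = fun y => (-1) ^+ size s * partials s f (p - y).
Proof.
move=> hf; have hs t : forall k, Ck k (partials t f).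
  by elim: t => // i t ih k; exact: Ck_partial (ih k.+1).
elim: s => [|i s ih] /=; first by apply/funext => y; rewrite mul1r.
rewrite -/(partials s _) ih (partialZ (k := 0)); last exact/Ck_reflect/hs.
rewrite (partial_reflect (k := 0)); last exact/hs.
by apply/funext => y; rewrite exprS mulN1r mulrN mulNr.
Qed.

Lemma Ck_partials k (s : seq 'I_2) f : Ck (size s + k) f -> Ck k (partials s f).
Proof.
elim: s k => // i s ih k; rewrite addSn -addnS => /ih; exact: Ck_partial.
Qed.

End SmoothFunctions.

(** * Partial derivatives as one-variable derivatives along coordinate lines *)

Section Slices.
Context {R : realType}.
Implicit Types (f F : plane R -> R) (x y : plane R) (i : 'I_2) (t : R).

Definition coord i x : R := if i == 0 then x.1 else x.2.

Definition slice i x t : plane R := if i == 0 then (t, x.2) else (x.1, t).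

Lemma slice_coord i x : slice i x (coord i x) = x.
Proof. by case: x => a b; rewrite /slice /coord; case: (i == 0). Qed.

Lemma coord_slice i x t : coord i (slice i x t) = t.
Proof. by rewrite /slice /coord; case: (i == 0). Qed.

Lemma slice_slice i x t u : slice i (slice i x t) u = slice i x u.
Proof. by rewrite /slice; case: (i == 0). Qed.

Lemma slice_shift i x (h : R) : slice i x (h + coord i x) = h *: unit_vec i + x.
Proof.
rewrite /slice /coord /unit_vec; case: x => a b; case: (i == 0); congr pair;
  by rewrite /= ?scaler0 ?add0r// /GRing.scale/= mulr1.
Qed.

Lemma is_derive_slice i F x (df : R) :
  is_derive (coord i x) 1 (fun t => F (slice i x t)) df <-> is_derive x (unit_vec i) F df.
Proof.
have E : (fun h : R => h^-1 *: (((fun t => F (slice i x t)) \o shift (coord i x)) (h *: 1)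
      - F (slice i x (coord i x)))) =
    (fun h => h^-1 *: ((F \o shift x) (h *: unit_vec i) - F x)).
  apply/funext => h /=; rewrite slice_coord; congr (_ *: (F _ - _)).
  by rewrite -slice_shift /GRing.scale/= mulr1.
by split => -[h1 h2]; apply: DeriveDef;
  rewrite /derivable /derive ?E -?E; move: h1 h2; rewrite /derivable /derive ?E -?E.
Qed.

Lemma continuous_slice i F x : continuous F -> continuous (fun t => F (slice i x t)).
Proof.
move=> cF t; apply: continuous_comp; last exact: cF.
rewrite /slice; case: (i == 0).
  exact: (@cvg_pair _ _ _ (nbhs t) (nbhs t) (nbhs x.2) _ _ _ id (cst x.2) cvg_id (cvg_cst _)).
exact: (@cvg_pair _ _ _ (nbhs t) (nbhs x.1) (nbhs t) _ _ _ (cst x.1) id (cvg_cst _) cvg_id).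
Qed.

Lemma continuous_coord i : continuous (coord i).
Proof. by rewrite /coord => x; case: (i == 0); [exact: cvg_fst|exact: cvg_snd]. Qed.

Lemma is_derive_lift (g : R -> R) dg i j x (a d : R) :
  is_derive (a * coord j x + d) 1 g dg ->
  is_derive x (unit_vec i) (fun y => g (a * coord j y + d)) (if i == j then a * dg else 0).
Proof.
move=> hg; apply/is_derive_slice; case: eqP => [->|ij].
  under eq_fun do rewrite coord_slice.
  have h : is_derive (coord j x) 1 (fun t => a * t + d) a.
    by apply: is_derive_eq; rewrite ?scaler0 ?addr0 /GRing.scale/= mulr1.
  by rewrite mulrC; exact: is_derive1_comp.
have -> : (fun t => g (a * coord j (slice i x t) + d)) = fun=> g (a * coord j x + d).
  apply/funext => t; rewrite /coord /slice.
  by case: ifPn => [/eqP j0|j0]; case: ifPn => [/eqP i0|i0] //; case: ij; [rewrite j0|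
    apply/val_inj; move: i j i0 j0 {hg} => [[|[|?]]//? ] [[|[|?]]//?]].
exact: is_derive_cst.
Qed.

End Slices.

(** * Smooth functions of one variable vanishing on a half-line *)

Section FlatFunctions.
Context {R : realType}.

(* x^-k exp(-1/x) on the positive axis; [flat 0] is the classical smooth
   function that is not analytic at 0, and the family is stable under
   differentiation up to linear combinations. *)
Definition flat (k : nat) (t : R) : R :=
  if 0 < t then t^-1 ^+ k * expR (- t^-1) else 0.

Lemma flat_ge0 k t : 0 <= flat k t.
Proof.
by rewrite /flat; case: ifP => // t0; rewrite mulr_ge0 ?expR_ge0// exprn_ge0// invr_ge0 ltW.
Qed.

(** For [t > 0], the term of order [k + 2] of the exponential series gives
    [t^-(k+2) / (k+2)! <= exp(1/t)]. A quadratic bound is what makes the derivative at 0 vanish. *)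
Lemma flat_le k t : flat k t <= k.+2`!%:R * t ^+ 2.
Proof.
rewrite /flat; case: ifP => t0; last by rewrite mulr_ge0// ?ler0n// sqr_ge0.
have ti0 : 0 < t^-1 by rewrite invr_gt0.
have := expR_ge1Dxn k.+1 (ltW ti0).
have f0 : (0 : R) < k.+2`!%:R by rewrite ltr0n fact_gt0.
rewrite expRN => h.
have {}h : t^-1 ^+ k.+2 / k.+2`!%:R <= expR t^-1 by lra.
rewrite ler_pdivrMr ?expR_gt0//.
move: h; rewrite ler_pdivrMr// => h.
have -> : t^-1 ^+ k = t ^+ 2 * t^-1 ^+ k.+2.
  by rewrite -[k.+2]/(2 + k)%N exprD mulrA -exprMn mulfV ?gt_eqF// expr1n mul1r.
by rewrite [leRHS]mulrAC mulrC ler_wpM2r ?sqr_ge0// mulrC.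
Qed.

Lemma is_derive_flat k (t : R) :
  is_derive t 1 (flat k) (flat k.+2 t - k%:R * flat k.+1 t).
Proof.
have [t0|t0|<-] := ltgtP 0 t.
- have e : {near t, (fun s => s^-1 ^+ k * expR (- s^-1)) =1 flat k}.
    by near=> s; rewrite /flat ifT//; near: s; exact: lt_nbhsr.
  apply: (near_eq_is_derive e).
  have hV : is_derive t 1 (fun s : R => s^-1) (- t ^- 2).
    by have := is_deriveV (f := id) (lt0r_neq0 t0) (is_derive_id t 1); rewrite /GRing.scale/= mulr1.
  have hX : is_derive t 1 (fun s : R => s^-1 ^+ k) ((k%:R * t^-1 ^+ k.-1) *: - t ^- 2).
    have -> : (fun s : R => s^-1 ^+ k) = (fun s => s^-1) ^+ k by rewrite exprfctE.
    exact: is_deriveX hV.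
  have hE : is_derive t 1 (fun s : R => expR (- s^-1)) (expR (- t^-1) * t ^- 2).
    apply: (is_derive1_comp (f := expR) (g := fun s => - s^-1)).
    by rewrite -[X in is_derive _ _ _ X]opprK; exact: is_deriveN.
  apply: (@is_derive_eq _ _ _ _ _ _ _ _ (is_deriveM hX hE)).
  rewrite /flat t0 -!exprVn /GRing.scale/=.
  by case: k {e hX} => [|k]; rewrite /= ?exprS; ring.
- have e : {near t, (cst 0 : R -> R) =1 flat k}.
    by near=> s; rewrite /flat ifF//; apply/negbTE; rewrite -leNgt ltW//; near: s; exact: lt_nbhsl.
  apply: (near_eq_is_derive e).
  rewrite /flat ltNge (ltW t0)/= mulr0 subr0; exact: is_derive_cst.
- have -> : flat k.+2 (0:R) - k%:R * flat k.+1 0 = 0 by rewrite /flat ltxx mulr0 subr0.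
  suff h : h^-1 *: ((flat k \o shift 0) (h *: 1) - flat k 0) @[h --> (0 : R)^'] --> (0 : R).
    by apply: DeriveDef; [apply/cvg_ex; exists 0|exact/cvg_lim].
  set c : R := k.+2`!%:R.
  have n0 : (c * `|h|) @[h --> (0 : R)^'] --> (0 : R).
    have : c * `|h| @[h --> (0 : R)] --> c * `|0 : R|.
      by apply: cvgMr; apply: cvg_norm; exact: cvg_id.
    by rewrite normr0 mulr0; exact: cvg_within_filter.
  apply: (@squeeze_cvgr _ _ _ _ (fun h => - (c * `|h|)) (fun h => c * `|h|)).
  + near=> h; rewrite -ler_norml /= addr0 /flat ltxx subr0 /GRing.scale/= mulr1 normrM.
    rewrite -/(flat k h) (ger0_norm (flat_ge0 _ _)).
    have h0 : h != 0 by near: h; exact: nbhs_dnbhs_neq.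
    rewrite normfV ler_pdivrMl ?normr_gt0//.
    by rewrite mulrCA -normrM ger0_norm -?expr2 ?sqr_ge0 ?flat_le.
  + have := cvgN n0; rewrite oppr0 => h; exact: h.
  + exact: n0.
Unshelve. all: by end_near. Qed.

Lemma continuous_flat k : continuous (flat k).
Proof.
move=> t; apply/differentiable_continuous/derivable1_diffP.
by have [] := is_derive_flat k t.
Qed.

Lemma Ck_flat n k j (a d : R) : Ck n (fun x : plane R => flat k (a * coord j x + d)).
Proof.
have cc m : continuous (fun x : plane R => flat m (a * coord j x + d)).
  move=> x; apply: (@continuous_comp _ _ _ (fun x => a * coord j x + d) (flat m));
    last exact: continuous_flat.
  apply: cvgD; last exact: cvg_cst.
  by apply: cvgMr; exact: continuous_coord.
elim: n k => [|n ih] k; first by split.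
pose df i (x : plane R) := (if i == j then a else 0) *
  (flat k.+2 (a * coord j x + d) + (- k%:R) * flat k.+1 (a * coord j x + d)).
apply: (CkSP (df := df)) => // [i x|i].
  have := is_derive_lift i (is_derive_flat k (a * coord j x + d)).
  by rewrite /df mulNr; case: (i == j); rewrite ?mul0r.
by apply: CkZ; apply: CkD; [exact: ih|apply: CkZ; exact: ih].
Qed.
End FlatFunctions.

(** * Test functions *)

Section TestFunctions.
Context {R : realType}.
Implicit Types (f g chi eta : plane R -> R) (x y : plane R) (D K : set (plane R)) (i : 'I_2).

Lemma test_functionI D K chi : (forall k, Ck k chi) -> compact K -> K `<=` D ->
  (forall x, ~ K x -> chi x = 0) -> test_function D chi.
Proof.
move=> hC cK KD h0; have cl : closure [set x | chi x != 0] `<=` K.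
  rewrite [X in _ `<=` X](_ : K = closure K); last first.
    exact: (closure_id K).1 (compact_closed2 cK).
  apply: closure_subset => x /= cx; apply: contrapT => /h0 e; by rewrite e eqxx in cx.
split => //; last exact: subset_trans KD.
by apply: subclosed_compact cK cl; exact: closed_closure.
Qed.

Lemma test_function_off D chi x : test_function D chi -> ~ D x -> chi x = 0.
Proof.
move=> [_ _ sD] nDx; apply: contrapT => /eqP cx; apply: nDx; apply: sD.
exact: subset_closure.
Qed.

Lemma partial_off f K i : closed K -> (forall x, ~ K x -> f x = 0) ->
  forall x, ~ K x -> partial i f x = 0.
Proof.
move=> clK f0 x Kx; rewrite /partial.
have nK : \near x, ~ K x.
  by apply: open_nbhs_nbhs; split => //; exact: closed_openC.
have -> : 'D_(unit_vec i) f x = 'D_(unit_vec i) (cst 0 : plane R -> R) x.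
  apply: near_eq_derive; near=> y; rewrite f0//; near: y; exact: nK.
exact: derive_cst.
Unshelve. all: by end_near. Qed.

Lemma test_functionP D chi : test_function D chi <->
  (forall k, Ck k chi) /\ exists K, [/\ compact K, K `<=` D,
     forall x, ~ K x -> chi x = 0 & forall s x, ~ K x -> partials s chi x = 0].
Proof.
split => [tc|[hC [K [cK KD h0 _]]]]; last exact: test_functionI cK KD h0.
have [hC cS sD] := tc.
have c0 x : ~ closure [set x | chi x != 0] x -> chi x = 0.
  by move=> h; apply: contrapT => /eqP cx; apply: h; exact: subset_closure.
split => //; exists (closure [set x | chi x != 0]); split => //.
elim => [|i s ih] //= x.
by apply: partial_off => //; exact: compact_closed2.
Qed.

Lemma test_partials D chi s : test_function D chi -> test_function D (partials s chi).
Proof.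
move=> /test_functionP[hC [K [cK KD h0 hs]]]; apply: (test_functionI _ cK KD) => //.
  by move=> k; apply: Ck_partials.
by move=> x; exact: hs.
Qed.

Lemma test_partial D chi i : test_function D chi -> test_function D (partial i chi).
Proof. by move=> /(test_partials [:: i]). Qed.

Lemma test_mulr D chi f : (forall k, Ck k f) -> test_function D chi ->
  test_function D (fun x => f x * chi x).
Proof.
move=> hf /test_functionP[hC [K [cK KD h0 hs]]]; apply: (test_functionI _ cK KD) => //.
  by move=> k; apply: CkM.
by move=> x /h0 ->; rewrite mulr0.
Qed.

Lemma test_cst0 D : test_function D (fun=> 0).
Proof. by apply: (@test_functionI _ set0) => //; [move=> k; exact: Ck_cst|exact: compact0]. Qed.

Lemma test_add D chi eta : test_function D chi -> test_function D eta ->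
  test_function D (fun x => chi x + eta x).
Proof.
move=> /test_functionP[hC [K [cK KD h0 _]]] /test_functionP[hC' [K' [cK' KD' h0' _]]].
apply: (@test_functionI _ (K `|` K')).
- by move=> k; apply: CkD.
- exact: compactU.
- by rewrite subUset.
- by move=> x /not_orP[/h0 -> /h0' ->]; rewrite addr0.
Qed.

Lemma test_sub D D' chi : D `<=` D' -> test_function D chi -> test_function D' chi.
Proof. by move=> DD' [hC cS sD]; split => //; exact: subset_trans DD'. Qed.

Lemma test_continuous D chi : test_function D chi -> continuous chi.
Proof. by case => /(_ 0%N)[]. Qed.

Lemma loc_integrable_test D g chi : pmeasurable D -> loc_integrable D g ->
  test_function D chi -> area.-integrable D (EFin \o (fun x => g x * chi x)).
Proof.
move=> mD ig /[dup] /test_continuous cchi /test_functionP[_ [K [cK KD h0 _]]].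
exact: loc_integrableM ig cchi cK KD h0.
Qed.

Lemma continuous_loc_integrable D f : pmeasurable D -> continuous f -> loc_integrable D f.
Proof.
move=> mD cf; split; first exact: continuous_measurable2.
move=> K cK KD; have mK := compact_measurable2 cK.
have [M M0 fM] := compact_bounded_fun cK cf.
apply: (@integrable_le _ _ _ (cst M)) => //.
- exact: continuous_measurable2.
- apply: measurable_bounded_integrable => //; first exact: compact_area cK.
  exact: bounded_cst.
- by move=> x Kx /=; rewrite [leRHS]ger0_norm ?(ltW M0)// fM.
Qed.

Lemma test_integrable D chi : pmeasurable D -> test_function setT chi ->
  area.-integrable D (EFin \o chi).
Proof.
move=> mD tc; have cc := test_continuous tc.
apply: (integrableS (E := setT)) => //.
have : area.-integrable setT (EFin \o (fun x => 1 * chi x)).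
  apply: loc_integrable_test => //; apply: continuous_loc_integrable => //.
  by move=> x; exact: cvg_cst.
by congr (_.-integrable _ _); apply/funext => x /=; rewrite mul1r.
Qed.

End TestFunctions.

(** * Integration by parts *)

Section IntegralOfDerivative.
Context {R : realType}.
Implicit Types (f chi eta : plane R -> R) (D : set (plane R)) (i : 'I_2).

Lemma integral_derive1 (h dh : R -> R) (M : R) : (forall t : R, is_derive t 1 h (dh t)) ->
  continuous dh -> (forall t, M < `|t| -> h t = 0) ->
  (\int[lebesgue_measure]_t (dh t)%:E = 0)%E.
Proof.
(* The sign of [M] is arbitrary; this choice makes [[-N, N]] a proper interval whose endpoints lie
   where [h] vanishes. *)
move=> hd cdh h0; pose N : R := `|M| + 1.
have N0 : 0 < N by rewrite ltr_wpDl.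
have MN : M < N by rewrite (le_lt_trans (ler_norm M))// ltrDl.
have ch : continuous h.
  by move=> t; apply/differentiable_continuous/derivable1_diffP; have [] := hd t.
have dh0 t : M < `|t| -> dh t = 0.
  move=> Mt; have [_ <-] := hd t.
  have -> : 'D_1 h t = 'D_1 (cst 0 : R -> R) t; last exact: derive_cst.
  apply: near_eq_derive; near=> u; apply: h0; near: u.
  by apply: cvgr_gt Mt; apply: cvg_norm; exact: cvg_id.
transitivity (\int[lebesgue_measure]_(t in `[(- N)%R, N]) (dh t)%:E)%E.
  rewrite [RHS]integral_mkcond; apply: eq_integral => t _.
  rewrite /patch; case: ifPn => //; rewrite notin_setE/= in_itv/= => /negP tN.
  rewrite dh0//; apply: (lt_le_trans MN); rewrite leNgt; apply: contra tN.
  by rewrite ltr_norml => /andP[? ?]; rewrite !ltW.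
rewrite (@continuous_FTC2 _ dh h) ?gtrN//.
- by rewrite !h0 ?subee// ?normrN (gtr0_norm N0).
- exact: continuous_subspaceT.
- split => [t _|//|//]; first by have [] := hd t.
  + exact/cvg_at_right_filter/ch.
  + exact/cvg_at_left_filter/ch.
- by move=> t _; rewrite derive1E; have [] := hd t.
Unshelve. all: by end_near. Qed.

(** By Fubini, integrating first in direction [i]: on every line the integrand is the derivative of
    a compactly supported function. The two directions call for the two orders of iterated
    integration. *)
Lemma integral_partial D chi i : pmeasurable D -> test_function D chi ->
  \int[area]_(x in D) partial i chi x = 0.
Proof.
move=> mD tc; have tci := test_partial i tc.
rewrite Rintegral_mkcond.
have -> : partial i chi \_ D = partial i chi.
  apply/funext => x; rewrite /patch; case: ifPn => // /negP; rewrite inE => nDx.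
  by rewrite (test_function_off tci).
move: tc tci => /(test_sub (@subsetT _ D)) tc /(test_sub (@subsetT _ D)) tci.
have [hC [K [cK _ h0 _]]] := (test_functionP _ _).1 tc.
have [M M0 KM] := compact_sub_square cK.
have off x : M < `|coord i x| -> chi x = 0.
  move=> Mx; apply: h0 => /KM[]; rewrite /= !in_itv/= -!ler_norml.
  by move: Mx; rewrite /coord; case: (i == 0); rewrite ltNge => /negP.
have sl x : (\int[lebesgue_measure]_t (partial i chi (slice i x t))%:E = 0)%E.
  apply: (@integral_derive1 (fun t => chi (slice i x t)) _ M).
  - move=> t; rewrite -{1}(coord_slice i x t).
    have E : (fun t0 : R => chi (slice i x t0)) = (fun t0 => chi (slice i (slice i x t) t0)).
      by apply/funext => u; rewrite slice_slice.
    rewrite E; apply/is_derive_slice; exact: (Ck_is_derive (hC 1%N)).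
  - apply: continuous_slice; exact: test_continuous tci.
  - by move=> t Mt; apply: off; rewrite coord_slice.
have ii := test_integrable measurableT tci.
have [i0|i0] := eqVneq i 0.
  rewrite /Rintegral /area -integral21_prod_meas1// (eq_integral (cst 0%E)); first by rewrite integral0.
  by move=> y _; have := sl (0, y); rewrite /slice i0.
rewrite /Rintegral /area -integral12_prod_meas1// (eq_integral (cst 0%E)); first by rewrite integral0.
by move=> y _; have := sl (y, 0); rewrite /slice (negbTE i0).
Qed.

Lemma integral_by_parts D chi eta i : pmeasurable D -> test_function D chi ->
  (forall k, Ck k eta) ->
  \int[area]_(x in D) (eta x * partial i chi x) = - \int[area]_(x in D) (partial i eta x * chi x).
Proof.
move=> mD tc he; have := integral_partial i mD (test_mulr he tc).
have [hC _ _] := tc.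
have hp k : Ck k (partial i eta) by exact: Ck_partial.
rewrite (partialM _ (he 1%N) (hC 1%N)) RintegralD//.
- move=> /eqP; rewrite addr_eq0 => /eqP ->; congr (- _).
  by apply: eq_Rintegral => x _; rewrite mulrC.
- by apply: test_integrable => //; apply: (test_sub (@subsetT _ D)); apply: test_mulr he _;
    exact: test_partial.
- have -> : (fun x => chi x * partial i eta x) = (fun x => partial i eta x * chi x).
    by apply/funext => x; rewrite mulrC.
  by apply: test_integrable => //; apply: (test_sub (@subsetT _ D)); exact: test_mulr.
Qed.

End IntegralOfDerivative.

(** * Smooth approximations of rectangles *)

Section Bumps.
Context {R : realType}.
Implicit Types (lo hi x : plane R) (D : set (plane R)).

Lemma flat0_le1 (t : R) : flat 0 t <= 1.
Proof.
rewrite /flat; case: ifP => // t0; rewrite expr0 mul1r -expR0 ler_expR.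
by rewrite oppr_le0 invr_ge0 ltW.
Qed.

(** One factor per side of the rectangle. Since [flat 0 (n t) = exp(-1/(n t))] tends to 1 for
    [t > 0], the bumps converge pointwise to the indicator of the open rectangle. *)
Definition bump lo hi (n : nat) x : R :=
  flat 0 (n.+1%:R * coord 0 x + - (n.+1%:R * lo.1)) *
  flat 0 (- n.+1%:R * coord 0 x + n.+1%:R * hi.1) *
  (flat 0 (n.+1%:R * coord 1 x + - (n.+1%:R * lo.2)) *
  flat 0 (- n.+1%:R * coord 1 x + n.+1%:R * hi.2)).

Lemma Ck_bump lo hi n k : Ck k (bump lo hi n).
Proof. by apply: CkM; apply: CkM; exact: Ck_flat. Qed.

Lemma bump_ge0 lo hi n x : 0 <= bump lo hi n x.
Proof. by rewrite !mulr_ge0// flat_ge0. Qed.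

Lemma bump_le1 lo hi n x : bump lo hi n x <= 1.
Proof. by rewrite !mulr_ile1// ?mulr_ge0// ?flat_ge0// flat0_le1. Qed.

Lemma flat0_eq0 (t : R) : t <= 0 -> flat 0 t = 0.
Proof. by move=> t0; rewrite /flat ltNge t0. Qed.

Lemma bump_off lo hi n x : ~ open_rectangle lo hi x -> bump lo hi n x = 0.
Proof.
move=> nx; apply: contrapT => /eqP; rewrite /bump !mulf_eq0 !negb_or => /andP[/andP[h1 h2]/andP[h3 h4]].
have pos (t : R) : flat 0 t != 0 -> 0 < t.
  by apply: contraR; rewrite -leNgt => /flat0_eq0 ->.
have n0 : (0 : R) < n.+1%:R by rewrite ltr0n.
apply: nx; move: h1 h2 h3 h4 => /pos h1 /pos h2 /pos h3 /pos h4.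
split; apply/andP; split; rewrite -(ltr_pM2l n0); move: h1 h2 h3 h4; rewrite /coord/=; lra.
Qed.

Lemma test_bump lo hi n D : closed_box lo hi `<=` D -> test_function D (bump lo hi n).
Proof.
move=> bD; apply: (@test_functionI _ _ (closed_box lo hi)) => //.
- exact: Ck_bump.
- exact: compact_closed_box.
- by move=> x nx; apply: bump_off => /open_rectangle_sub_box.
Qed.

Lemma cvg_flat0 (b : R) : 0 < b -> (fun n => flat 0 (n.+1%:R * b)) @ \oo --> (1 : R).
Proof.
move=> b0.
have -> : (fun n => flat 0 (n.+1%:R * b)) = (fun n => expR (- (harmonic n * b^-1))).
  by apply/funext => n; rewrite /flat mulr_gt0 ?ltr0n// expr0 mul1r invfM.
have h : (harmonic n * b^-1 : R) @[n --> \oo] --> (0 * b^-1 : R).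
  by apply: cvgMl; exact: cvg_harmonic.
rewrite -expR0; apply: continuous_cvg; first exact: continuous_expR.
by rewrite -oppr0 -(mul0r b^-1); apply: cvgN.
Qed.

Lemma cvg_bump lo hi x : bump lo hi n x @[n --> \oo] --> (\1_(open_rectangle lo hi) x : R).
Proof.
rewrite indicE; case: (boolP (x \in _)); last first.
  rewrite notin_setE => nx; rewrite (_ : (fun n => _) = fun=> 0); first exact: cvg_cst.
  by apply/funext => n; rewrite bump_off.
rewrite inE => -[/andP[h1 h2] /andP[h3 h4]].
rewrite -[X in _ --> X](_ : 1 * 1 * (1 * 1) = 1%:R); last by rewrite !mulr1.
have E (u v : R) : (fun n => flat 0 (n.+1%:R * u + - (n.+1%:R * v))) =
    (fun n => flat 0 (n.+1%:R * (u - v))).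
  by apply/funext => n; rewrite mulrBr.
have E' (u v : R) : (fun n => flat 0 (- n.+1%:R * u + n.+1%:R * v)) =
    (fun n => flat 0 (n.+1%:R * (v - u))).
  by apply/funext => n; rewrite mulrBr mulNr addrC.
by apply: cvgM; apply: cvgM; rewrite ?E ?E'; apply: cvg_flat0; rewrite // subr_gt0.
Qed.
End Bumps.

(** * The fundamental lemma of the calculus of variations and weak derivatives *)

Section BorelGenerators.
Context {R : realType}.

Definition rectangles : set (set (plane R)) := [set A | exists lo hi, A = open_rectangle lo hi].

Lemma rectangles_setI : setI_closed rectangles.
Proof.
move=> _ _ [a [b ->]] [c [d ->]].
exists (Num.max a.1 c.1, Num.max a.2 c.2), (Num.min b.1 d.1, Num.min b.2 d.2).
apply/seteqP; split => x; rewrite /open_rectangle/= !gt_max !lt_min.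
  by move=> [[/andP[-> ->] /andP[-> ->]] [/andP[-> ->] /andP[-> ->]]].
by move=> [/andP[/andP[-> ->] /andP[-> ->]] /andP[/andP[-> ->] /andP[-> ->]]].
Qed.

Let sigma_preimage (S : set (set (plane R))) (p : plane R -> R) :
  sigma_algebra setT S -> sigma_algebra setT [set A : set R | S (p @^-1` A)].
Proof.
move=> [S0 SC SU]; split => /=.
- by rewrite preimage_set0.
- by move=> A SA; have := SC _ SA; rewrite !setTD preimage_setC.
- by move=> F SF; rewrite preimage_bigcup; exact: SU.
Qed.

(** Each coordinate of a measurable product is generated by open intervals, and a strip is the union
    of the rectangles obtained by cutting it at [-n-1] and [n+1]. As rectangles are also stable
    under intersection, Dynkin's theorem applies to them. *)
Lemma measurable_rectanglesE : @measurable _ (mplane R) = <<s rectangles >>.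
Proof.
apply/seteqP; split; last first.
  apply: smallest_sub; first exact: sigma_algebra_measurable.
  by move=> _ [a [b ->]]; exact: measurable_rectangle.
have sS := smallest_sigma_algebra [set: plane R] rectangles.
have [S0 SC SU] := sS.
have SI A B : <<s rectangles >> A -> <<s rectangles >> B -> <<s rectangles >> (A `&` B).
  by move=> SA SB; have := @measurableI _ (g_sigma_algebraType rectangles) A B; apply.
have big (t : R) : exists n : nat, - n.+1%:R < t < n.+1%:R.
  exists (Num.truncn `|t|); rewrite -ltr_norml.
  by have /andP[_] := truncn_itv (normr_ge0 t).
rewrite measurable_prod_measurableType.
apply: smallest_sub => // _ [A mA [B mB <-]].
rewrite (_ : A `*` B = (fst @^-1` A) `&` (snd @^-1` B)); last by apply/seteqP; split.
apply: SI.
  have : (@ocitv R).-sigma.-measurable A by [].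
  rewrite RGenOpens.measurableE => mA'.
  suff : <<s @RGenOpens.G R >> `<=` [set A : set R | <<s rectangles >> (fst @^-1` A)] by apply.
  apply: smallest_sub; first exact: (sigma_preimage fst sS).
  move=> _ [a [b ->]] /=.
  rewrite (_ : _ @^-1` _ = \bigcup_n open_rectangle (a, - n.+1%:R) (b, n.+1%:R)).
    by apply: SU => n; apply: sub_sigma_algebra; exists (a, - n.+1%:R), (b, n.+1%:R).
  apply/seteqP; split => [x|x [n _ [/= ? _]]]; rewrite /= in_itv//= => xab.
  by have [n xn] := big x.2; exists n.
have : (@ocitv R).-sigma.-measurable B by [].
rewrite RGenOpens.measurableE => mB'.
suff : <<s @RGenOpens.G R >> `<=` [set A : set R | <<s rectangles >> (snd @^-1` A)] by apply.
apply: smallest_sub; first exact: (sigma_preimage snd sS).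
move=> _ [a [b ->]] /=.
rewrite (_ : _ @^-1` _ = \bigcup_n open_rectangle (- n.+1%:R, a) (n.+1%:R, b)).
  by apply: SU => n; apply: sub_sigma_algebra; exists (- n.+1%:R, a), (n.+1%:R, b).
apply/seteqP; split => [x|x [n _ [/= _ ?]]]; rewrite /= in_itv//= => xab.
by have [n xn] := big x.1; exists n.
Qed.

End BorelGenerators.

(** * The fundamental lemma *)

Section FundamentalLemma.
Context {R : realType}.
Implicit Types (D : set (plane R)) (f g : plane R -> R).

(** Dominated convergence along the bumps of the rectangle, with [|g|] as dominating function: it is
    integrable on the closed box, a compact subset of [D]. *)
Lemma integral_rectangle0 D g lo hi : pmeasurable D -> loc_integrable D g ->
  (forall chi, test_function D chi -> \int[area]_(x in D) (g x * chi x) = 0) ->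
  closed_box lo hi `<=` D ->
  (\int[area]_(x in open_rectangle lo hi) (g x)%:E = 0)%E.
Proof.
move=> mD ig h bD; have cb := @compact_closed_box R lo hi.
have mb := compact_measurable2 cb; have [mg /(_ _ cb bD) igb] := ig.
pose f n x : \bar R := (g x * bump lo hi n x)%:E.
have mgb : pmeasurable_fun (closed_box lo hi) g by apply: measurable_funS mg.
have [] := @dominated_convergence _ _ _ area _ mb f
    (fun x => (g x * \1_(open_rectangle lo hi) x)%:E) (fun x => `|g x|%:E).
- move=> n; apply/measurable_EFinP; apply: measurable_funM => //.
  by apply: continuous_measurable2 => //; exact: (Ck_continuous (Ck_bump lo hi n 0)).
- apply/measurable_EFinP; apply: measurable_funM => //.
  by apply: measurable_indic; exact: measurable_rectangle.
- apply: aeW => x bx; apply: cvg_EFin; first exact: nearW.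
  by apply: cvgMr; exact: cvg_bump.
- exact: integrable_norm.
- apply: aeW => x n bx; rewrite /f /= lee_fin normrM ler_piMr//.
  by rewrite ger0_norm ?bump_ge0 ?bump_le1.
move=> _ _.
have -> : [sequence (\int[area]_(x in closed_box lo hi) f n x)%E]_n = fun=> 0%E.
  apply/funext => n /=; have := h _ (test_bump n bD).
  have E : (fun x => g x * bump lo hi n x) =
      (fun x => g x * bump lo hi n x) \_ (closed_box lo hi).
    apply/funext => x; rewrite /patch; case: ifPn => //; rewrite notin_setE => nx.
    by rewrite bump_off ?mulr0// => /open_rectangle_sub_box.
  rewrite E -Rintegral_mkcondr (setIidr bD) /Rintegral => e0.
  have := congr1 EFin e0; rewrite fineK//; apply: integrable_fin_num => //.
  apply: (@integrable_le _ _ _ g) => //.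
    apply: measurable_funM => //.
    by apply: continuous_measurable2 => //; exact: (Ck_continuous (Ck_bump lo hi n 0)).
  by move=> x _; rewrite normrM ler_piMr// ger0_norm ?bump_ge0 ?bump_le1.
move=> /(cvg_unique _ (cvg_cst _)) => /(_ _)/esym.
have E : (fun x => (g x * \1_(open_rectangle lo hi) x)%:E) =
    (fun x => (g x)%:E) \_ (open_rectangle lo hi).
  by apply/funext => x; rewrite /patch indicE; case: ifPn; rewrite ?mulr1 ?mulr0.
rewrite E -integral_mkcondr setIidr//; last exact: open_rectangle_sub_box.
by apply.
Qed.

(** Inside a rectangle [Q], the sets [S] such that [g] has integral 0 over [Q] and [S] together form
    a Dynkin class containing the rectangles, hence all measurable sets; so [g] vanishes almost
    everywhere on [Q]. Countably many rational boxes then cover [D]. *)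
Lemma fundamental_lemma D g : open D -> loc_integrable D g ->
  (forall chi, test_function D chi -> \int[area]_(x in D) (g x * chi x) = 0) ->
  {ae area, forall x, D x -> g x = 0}.
Proof.
move=> oD ig h; have mD := open_measurable2 oD.
have box lo hi : closed_box lo hi `<=` D ->
    {ae area, forall x, open_rectangle lo hi x -> g x = 0}.
  move=> bD; set Q := open_rectangle lo hi.
  have mQ : pmeasurable Q by exact: measurable_rectangle.
  have QD : Q `<=` D by apply: subset_trans bD; exact: open_rectangle_sub_box.
  have [mg /(_ _ (@compact_closed_box R lo hi) bD) igb] := ig.
  have igQ : area.-integrable Q (EFin \o g).
    apply: integrableS igb => //; last exact: open_rectangle_sub_box.
    by apply: compact_measurable2; exact: compact_closed_box.
  have P0 S : <<s rectangles >> S -> (\int[area]_(x in Q `&` S) (g x)%:E = 0)%E.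
    have PT : (\int[area]_(x in Q `&` setT) (g x)%:E = 0)%E.
      by rewrite setIT; exact: (integral_rectangle0 mD ig h).
    apply: (@dynkin_induction _ (mplane R) (@rectangles R)
      (fun S => (\int[area]_(x in Q `&` S) (g x)%:E = 0)%E) (@measurable_rectanglesE R)
      (@rectangles_setI R) PT).
    - move=> _ [a [b ->]].
      have -> : Q `&` open_rectangle a b = open_rectangle
          (Num.max lo.1 a.1, Num.max lo.2 a.2) (Num.min hi.1 b.1, Num.min hi.2 b.2).
        apply/seteqP; split => x; rewrite /Q /open_rectangle/= !gt_max !lt_min.
          by move=> [[/andP[-> ->] /andP[-> ->]] [/andP[-> ->] /andP[-> ->]]].
        by move=> [/andP[/andP[-> ->] /andP[-> ->]] /andP[/andP[-> ->] /andP[-> ->]]].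
      apply: (integral_rectangle0 mD ig h); apply: subset_trans bD => x [].
      rewrite /closed_box/= !in_itv/= !ge_max !le_min => /andP[/andP[a1 a2] /andP[a3 a4]].
      by move=> /andP[/andP[a5 a6] /andP[a7 a8]]; rewrite a1 a3 a5 a7.
    - move=> A mA A0; have : (\int[area]_(x in Q `&` setT) (g x)%:E = 0)%E by [].
      rewrite -(setUv A) setIUr integral_setU_EFin//=.
      + by rewrite A0 add0e.
      + exact: measurableI.
      + by apply: measurableI => //; exact: measurableC.
      + by rewrite -setIUr setUv setIT; apply: measurable_funS mg.
      + apply/disj_setPS => x [[_ Ax] [_ nAx]]; exact: nAx.
    - move=> F mF tF F0; rewrite setI_bigcupr integral_bigcup//.
      + by apply: eseries0 => n _ _; exact: F0.
      + exact: trivIset_setIl.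
      + by move=> k; exact: measurableI.
      + apply: integrableS igQ => //; first by apply: bigcup_measurable => k _; exact: measurableI.
        by apply: bigcup_sub => k _; exact: subIsetl.
  have : ae_eq area Q (EFin \o g) (cst 0%E).
    apply: integral_ae_eq => // E EQ mE; rewrite integral0.
    by rewrite -(setIidr EQ) P0// -measurable_rectanglesE.
  by apply: filterS => x g0 Qx; have := g0 Qx; case.
pose F n := if unpickle n is Some k then
  [set x | ~ (open_rectangle (rat_lo k) (rat_hi k) x -> g x = 0)] `&`
  [set x : plane R | closed_box (rat_lo k) (rat_hi k) `<=` D] else set0.
suff : area.-negligible (~` [set x | D x -> g x = 0]) by [].
have nF : area.-negligible (\bigcup_n F n).
  apply: negligible_bigcup => n; rewrite /F; case: unpickle => [k|]; last first.
    exact: negligible_set0.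
  have [bD|nb] := pselect (closed_box (@rat_lo R k) (rat_hi k) `<=` D).
    by apply: negligibleS (box _ _ bD); exact: subIsetl.
  by apply: negligibleS (negligible_set0 area) => x [].
apply: negligibleS nF.
move=> x /not_implyP[Dx gx]; have [k kx kD] := open_rat_box oD Dx.
exists (pickle k); first exact: I.
by rewrite /F pickleK; split; [move=> /(_ kx)|exact: kD].
Qed.

End FundamentalLemma.

(** * Weak derivatives: uniqueness, linearity, restriction *)

Section WeakDerivatives.
Context {R : realType}.
Implicit Types (D : set (plane R)) (f g u v chi eta : plane R -> R) (s : seq 'I_2).

Lemma loc_integrableZD D (c : R) f g : pmeasurable D -> loc_integrable D f -> loc_integrable D g ->
  loc_integrable D (fun x => c * f x + g x).
Proof.
move=> mD [mf fi] [mg gi]; split.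
  by apply: measurable_funD => //; apply: measurable_funM.
move=> K cK KD; have mK := compact_measurable2 cK.
by apply: integrable_add => //; [apply: integrable_scale => //; exact: fi|exact: gi].
Qed.

Lemma weak_deriv_unique D s f g1 g2 : open D -> is_weak_deriv D s f g1 -> is_weak_deriv D s f g2 ->
  {ae area, forall x, D x -> g1 x = g2 x}.
Proof.
move=> oD [lf l1 h1] [_ l2 h2]; have mD := open_measurable2 oD.
have : {ae area, forall x, D x -> (-1) * g2 x + g1 x = 0}.
  apply: fundamental_lemma => //; first exact: loc_integrableZD.
  move=> chi tc; have i1 := loc_integrable_test mD l1 tc.
  have i2 := loc_integrable_test mD l2 tc.
  under eq_Rintegral do rewrite mulrDl -mulrA.
  rewrite RintegralD//; last exact: (integrable_scale (-1) mD i2).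
  rewrite RintegralZl//.
  have e := h1 _ tc; rewrite (h2 _ tc) in e.
  have : (-1) ^+ size s * ((-1) ^+ size s * (\int[area]_(x in D) (g2 x * chi x))) =
     (-1) ^+ size s * ((-1) ^+ size s * (\int[area]_(x in D) (g1 x * chi x))) by rewrite e.
  by rewrite !mulrA -exprMn mulrNN mulr1 expr1n !mul1r => ->; rewrite mulN1r addNr.
by apply: filterS => x h Dx; have := h Dx; rewrite mulN1r => /eqP; rewrite addrC subr_eq0 => /eqP.
Qed.

Lemma weak_derivP D s f : has_weak_deriv D s f -> is_weak_deriv D s f (weak_deriv D s f).
Proof. by move=> [g hg]; rewrite /weak_deriv; case: xgetP => [h -> //|/(_ g)]. Qed.

Lemma weak_derivE D s f g : open D -> is_weak_deriv D s f g ->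
  {ae area, forall x, D x -> weak_deriv D s f x = g x}.
Proof.
by move=> oD h; apply: (weak_deriv_unique oD (weak_derivP _) h); exists g.
Qed.

Lemma is_weak_derivZD D s (c : R) f g df dg : pmeasurable D ->
  is_weak_deriv D s f df -> is_weak_deriv D s g dg ->
  is_weak_deriv D s (fun x => c * f x + g x) (fun x => c * df x + dg x).
Proof.
move=> mD [lf ldf hf] [lg ldg hg]; split; [exact: loc_integrableZD..|] => chi tc.
have tp := test_partials s tc.
under eq_Rintegral do rewrite mulrDl -mulrA.
under [in RHS]eq_Rintegral do rewrite mulrDl -mulrA.
rewrite !RintegralD ?RintegralZl//; try exact: (loc_integrable_test mD);
  try by apply: integrable_scale => //; exact: (loc_integrable_test mD).
by rewrite hf// hg// mulrDr mulrCA.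
Qed.

Lemma is_weak_deriv0 D f : loc_integrable D f -> is_weak_deriv D [::] f f.
Proof. by move=> lf; split => // chi tc /=; rewrite mul1r. Qed.

Lemma loc_integrableS D D' f : pmeasurable D -> pmeasurable D' -> D' `<=` D ->
  loc_integrable D f -> loc_integrable D' f.
Proof.
move=> mD mD' DD [mf fi]; split; first exact: measurable_funS mf.
by move=> K cK KD; apply: fi => //; exact: subset_trans DD.
Qed.

Lemma Rintegral_off D D' (f : plane R -> R) : pmeasurable D -> pmeasurable D' -> D' `<=` D ->
  (forall x, ~ D' x -> f x = 0) -> \int[area]_(x in D') f x = \int[area]_(x in D) f x.
Proof.
move=> mD mD' DD f0; rewrite [RHS](_ : _ = \int[area]_(x in D) (f \_ D') x).
  by rewrite -Rintegral_mkcondr (setIidr DD).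
by congr Rintegral; apply/funext => x; rewrite /patch; case: ifPn => //; rewrite notin_setE => /f0.
Qed.

Lemma is_weak_derivS D D' s f g : pmeasurable D -> pmeasurable D' -> D' `<=` D ->
  is_weak_deriv D s f g -> is_weak_deriv D' s f g.
Proof.
move=> mD mD' DD [lf lg h]; split; [exact: loc_integrableS lf|exact: loc_integrableS lg|].
move=> chi tc; have := h _ (test_sub DD tc).
rewrite -(Rintegral_off mD mD' DD); last first.
  by move=> x nDx; rewrite (test_function_off (test_partials s tc))// mulr0.
by rewrite -(Rintegral_off mD mD' DD)// => x nDx; rewrite (test_function_off tc)// mulr0.
Qed.

Lemma partials_rcons s i f : partials (rcons s i) f = partials s (partial i f).
Proof. by rewrite /partials foldr_rcons. Qed.

(* The weak derivative of order s is the classical one taken in the opposite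
   order, because integrating by parts reverses the order of the factors. *)
Lemma is_weak_deriv_smooth D s eta : pmeasurable D -> (forall k, Ck k eta) ->
  is_weak_deriv D s eta (partials (rev s) eta).
Proof.
move=> mD he.
have lp t : loc_integrable D (partials t eta).
  by apply: continuous_loc_integrable => //; apply: (@Ck_continuous _ 0%N); exact: Ck_partials.
split; [exact: (lp [::])|exact: lp|].
elim: s eta he {lp} => [|i s ih] eta he chi tc /=; first by rewrite mul1r.
rewrite -/(partials s chi) (integral_by_parts _ mD (test_partials s tc))// ih//; last first.
  by move=> k; exact: Ck_partial.
by rewrite rev_cons partials_rcons exprS mulN1r mulNr.
Qed.

Lemma weak_deriv_eq0 D s f : open D -> has_weak_deriv D s f ->
  (forall x, D x -> f x = 0) -> {ae area, forall x, D x -> weak_deriv D s f x = 0}.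
Proof.
move=> oD [g hg] f0; apply: weak_derivE => //; have [lf _ _] := hg; split => //.
  by apply: continuous_loc_integrable; [exact: open_measurable2|move=> x; exact: cvg_cst].
move=> chi tc; have E h (h0 : forall x, D x -> h x = 0) eta :
    \int[area]_(x in D) (h x * eta x) = 0.
  transitivity (\int[area]_(x in D) (0 : R)).
    by apply: eq_Rintegral => x; rewrite inE => Dx; rewrite h0// mul0r.
  by rewrite Rintegral_cst ?mul0r//; exact: open_measurable2.
by rewrite !E// mulr0.
Qed.

End WeakDerivatives.

(** * Sobolev seminorms and the Poincare inequality *)

Section SquareIntegrable.
Context {R : realType}.
Implicit Types (D : set (plane R)) (f g : plane R -> R).

Lemma ae_Rintegral D f g : pmeasurable D -> pmeasurable_fun D f -> pmeasurable_fun D g ->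
  {ae area, forall x, D x -> f x = g x} -> \int[area]_(x in D) f x = \int[area]_(x in D) g x.
Proof.
move=> mD mf mg fg; rewrite /Rintegral; congr fine.
apply: ae_eq_integral => //; try exact/measurable_EFinP.
by apply: filterS fg => x h Dx /=; rewrite h.
Qed.

Lemma integrable_ae_eq D f g : pmeasurable D -> area.-integrable D (EFin \o f) ->
  pmeasurable_fun D g -> {ae area, forall x, D x -> f x = g x} ->
  area.-integrable D (EFin \o g).
Proof.
move=> mD fi mg fg; have mf := measurable_int _ fi.
have mg' : pmeasurable_fun D (EFin \o g) by exact/measurable_EFinP.
move/integrableP : fi => [_ fi]; apply/integrableP; split => //.
suff <- : (\int[area]_(x in D) `|(EFin \o f) x| = \int[area]_(x in D) `|(EFin \o g) x|)%E by [].
apply: ae_eq_integral => //; try exact: measurableT_comp.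
by apply: filterS fg => x h Dx /=; rewrite h.
Qed.

Lemma square_integrableM D f g : pmeasurable D -> square_integrable D f -> square_integrable D g ->
  area.-integrable D (EFin \o (fun x => f x * g x)).
Proof.
move=> mD [mf fi] [mg gi].
apply: (@integrable_le _ _ _ (fun x => f x ^+ 2 + g x ^+ 2)) => //.
- exact: measurable_funM.
- exact: integrable_add.
- move=> x _; rewrite [leRHS]ger0_norm ?addr_ge0 ?sqr_ge0// ler_norml.
  have := sqr_ge0 (f x + g x); have := sqr_ge0 (f x - g x).
  have := sqr_ge0 (f x); have := sqr_ge0 (g x); rewrite sqrrB sqrrD; lra.
Qed.

Lemma square_integrableZD D c f g : pmeasurable D -> square_integrable D f ->
  square_integrable D g -> square_integrable D (fun x => c * f x + g x).
Proof.
move=> mD hf hg; have [mf fi] := hf; have [mg gi] := hg; split.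
  by apply: measurable_funD => //; exact: measurable_funM.
have -> : (fun x => ((c * f x + g x) ^+ 2)%:E) =
    EFin \o (fun x => (c ^+ 2 * f x ^+ 2 + (c *+ 2) * (f x * g x)) + g x ^+ 2).
  by apply/funext => x /=; congr EFin; ring.
apply: integrable_add => //; apply: integrable_add => //; first exact: integrable_scale.
by apply: integrable_scale => //; exact: square_integrableM.
Qed.

Lemma square_integrable_ae D f g : pmeasurable D -> square_integrable D f -> pmeasurable_fun D g ->
  {ae area, forall x, D x -> f x = g x} -> square_integrable D g.
Proof.
move=> mD [mf fi] mg fg; split => //.
apply: (@integrable_ae_eq _ (fun x => f x ^+ 2)) => //; first exact: measurable_funX.
by apply: filterS fg => x h Dx; rewrite h.
Qed.

(** Monotonicity of the integral asks for an inequality at every point: [g] is replaced by the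
    maximum of [g] and [f], which equals [g] almost everywhere and dominates [f] everywhere. *)
Lemma ae_le_Rintegral D f g : pmeasurable D -> pmeasurable_fun D f ->
  area.-integrable D (EFin \o g) -> (forall x, D x -> 0 <= f x) ->
  {ae area, forall x, D x -> f x <= g x} ->
  area.-integrable D (EFin \o f) /\ \int[area]_(x in D) f x <= \int[area]_(x in D) g x.
Proof.
move=> mD mf gi f0 fg; have [mg _] := integrableP _ _ _ gi.
have mg' : pmeasurable_fun D g by exact/measurable_EFinP.
pose h x := Num.max (g x) (f x).
have gh : {ae area, forall x, D x -> g x = h x}.
  by apply: filterS fg => x fg Dx; rewrite /h; apply/esym/max_idPl; exact: fg.
have mh : pmeasurable_fun D h by exact: measurable_maxr.
have hi : area.-integrable D (EFin \o h).
  exact: integrable_ae_eq gi mh gh.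
have fh x : D x -> f x <= h x by move=> _; rewrite /h le_max lexx orbT.
have fi : area.-integrable D (EFin \o f).
  apply: integrable_le hi _ => // x Dx; rewrite !ger0_norm ?f0 ?fh//.
  by rewrite (le_trans (f0 _ Dx))// fh.
by split => //; rewrite (ae_Rintegral mD mg' mh gh); apply: le_Rintegral.
Qed.

Lemma Rintegral_sum D (I : Type) (r : seq I) (F : I -> plane R -> R) : pmeasurable D ->
  (forall i, area.-integrable D (EFin \o F i)) ->
  area.-integrable D (EFin \o (fun x => \sum_(i <- r) F i x)) /\
  \int[area]_(x in D) (\sum_(i <- r) F i x) = \sum_(i <- r) \int[area]_(x in D) F i x.
Proof.
move=> mD Fi; elim: r => [|i r [ih1 ih2]].
  have E : (fun x => \sum_(i <- [::]) F i x) = cst 0 by apply/funext => x; rewrite big_nil.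
  by rewrite E big_nil Rintegral_cst// mul0r; split => //; exact: integrable0.
have E : (fun x => \sum_(j <- i :: r) F j x) = (fun x => F i x + \sum_(j <- r) F j x).
  by apply/funext => x; rewrite big_cons.
by rewrite E; split; [exact: integrable_add|rewrite RintegralD// big_cons ih2].
Qed.

End SquareIntegrable.

(** Both [bilin] and the squared seminorms are sums of these forms, so bilinearity and positivity
    are proved here once. The lock keeps the integral from being unfolded. *)
HB.lock Definition sform (R : realType) (D : set (plane R)) (s : seq 'I_2)
    (u v : plane R -> R) : R :=
  \int[area]_(x in D) (weak_deriv D s u x * weak_deriv D s v x).

(** Squared, so that energies of functions add up and compare without square roots. *)
HB.lock Definition Hsq (R : realType) (D : set (plane R)) (m : nat) (u : plane R -> R) : R :=
  Hsemi D m u ^+ 2.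

(** * Bilinear forms of weak derivatives *)

Section SobolevForms.
Context {R : realType}.
Implicit Types (D : set (plane R)) (f g u v w chi : plane R -> R) (s : seq 'I_2).

Lemma Hspace_weak D k f s : Hspace D k f -> (size s <= k)%N ->
  is_weak_deriv D s f (weak_deriv D s f) /\ square_integrable D (weak_deriv D s f).
Proof. by move=> Hf sk; have [/weak_derivP] := Hf _ sk. Qed.

Lemma weak_derivZD D s (c : R) u v : open D -> has_weak_deriv D s u -> has_weak_deriv D s v ->
  {ae area, forall x, D x ->
    weak_deriv D s (c *: u + v) x = c * weak_deriv D s u x + weak_deriv D s v x}.
Proof.
move=> oD /weak_derivP hu /weak_derivP hv; apply: weak_derivE => //.
by apply: is_weak_derivZD => //; exact: open_measurable2.
Qed.

Lemma HspaceZD D k (c : R) u v : open D -> Hspace D k u -> Hspace D k v ->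
  Hspace D k (c *: u + v).
Proof.
move=> oD Hu Hv s sk; have mD := open_measurable2 oD.
have [hu su] := Hspace_weak Hu sk; have [hv sv] := Hspace_weak Hv sk.
have hw := is_weak_derivZD c mD hu hv.
have hasw : has_weak_deriv D s (c *: u + v) by eexists; exact: hw.
split => //; have [_ [mw _] _] := weak_derivP hasw.
apply: square_integrable_ae (square_integrableZD c mD su sv) _ _ => //.
by apply: filterS (weak_derivE oD hw) => x h Dx; rewrite h.
Qed.

Lemma sformC D s u v : sform D s u v = sform D s v u.
Proof. by rewrite !sform.unlock; apply: eq_Rintegral => x _; rewrite mulrC. Qed.

Lemma sform_ge0 D s u : 0 <= sform D s u u.
Proof. by rewrite sform.unlock; apply: Rintegral_ge0 => x _; rewrite -expr2 sqr_ge0. Qed.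

Lemma sformZD D k s (c : R) u v w : open D -> (size s <= k)%N ->
  Hspace D k u -> Hspace D k v -> Hspace D k w ->
  sform D s (c *: u + v) w = c * sform D s u w + sform D s v w.
Proof.
move=> oD sk Hu Hv Hw; have mD := open_measurable2 oD.
have [hu su] := Hspace_weak Hu sk; have [hv sv] := Hspace_weak Hv sk.
have [hw sw] := Hspace_weak Hw sk; have [hz sz] := Hspace_weak (HspaceZD c oD Hu Hv) sk.
have [mu _] := su; have [mv _] := sv; have [mw _] := sw; have [mz _] := sz.
rewrite !sform.unlock -RintegralZl//; last exact: square_integrableM.
rewrite -RintegralD//; [|by apply: integrable_scale => //; exact: square_integrableM|
  exact: square_integrableM].
apply: ae_Rintegral => //; first exact: measurable_funM.
  apply: measurable_funD => //; last exact: measurable_funM.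
  by apply: measurable_funM => //; exact: measurable_funM.
apply: filterS (weak_derivZD c oD (ex_intro _ _ hu) (ex_intro _ _ hv)) => x h Dx.
by rewrite h// mulrDl mulrA.
Qed.

Lemma sform_test D s chi : open D -> test_function D chi ->
  sform D s chi chi = \int[area]_(x in D) (partials (rev s) chi x) ^+ 2.
Proof.
move=> oD tc; have mD := open_measurable2 oD; have [hC _ _] := tc.
have h := is_weak_deriv_smooth s mD hC.
have [_ [mw _] _] := weak_derivP (ex_intro _ _ h).
have cp : continuous (partials (rev s) chi) by exact: test_continuous (test_partials _ tc).
rewrite sform.unlock; apply: ae_Rintegral => //; first exact: measurable_funM.
- by apply: measurable_funX; exact: continuous_measurable2.
- by apply: filterS (weak_derivE oD h) => x e Dx; rewrite e// expr2.
Qed.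

Lemma test_Hspace D k chi : open D -> test_function D chi -> Hspace D k chi.
Proof.
move=> oD tc s _; have mD := open_measurable2 oD; have [hC _ _] := tc.
have h := is_weak_deriv_smooth s mD hC; split; first by eexists; exact: h.
have [_ [mw _] _] := weak_derivP (ex_intro _ _ h).
have tp := test_partials (rev s) tc; have cp := test_continuous tp; have [hCp _ _] := tp.
apply: (@square_integrable_ae _ _ (partials (rev s) chi)) => //; last first.
  by apply: filterS (weak_derivE oD h) => x e Dx; rewrite e.
split; first exact: continuous_measurable2.
have := test_integrable mD (test_sub (@subsetT _ D) (test_mulr hCp tp)).
by congr (_.-integrable _ _).
Qed.

Lemma big_tuple0 (F : 0.-tuple 'I_2 -> R) : \sum_(t : 0.-tuple 'I_2) F t = F [tuple].
Proof. by rewrite (big_pred1 [tuple])// => t; apply/esym/eqP; rewrite [t]tuple0; exact/val_inj. Qed.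

Lemma big_tupleS n (F : n.+1.-tuple 'I_2 -> R) :
  \sum_(t : n.+1.-tuple 'I_2) F t = \sum_i \sum_(t : n.-tuple 'I_2) F [tuple of i :: t].
Proof.
rewrite pair_big/= (reindex (fun p : 'I_2 * n.-tuple 'I_2 => [tuple of p.1 :: p.2]))//.
exists (fun t => (thead t, [tuple of behead t])) => /= [[i t] _|t _].
  by rewrite theadE; congr pair; exact/val_inj.
by rewrite -tuple_eta.
Qed.

Lemma Hsq_ge0 D m f : 0 <= Hsq D m f.
Proof. by rewrite Hsq.unlock sqr_ge0. Qed.

Lemma HsqE D m f : Hsq D m f = \sum_(s : m.-tuple 'I_2) sform D s f f.
Proof.
rewrite Hsq.unlock sqr_sqrtr; last first.
  by apply: sumr_ge0 => s _; apply: Rintegral_ge0 => x _; exact: sqr_ge0.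
by apply: eq_bigr => s _; rewrite sform.unlock; apply: eq_Rintegral => x _; rewrite expr2.
Qed.

Lemma Hsq0E D f : Hsq D 0 f = sform D [::] f f.
Proof. by rewrite HsqE big_tuple0. Qed.

Lemma Hsq1E D f : Hsq D 1 f = \sum_(i < 2) sform D [:: i] f f.
Proof. by rewrite HsqE big_tupleS; apply: eq_bigr => i _; rewrite big_tuple0. Qed.

Lemma Hsq2E D f : Hsq D 2 f = \sum_(i < 2) \sum_(j < 2) sform D [:: i; j] f f.
Proof.
rewrite HsqE big_tupleS; apply: eq_bigr => i _.
by rewrite big_tupleS; apply: eq_bigr => j _; rewrite big_tuple0.
Qed.

Lemma Hnorm_lt D k f (e : R) m : Hnorm D k f < e -> (m <= k)%N -> Hsq D m f < e ^+ 2.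
Proof.
move=> fe mk; have e0 : 0 <= e by rewrite (le_trans _ (ltW fe))// sqrtr_ge0.
apply: (@le_lt_trans _ _ (Hnorm D k f ^+ 2)); last first.
  by rewrite ltr_pXn2r// nnegrE// sqrtr_ge0.
have mk' : (m < k.+1)%N by [].
rewrite [leRHS]sqr_sqrtr; last by apply: sumr_ge0 => i _; exact: sqr_ge0.
rewrite (bigD1 (Ordinal mk'))//= Hsq.unlock lerDl sumr_ge0// => i _; exact: sqr_ge0.
Qed.

Lemma bilinE D v w : open D -> Hspace D 2 v -> Hspace D 2 w ->
  bilin D v w = \sum_(i < 2) \sum_(j < 2) sform D [:: i; j] v w.
Proof.
move=> oD Hv Hw; have mD := open_measurable2 oD.
have ii i j : area.-integrable D (EFin \o (fun x => weak_deriv D [:: i; j] v x * weak_deriv D [:: i; j] w x)).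
  have [_ sv] := Hspace_weak (s := [:: i; j]) Hv isT.
  have [_ sw] := Hspace_weak (s := [:: i; j]) Hw isT.
  exact: square_integrableM.
under eq_bigr do under eq_bigr do rewrite sform.unlock.
rewrite /bilin (Rintegral_sum _ mD _).2; last by move=> i; exact: (Rintegral_sum _ mD (ii i)).1.
by apply: eq_bigr => i _; exact: (Rintegral_sum _ mD (ii i)).2.
Qed.

Lemma bilin_sqr D v : open D -> Hspace D 2 v -> bilin D v v = Hsq D 2 v.
Proof. by move=> oD Hv; rewrite bilinE// Hsq2E. Qed.

Lemma bilinC D v w : bilin D v w = bilin D w v.
Proof.
by apply: eq_Rintegral => x _; apply: eq_bigr => i _; apply: eq_bigr => j _; rewrite mulrC.
Qed.

Lemma bilinZD D (c : R) u v w : open D -> Hspace D 2 u -> Hspace D 2 v -> Hspace D 2 w ->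
  bilin D (c *: u + v) w = c * bilin D u w + bilin D v w.
Proof.
move=> oD Hu Hv Hw; rewrite !bilinE//; last exact: HspaceZD.
rewrite mulr_sumr -big_split; apply: eq_bigr => i _ /=.
rewrite mulr_sumr -big_split; apply: eq_bigr => j _ /=.
by rewrite (sformZD (k := 2)).
Qed.

(** The expansions for [u + v] and [- u + v] sum to the parallelogram identity, whose second term is
    nonnegative. *)
Lemma sformDl2 D k s u v : open D -> (size s <= k)%N -> Hspace D k u -> Hspace D k v ->
  sform D s (u + v) (u + v) <= 2 * sform D s u u + 2 * sform D s v v.
Proof.
move=> oD sk Hu Hv.
have E c : sform D s (c *: u + v) (c *: u + v) =
    c ^+ 2 * sform D s u u + 2 * c * sform D s u v + sform D s v v.
  have Hw := HspaceZD c oD Hu Hv.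
  rewrite (sformZD c oD sk Hu Hv Hw) ![sform D s _ (c *: u + v)]sformC.
  rewrite (sformZD c oD sk Hu Hv Hu) (sformZD c oD sk Hu Hv Hv).
  rewrite (sformC D s v u); move: (sform D s u u) (sform D s u v) (sform D s v v) => a b d.
  ring.
have := E 1; have := E (-1); rewrite scale1r => e1 e2.
have := sform_ge0 D s (- 1 *: u + v); rewrite e1 e2.
clear E e1 e2; move: (sform D s u u) (sform D s u v) (sform D s v v) => a b d; lra.
Qed.

Lemma ler_sum2 (I : finType) (F G H : I -> R) : (forall i, F i <= 2 * G i + 2 * H i) ->
  \sum_i F i <= 2 * (\sum_i G i) + 2 * (\sum_i H i).
Proof. by move=> h; rewrite !mulr_sumr -big_split; apply: ler_sum. Qed.

Lemma HsqD_le D m u v : open D -> Hspace D m u -> Hspace D m v ->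
  Hsq D m (u + v) <= 2 * Hsq D m u + 2 * Hsq D m v.
Proof.
move=> oD Hu Hv; rewrite !HsqE; apply: ler_sum2 => s.
by apply: (sformDl2 (k := m)); rewrite ?size_tuple.
Qed.

Lemma HspaceW D k m u : (m <= k)%N -> Hspace D k u -> Hspace D m u.
Proof. by move=> mk Hu s sm; apply: Hu; exact: leq_trans mk. Qed.

End SobolevForms.

(** * The Poincare inequality and definiteness of the energy *)

Section Poincare.
Context {R : realType}.
Implicit Types (D : set (plane R)) (f g u v w chi : plane R -> R) (s : seq 'I_2) (i : 'I_2).

Lemma Ck_coord k i : Ck k (@coord R i).
Proof.
case: k => [|k]; first by split => //; exact: continuous_coord.
apply: (CkSP (df := fun j _ => if j == i then 1 else 0)); first exact: continuous_coord.
  move=> j x; have := is_derive_lift (a := 1) (d := 0) j (is_derive_id (1 * coord i x + 0) 1).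
  rewrite mulr1; congr is_derive.
  by apply/funext => y /=; rewrite mul1r addr0.
by move=> j; exact: Ck_cst.
Qed.

Lemma partial_coord i : partial i (@coord R i) = fun=> 1.
Proof.
apply: partialE => x.
have := is_derive_lift (a := 1) (d := 0) i (is_derive_id (1 * coord i x + 0) 1).
rewrite mulr1 eqxx; congr is_derive.
by apply/funext => y /=; rewrite mul1r addr0.
Qed.

Lemma coord_square M i (x : plane R) : square M x -> `|coord i x| <= M.
Proof. by rewrite /coord => -[]; rewrite /= !in_itv/= -!ler_norml; case: (i == 0). Qed.

Lemma test_sqr_integrable D chi : pmeasurable D -> test_function D chi ->
  area.-integrable D (EFin \o (fun x => chi x ^+ 2)).
Proof.
move=> mD tc; have [hC _ _] := tc.
have := test_integrable mD (test_sub (@subsetT _ D) (test_mulr hC tc)).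
by congr (_.-integrable _ _).
Qed.

(* Integrate the divergence of the field x_i chi^2 e_i. *)
Lemma poincare_test D chi M i : pmeasurable D -> D `<=` square M -> test_function D chi ->
  \int[area]_(x in D) chi x ^+ 2 <= 4 * M ^+ 2 * \int[area]_(x in D) partial i chi x ^+ 2.
Proof.
move=> mD DM tc; have [hC _ _] := tc; have tp := test_partial i tc.
have t2 := test_mulr hC tc; have t1 := test_mulr (fun k => Ck_coord k i) t2.
have := integral_partial i mD t1.
have C2 : Ck 1 (fun x => chi x * chi x) by exact: CkM.
rewrite (partialM _ (Ck_coord 1 i) C2) (partialM _ (hC 1%N) (hC 1%N)) partial_coord.
have ichi := test_sqr_integrable mD tc; have ip := test_sqr_integrable mD tp.
set h := fun x => _ => h0.
have ih : area.-integrable D (EFin \o h).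
  have := test_integrable mD (test_sub (@subsetT _ D) (test_partial i t1)).
  by rewrite (partialM _ (Ck_coord 1 i) C2) (partialM _ (hC 1%N) (hC 1%N)) partial_coord.
(* With [c = x_i], [X = chi] and [p] the partial derivative, the divergence is [X^2 + 2 c X p], and
   [(X + 2 c p)^2 >= 0] gives [X^2 + 2 c X p >= X^2 / 2 - 2 c^2 p^2] where [c^2 <= M^2]. *)
have : \int[area]_(x in D) (2^-1 * chi x ^+ 2 - 2 * M ^+ 2 * partial i chi x ^+ 2) <= 0.
  rewrite -h0; apply: le_Rintegral => //.
    by apply: integrable_sub => //; exact: integrable_scale.
  move=> x Dx; rewrite /h.
  have cM := coord_square i (DM _ Dx).
  have xM : coord i x ^+ 2 <= M ^+ 2.
    by rewrite -[leLHS]real_normK ?num_real// lerXn2r ?nnegrE// (le_trans _ cM).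
  move: (coord i x) (chi x) (partial i chi x) xM => c X p xM.
  have p0 := sqr_ge0 p; have := sqr_ge0 (X + 2 * c * p).
  have : 0 <= (M ^+ 2 - c ^+ 2) * p ^+ 2 by rewrite mulr_ge0// subr_ge0.
  by lra.
rewrite RintegralB//; try exact: integrable_scale.
rewrite !RintegralZl//; move: (Rintegral _ _ _) (Rintegral _ _ _) => a b; lra.
Qed.

Lemma sformZ2 D k s (c : R) u v : open D -> (size s <= k)%N -> Hspace D k u -> Hspace D k v ->
  sform D s (c *: u + v) (c *: u + v) =
    c ^+ 2 * sform D s u u + 2 * c * sform D s u v + sform D s v v.
Proof.
move=> oD sk Hu Hv; have Hw := HspaceZD c oD Hu Hv.
rewrite (sformZD c oD sk Hu Hv Hw) ![sform D s _ (c *: u + v)]sformC.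
rewrite (sformZD c oD sk Hu Hv Hu) (sformZD c oD sk Hu Hv Hv) (sformC D s v u).
by move: (sform D s u u) (sform D s u v) (sform D s v v) => a b d; ring.
Qed.

Lemma HsqN D m u : open D -> Hspace D m u -> Hsq D m (- u) = Hsq D m u.
Proof.
move=> oD Hu; rewrite !HsqE; apply: eq_bigr => s _.
(* Brings [- u] to the shape [c *: u + v] of the expansion lemma; the coefficients sum to
   [4 - 4 + 1 = 1]. *)
have -> : - u = (-2) *: u + u by rewrite scaleNr scaler_nat mulr2n opprD -addrA addNr addr0.
rewrite (@sformZ2 _ m)// ?size_tuple//; move: (sform D s u u) => a; ring.
Qed.

Lemma HspaceB D k u v : open D -> Hspace D k u -> Hspace D k v -> Hspace D k (u - v).
Proof. by move=> oD Hu Hv; rewrite addrC -[- v]scaleN1r; exact: HspaceZD. Qed.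

Lemma HsqB_sym D m u v : open D -> Hspace D m u -> Hspace D m v ->
  Hsq D m (u - v) = Hsq D m (v - u).
Proof. by move=> oD Hu Hv; rewrite -(HsqN oD (HspaceB oD Hu Hv)) opprB. Qed.

Lemma Hsq_test0 D chi : open D -> test_function D chi ->
  Hsq D 0 chi = \int[area]_(x in D) chi x ^+ 2.
Proof. by move=> oD tc; rewrite Hsq0E sform_test. Qed.

Lemma Hsq_test1 D chi : open D -> test_function D chi ->
  Hsq D 1 chi = \sum_(i < 2) \int[area]_(x in D) partial i chi x ^+ 2.
Proof. by move=> oD tc; rewrite Hsq1E; apply: eq_bigr => i _; rewrite sform_test. Qed.

Lemma Hsq_test2 D chi : open D -> test_function D chi ->
  Hsq D 2 chi = \sum_(i < 2) \sum_(j < 2) \int[area]_(x in D) partial j (partial i chi) x ^+ 2.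
Proof.
move=> oD tc; rewrite Hsq2E; apply: eq_bigr => i _; apply: eq_bigr => j _.
by rewrite sform_test.
Qed.

Lemma Hsq_test_step0 D chi M : open D -> D `<=` square M -> test_function D chi ->
  Hsq D 0 chi <= 4 * M ^+ 2 * Hsq D 1 chi.
Proof.
move=> oD DM tc; have mD := open_measurable2 oD; rewrite (Hsq_test0 oD tc) (Hsq_test1 oD tc).
apply: le_trans (poincare_test ord0 mD DM tc) _.
apply: ler_wpM2l; first by rewrite mulr_ge0// sqr_ge0.
by rewrite big_ord_recl lerDl sumr_ge0// => i _; apply: Rintegral_ge0 => x _; exact: sqr_ge0.
Qed.

Lemma Hsq_test_step1 D chi M : open D -> D `<=` square M -> test_function D chi ->
  Hsq D 1 chi <= 4 * M ^+ 2 * Hsq D 2 chi.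
Proof.
move=> oD DM tc; have mD := open_measurable2 oD; rewrite (Hsq_test2 oD tc) (Hsq_test1 oD tc).
rewrite mulr_sumr; apply: ler_sum => i _.
apply: le_trans (poincare_test ord0 mD DM (test_partial i tc)) _.
apply: ler_wpM2l; first by rewrite mulr_ge0// sqr_ge0.
by rewrite big_ord_recl lerDl sumr_ge0// => j _; apply: Rintegral_ge0 => x _; exact: sqr_ge0.
Qed.

Lemma H20_Hspace D f : H20 D f -> Hspace D 2 f.
Proof. by case. Qed.

Lemma H20_approx D f (e : R) : H20 D f -> 0 < e ->
  exists2 chi, test_function D chi & forall m, (m <= 2)%N -> Hsq D m (f - chi) < e.
Proof.
(* For [r = min e 1] one has [r^2 <= r <= e], which turns the bound on the norm into a bound on its
   square. *)
move=> [_ _ _ h] e0; have e1 : 0 < Num.min e 1 by rewrite lt_min e0 ltr01.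
have [chi tc hc] := h _ e1; exists chi => // m m2.
apply: lt_le_trans (Hnorm_lt hc m2) _; rewrite expr2.
by rewrite (le_trans (_ : _ <= Num.min e 1 * 1)) ?ler_wpM2l ?ge_min ?lexx ?orbT ?(ltW e1)// mulr1 ge_min lexx.
Qed.

Lemma poincare_H20 D M f : open D -> D `<=` square M -> H20 D f ->
  Hsq D 0 f <= 4 * (4 * M ^+ 2) ^+ 2 * Hsq D 2 f.
Proof.
move=> oD DM Hf; have Hf2 := H20_Hspace Hf.
set K := (4 * M ^+ 2) ^+ 2; have K0 : 0 <= K by exact: sqr_ge0.
apply/ler_addgt0Pr => e e0.
(* An approximation error [d] contributes [2 d] directly, and [4 K d] through the inequality for
   [chi]. *)
have d0 : 0 < e / (2 + 4 * K) by rewrite divr_gt0//; lra.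
have [chi tc hc] := H20_approx Hf d0.
have Hc2 : Hspace D 2 chi by exact: test_Hspace.
have Hd := HspaceB oD Hf2 Hc2.
have h0 : Hsq D 0 f <= 2 * Hsq D 0 (f - chi) + 2 * Hsq D 0 chi.
  by rewrite -{1}(subrK chi f); apply: HsqD_le => //; exact: (@HspaceW _ _ 2).
have h2 : Hsq D 2 chi <= 2 * Hsq D 2 (f - chi) + 2 * Hsq D 2 f.
  rewrite (HsqB_sym oD Hf2 Hc2) -{1}(subrK f chi); apply: HsqD_le => //; exact: HspaceB.
have s0 := Hsq_test_step0 oD DM tc; have s1 := Hsq_test_step1 oD DM tc.
have := hc 0%N isT; have := hc 2%N isT.
have k1 : Hsq D 0 chi <= K * Hsq D 2 chi.
  have m0 : 0 <= 4 * M ^+ 2 by rewrite mulr_ge0// sqr_ge0.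
  by apply: le_trans s0 (le_trans (ler_wpM2l m0 s1) _); rewrite mulrA -expr2.
have := Hsq_ge0 D 2 f.
have ee : (2 + 4 * K) * (e / (2 + 4 * K)) = e by rewrite mulrC divfK// gt_eqF//; lra.
move: (e / (2 + 4 * K)) ee h0 h2 k1 => d ee.
move: (Hsq D 0 f) (Hsq D 2 f) (Hsq D 0 (f - chi)) (Hsq D 2 (f - chi)) (Hsq D 0 chi) (Hsq D 2 chi).
clear -K0 ee; move=> a0 a2 b0 b2 c0 c2 h0 h2 k1 a20 hb2 hb0.
have : K * c2 <= K * (2 * b2 + 2 * a2) by exact: ler_wpM2l.
have : K * b2 <= K * d by apply: ler_wpM2l => //; exact: ltW.
lra.
Qed.

(** A point of the open set lies in a rational rectangle contained in the set, and that rectangle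
    has positive area. This upgrades almost everywhere identities of continuous functions to
    identities. *)
Lemma negligible_open0 (U : set (plane R)) : open U -> area.-negligible U -> U = set0.
Proof.
move=> oU nU; apply/eqP; rewrite -[_ == _]negbK; apply/negP => /set0P[x Ux].
have [k kx kU] := open_rat_box oU Ux.
have mr := @measurable_rectangle R (rat_lo k) (rat_hi k).
have : area (open_rectangle (rat_lo k : plane R) (rat_hi k)) = 0%E.
  apply/(negligibleP _ mr); apply: negligibleS nU.
  by apply: subset_trans kU; exact: open_rectangle_sub_box.
move: kx; rewrite open_rectangleE => -[/= kx1 kx2].
rewrite /area product_measure1E//=.
have pos (a b t : R) : t \in `]a, b[ -> (0 < @lebesgue_measure R [set` `]a, b[])%E.
  rewrite in_itv/= => /andP[at_ tb]; rewrite lebesgue_measure_itv/= lte_fin.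
  by rewrite (lt_trans at_ tb) -EFinD lte_fin subr_gt0 (lt_trans at_ tb).
move=> /eqP; rewrite mule_eq0 => /orP[] /eqP e0.
  by have := pos _ _ _ kx1; rewrite e0 ltxx.
by have := pos _ _ _ kx2; rewrite e0 ltxx.
Qed.

Lemma Hsq0_eq0 D f : open D -> Hspace D 2 f -> continuous f -> Hsq D 0 f = 0 ->
  forall x, D x -> f x = 0.
Proof.
move=> oD Hf cf; have mD := open_measurable2 oD.
have [hw sw] := Hspace_weak (s := [::]) Hf isT; have [mw iw] := sw.
have [lf _ _] := hw; have fE := weak_derivE oD (is_weak_deriv0 lf).
rewrite Hsq0E sform.unlock => h0.
have {}h0 : (\int[area]_(x in D) `|(weak_deriv D [::] f x * weak_deriv D [::] f x)%:E| = 0)%E.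
  have ii := square_integrableM mD sw sw.
  have := integrable_fin_num mD ii; move=> fn.
  transitivity (\int[area]_(x in D) (weak_deriv D [::] f x * weak_deriv D [::] f x)%:E)%E.
    by apply: eq_integral => x _; rewrite gee0_abs// lee_fin -expr2 sqr_ge0.
  by rewrite -(fineK fn); congr EFin.
have mww : pmeasurable_fun D (fun x => (weak_deriv D [::] f x * weak_deriv D [::] f x)%:E).
  by apply/measurable_EFinP; exact: measurable_funM.
have := (ae_eq_integral_abs area mD mww).1 h0 => w0.
have U0 : D `&` [set x | f x != 0] = set0.
  apply: negligible_open0.
    apply: openI => //; have -> : [set x | f x != 0] = f @^-1` (~` [set 0]).
      by apply/seteqP; split => x /= /eqP.
    apply: open_comp; first by move=> x _; exact: cf.
    by apply: closed_openC; exact: closed_eq.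
  have : {ae area, forall x, D x -> f x = 0}.
    apply: filterS2 fE w0 => x e e' Dx; rewrite -(e Dx).
    have := e' Dx; rewrite /= => -[] /eqP; rewrite mulf_eq0 orbb => /eqP //.
  apply: negligibleS => x [Dx /eqP fx] /=.
  by move=> /(_ Dx).
move=> x Dx; apply: contrapT => /eqP fx.
have : (D `&` [set x | f x != 0]) x by [].
by rewrite U0.
Qed.

(** Definiteness of the energy form: the Poincare inequality gives 0 almost everywhere on [D], and
    the elements of [H20] are continuous and vanish outside [D]. *)
Lemma H20_eq0 D f : open D -> bounded_set D -> H20 D f -> Hsq D 2 f = 0 -> f = 0.
Proof.
move=> oD bD Hf h2; have [M _ DM] := bounded_sub_square bD.
have [cf f0 H2 _] := Hf; have := poincare_H20 oD DM Hf; rewrite h2 mulr0 => h0.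
have h : Hsq D 0 f = 0 by apply/eqP; rewrite eq_le h0 Hsq_ge0.
apply/funext => x; have [Dx|/f0//] := pselect (D x).
exact: (Hsq0_eq0 oD H2 cf h).
Qed.

End Poincare.

(** * Mollification *)

Section Taylor.
Context {R : realType}.
Implicit Types (f k u : plane R -> R) (x y z : plane R) (i : 'I_2).

Lemma lipschitz1 (h dh : R -> R) (L a b : R) : (forall t : R, is_derive t 1 h (dh t)) ->
  (forall t, `|dh t| <= L) -> `|h a - h b| <= L * `|a - b|.
Proof.
move=> hd dL; have ch : continuous h.
  by move=> t; apply/differentiable_continuous/derivable1_diffP; have [] := hd t.
wlog ba : a b / b <= a.
  move=> W; have [/W//|/ltW/W] := leP b a.
  by rewrite distrC [X in _ * X]distrC.
have [c _ ->] := MVT_segment ba (fun t _ => hd t) (continuous_subspaceT ch).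
by rewrite normrM ler_wpM2r.
Qed.

(** Two uses of the mean value theorem, for [h] and then for [dh]; the remainder is not sharpened by
    the usual factor 1/2. *)
Lemma taylor1 (h dh ddh : R -> R) (L a t : R) : (forall s : R, is_derive s 1 h (dh s)) ->
  (forall s : R, is_derive s 1 dh (ddh s)) -> (forall s, `|ddh s| <= L) ->
  `|h (a + t) - h a - t * dh a| <= L * t ^+ 2.
Proof.
move=> hd hdd dL; have L0 : 0 <= L by apply: le_trans (dL 0).
have ch : continuous h.
  by move=> s; apply/differentiable_continuous/derivable1_diffP; have [] := hd s.
have main c : `|c - a| <= `|t| -> `|dh c * t - t * dh a| <= L * t ^+ 2.
  move=> ca; rewrite [t * _]mulrC -mulrBl normrM -[t ^+ 2]real_normK ?num_real// expr2 mulrA.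
  by rewrite ler_wpM2r// (le_trans (lipschitz1 c a hdd dL)) ?ler_wpM2l.
have [t0|t0] := leP 0 t.
  have at_ : a <= a + t by rewrite lerDl.
  have [c ci ->] := MVT_segment at_ (fun s _ => hd s) (continuous_subspaceT ch).
  rewrite (_ : a + t - a = t); last by rewrite addrC addKr.
  apply: main; move: ci; rewrite in_itv/= => /andP[c1 c2].
  by rewrite (ger0_norm t0) ger0_norm ?subr_ge0//; lra.
have at_ : a + t <= a by lra.
have [c ci e] := MVT_segment at_ (fun s _ => hd s) (continuous_subspaceT ch).
have -> : h (a + t) - h a = dh c * t.
  by rewrite -[LHS]opprK opprB e -mulrN; congr (_ * _); lra.
apply: main; move: ci; rewrite in_itv/= => /andP[c1 c2].
by rewrite (ltr0_norm t0) ler0_norm ?subr_le0//; lra.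
Qed.

Lemma is_derive_along f i x : (forall y, is_derive y (unit_vec i) f (partial i f y)) ->
  forall t : R, is_derive t 1 (fun t => f (slice i x t)) (partial i f (slice i x t)).
Proof.
move=> hf t; rewrite -{1}(coord_slice i x t).
have E : (fun t0 : R => f (slice i x t0)) = (fun t0 => f (slice i (slice i x t) t0)).
  by apply/funext => u; rewrite slice_slice.
by rewrite E; apply/is_derive_slice.
Qed.

Definition dist1 x y : R := `|x.1 - y.1| + `|x.2 - y.2|.

(** The path from [x] to [y] goes through [(y.1, x.2)], along one coordinate at a time; hence the
    1-norm. *)
Lemma lipschitz2 f (L : R) x y : (forall i z, is_derive z (unit_vec i) f (partial i f z)) ->
  (forall i z, `|partial i f z| <= L) -> `|f x - f y| <= L * dist1 x y.
Proof.
move=> hf dL.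
have h1 := lipschitz1 x.1 y.1 (is_derive_along x (hf 0))
  (fun t => dL 0 (slice 0 x t)).
have h2 := lipschitz1 x.2 y.2 (is_derive_along (y.1, 0) (hf 1))
  (fun t => dL 1 (slice 1 (y.1, 0) t)).
move: h1 h2; rewrite /slice/= -!surjective_pairing => h1 h2.
rewrite /dist1 mulrDr; apply: le_trans (lerD h1 h2).
by rewrite (le_trans _ (ler_normD _ _))// addrA subrK.
Qed.

Lemma test_bounded f : test_function setT f -> exists2 L : R, 0 < L & forall x, `|f x| <= L.
Proof.
move=> tf; have /test_functionP[_ [K [cK _ f0 _]]] := tf.
have [L L0 fL] := compact_bounded_fun cK (test_continuous tf).
exists L => // x; have [/fL//|/f0 ->] := pselect (K x).
by rewrite normr0 ltW.
Qed.

End Taylor.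

(** * Convolution with a test function *)

Section Convolution.
Context {R : realType}.
Implicit Types (f g k u w : plane R -> R) (x y z : plane R) (i : 'I_2) (M N L : R).

Definition conv u k x : R := \int[area]_y (u y * k (x - y)).

Lemma test_square k : test_function setT k -> exists2 M, 0 < M &
  forall x, ~ square M x -> k x = 0.
Proof.
move=> /test_functionP[_ [K [cK _ k0 _]]]; have [M M0 KM] := compact_sub_square cK.
by exists M => // x nx; apply: k0 => /KM.
Qed.

Lemma squareP M x : square M x <-> `|x.1| <= M /\ `|x.2| <= M.
Proof. by rewrite /square/= !in_itv/= -!ler_norml. Qed.

(** One square outside which [k (z - .)] vanishes serves all [z] within distance 1 of [x], so
    difference quotients at [x] involve [u] only on a fixed compact set. *)
Lemma reflect_off k M x z y : (forall x, ~ square M x -> k x = 0) ->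
  `|z.1 - x.1| <= 1 -> `|z.2 - x.2| <= 1 -> ~ square (M + 1 + (`|x.1| + `|x.2|)) y ->
  k (z - y) = 0.
Proof.
move=> k0 z1 z2 ny; apply: k0 => /squareP[/= a b]; apply: ny; apply/squareP.
have := normr_ge0 x.1; have := normr_ge0 x.2.
have h (p q r : R) : `|p - q| <= 1 -> `|p - r| <= M -> `|r| <= M + 1 + `|q|.
  move=> pq pr; have -> : r = - (p - r) + (p - q) + q by ring.
  by rewrite (le_trans (ler_normD _ _))// lerD2r (le_trans (ler_normD _ _))// normrN lerD.
by move=> ? ?; have := h _ _ _ z1 a; have := h _ _ _ z2 b; split; lra.
Qed.

Lemma test_reflect k x : test_function setT k -> test_function setT (fun y => k (x - y)).
Proof.
move=> tk; have [M _ k0] := test_square tk; have [hC _ _] := tk.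
apply: (@test_functionI _ _ (square (M + 1 + (`|x.1| + `|x.2|)))) => //.
- by move=> n; apply: Ck_reflect.
- by apply: compact_setX; exact: segment_compact.
- by move=> y; apply: reflect_off; rewrite // subrr normr0.
Qed.

Lemma conv_integrable u k x : loc_integrable setT u -> test_function setT k ->
  area.-integrable setT (EFin \o (fun y => u y * k (x - y))).
Proof. by move=> lu tk; apply: loc_integrable_test => //; exact: test_reflect. Qed.

Lemma weighted_bound u w N L : loc_integrable setT u -> pmeasurable_fun setT w -> 0 <= L ->
  (forall y, `|w y| <= L) -> (forall y, ~ square N y -> w y = 0) ->
  `|\int[area]_y (u y * w y)| <= L * \int[area]_(y in square N) `|u y|.
Proof.
move=> lu mw L0 wL w0; have mN := @measurable_square R N; have [mu iu] := lu.
have iN : area.-integrable (square N) (EFin \o u).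
  by apply: iu => //; apply: compact_setX; exact: segment_compact.
have iNn : area.-integrable (square N) (EFin \o (fun y => `|u y|)) by exact: integrable_norm.
rewrite -(@Rintegral_off _ setT (square N))//; last by move=> y /w0 ->; rewrite mulr0.
rewrite -RintegralZl//.
have iw : area.-integrable (square N) (EFin \o (fun y => u y * w y)).
  apply: (@integrable_le _ _ _ (fun y => L * `|u y|)) => //.
  - by apply: measurable_funM; [exact: measurable_funS mu|exact: measurable_funS mw].
  - exact: integrable_scale.
  - by move=> y _; rewrite !normrM normr_id mulrC ler_wpM2r// (le_trans (wL y))// ler_norm.
apply: (@le_trans _ _ (\int[area]_(x in square N) `|u x * w x|)).
  exact: le_normr_Rintegral.
apply: le_Rintegral => //; [exact: integrable_norm|exact: integrable_scale|].
by move=> y _; rewrite normrM mulrC ler_wpM2r.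
Qed.

Lemma dist1_norm x z : `|z.1 - x.1| <= `|z - x| /\ `|z.2 - x.2| <= `|z - x|.
Proof. by rewrite prod_normE/= !le_max !lexx orbT. Qed.

Lemma continuous_test_reflect k x : test_function setT k ->
  pmeasurable_fun setT (fun y => k (x - y)).
Proof.
by move=> tk; apply: continuous_measurable2 => //; exact: test_continuous (test_reflect x tk).
Qed.

Lemma conv_lipschitz u k x : loc_integrable setT u -> test_function setT k ->
  exists2 L, 0 <= L & forall z, `|z.1 - x.1| <= 1 -> `|z.2 - x.2| <= 1 ->
    `|conv u k z - conv u k x| <= L * dist1 z x.
Proof.
move=> lu tk; have [M _ k0] := test_square tk; have [hC _ _] := tk.
have [L0 L00 kL0] := test_bounded (test_partial 0 tk).
have [L1 L10 kL1] := test_bounded (test_partial 1 tk).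
set N := M + 1 + (`|x.1| + `|x.2|).
set A := \int[area]_(y in square N) `|u y|.
have A0 : 0 <= A by exact: Rintegral_ge0.
exists ((L0 + L1) * A); first by rewrite mulr_ge0// addr_ge0 ?(ltW L00) ?(ltW L10).
move=> z z1 z2; rewrite /conv -RintegralB//; try exact: conv_integrable.
under eq_Rintegral do rewrite -mulrBr.
rewrite mulrAC; apply: weighted_bound => //.
- by apply: measurable_funB; exact: continuous_test_reflect.
- by rewrite mulr_ge0 ?addr_ge0 ?(ltW L00) ?(ltW L10).
- move=> y; have -> : dist1 z x = dist1 (z - y) (x - y).
    by rewrite /dist1/= !opprB !addrA !subrK.
  apply: lipschitz2; first by move=> i w; exact: (Ck_is_derive (hC 1%N)).
  move=> i w; have [->|i0] := eqVneq i 0; first by rewrite (le_trans (kL0 w))// lerDl ltW.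
  have -> : i = 1 by apply/val_inj; move: i i0 => [[|[|?]]//?].
  by rewrite (le_trans (kL1 w))// lerDr ltW.
- by move=> y ny; rewrite !(reflect_off k0 _ _ ny)// ?subrr// ?normr0.
Qed.

Lemma conv_continuous u k : loc_integrable setT u -> test_function setT k ->
  continuous (conv u k).
Proof.
move=> lu tk x; have [L L0 hL] := conv_lipschitz x lu tk.
apply/cvgrPdist_le => e e0.
have d0 : 0 < Num.min 1 (e / (2 * L + 1)) by rewrite lt_min ltr01 divr_gt0//; lra.
near=> z.
have zx : `|z - x| <= Num.min 1 (e / (2 * L + 1)).
  by rewrite distrC; near: z; apply: cvgr_dist_le => //; exact: cvg_id.
have [h1 h2] := dist1_norm x z; move: zx; rewrite le_min => /andP[zx1 zxe].
rewrite distrC (le_trans (hL z (le_trans h1 zx1) (le_trans h2 zx1)))//.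
have : dist1 z x <= 2 * (e / (2 * L + 1)) by rewrite /dist1; lra.
have E : (2 * L + 1) * (e / (2 * L + 1)) = e by rewrite mulrC divfK// gt_eqF//; lra.
have : 0 <= e / (2 * L + 1) by rewrite divr_ge0 ?(ltW e0)//; lra.
move: (e / (2 * L + 1)) E (dist1 z x) => d E r d00 rd.
have := ler_wpM2l L0 rd; lra.
Unshelve. all: by end_near. Qed.

(** Differentiation under the integral sign with [u] merely locally integrable: by [taylor1] the
    kernel's remainder is at most [L * h ^+ 2] uniformly in [y], and it vanishes outside a fixed
    square, where [u] has finite integral [A] in absolute value. *)
Lemma conv_is_derive u k i x : loc_integrable setT u -> test_function setT k ->
  is_derive x (unit_vec i) (conv u k) (conv u (partial i k) x).
Proof.
move=> lu tk; have [M _ k0] := test_square tk; have [hC _ _] := tk.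
have tki := test_partial i tk; have [L L0 kL] := test_bounded (test_partial i tki).
have [hCi _ _] := tki.
set N := M + 1 + (`|x.1| + `|x.2|).
set A := \int[area]_(y in square N) `|u y|.
have A0 : 0 <= A by exact: Rintegral_ge0.
have ki0 : forall y, ~ square M y -> partial i k y = 0.
  by apply: partial_off => //; apply: compact_closed2; apply: compact_setX; exact: segment_compact.
have uv : `|(unit_vec i : plane R).1| <= 1 /\ `|(unit_vec i : plane R).2| <= 1.
  by rewrite /unit_vec; case: (i == 0); rewrite /= normr0 normr1.
have main (h : R) : `|h| <= 1 ->
    `|conv u k (h *: unit_vec i + x) - conv u k x - h * conv u (partial i k) x| <= L * A * h ^+ 2.
  move=> h1; set z := h *: unit_vec i + x.
  have zx (p q r : R) : `|q| <= 1 -> `|h * q + r - r| <= 1.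
    by move=> q1; rewrite addrK normrM mulr_ile1.
  have zx1 : `|z.1 - x.1| <= 1 by apply: (zx 0); case: uv.
  have zx2 : `|z.2 - x.2| <= 1 by apply: (zx 0); case: uv.
  have iz := conv_integrable z lu tk; have ix := conv_integrable x lu tk.
  have ip := conv_integrable x lu tki.
  have -> : conv u k z - conv u k x - h * conv u (partial i k) x =
      \int[area]_y (u y * (k (z - y) - k (x - y) - h * partial i k (x - y))).
    rewrite /conv -RintegralZl// -!RintegralB//; last 2 first.
    - exact: integrable_sub.
    - exact: integrable_scale.
    by apply: eq_Rintegral => y _; ring.
  rewrite mulrAC; apply: weighted_bound => //.
  - apply: measurable_funB; first by apply: measurable_funB; exact: continuous_test_reflect.
    by apply: measurable_funM => //; exact: continuous_test_reflect.
  - by rewrite mulr_ge0 ?sqr_ge0 ?(ltW L0).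
  - move=> y; have := @taylor1 R (fun t => k (slice i (x - y) t))
      (fun t => partial i k (slice i (x - y) t))
      (fun t => partial i (partial i k) (slice i (x - y) t)) L (coord i (x - y)) h
      (is_derive_along _ (Ck_is_derive (hC 1%N) ^~ i))
      (is_derive_along _ (Ck_is_derive (hCi 1%N) ^~ i)) (fun s => kL _).
    by rewrite !slice_coord [_ + h]addrC slice_shift addrA.
  - move=> y ny; rewrite !(reflect_off k0 _ _ ny)// ?subrr ?normr0//.
    by rewrite (reflect_off ki0 _ _ ny)// ?subrr ?normr0// mulr0 subrr.
suff h : h^-1 *: ((conv u k \o shift x) (h *: unit_vec i) - conv u k x) @[h --> (0 : R)^'] -->
    conv u (partial i k) x.
  by apply: DeriveDef; [apply/cvg_ex; exists (conv u (partial i k) x)|exact/cvg_lim].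
apply/cvgrPdist_le => e e0.
have d0 : 0 < Num.min 1 (e / (L * A + 1)).
  by rewrite lt_min ltr01 divr_gt0// ltr_wpDl// mulr_ge0// ltW.
near=> h.
have h0 : h != 0 by near: h; exact: nbhs_dnbhs_neq.
have hd : `|h| <= Num.min 1 (e / (L * A + 1)).
  near: h; apply: nbhs_dnbhs; apply/nbhs_ballP; exists (Num.min 1 (e / (L * A + 1))) => // t.
  by rewrite /ball/= sub0r normrN => /ltW.
move: hd; rewrite le_min => /andP[h1 he].
rewrite distrC /= -[X in _ - X](mulKf h0) /GRing.scale/= -mulrBr normrM normfV.
rewrite ler_pdivrMl ?normr_gt0// (le_trans (main h h1))//.
rewrite -[h ^+ 2]real_normK ?num_real// (_ : L * A * _ = `|h| * (L * A * `|h|)); last by ring.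
apply: ler_wpM2l => //.
have LA : 0 <= L * A by rewrite mulr_ge0// ltW.
have E : (L * A + 1) * (e / (L * A + 1)) = e by rewrite mulrC divfK// gt_eqF//; lra.
have : 0 <= e / (L * A + 1) by rewrite divr_ge0 ?(ltW e0)//; lra.
move: (e / (L * A + 1)) E he => d E he d00.
have := ler_wpM2l LA he; lra.
Unshelve. all: by end_near. Qed.

Lemma partial_conv u k i : loc_integrable setT u -> test_function setT k ->
  partial i (conv u k) = conv u (partial i k).
Proof. by move=> lu tk; apply: partialE => x; exact: conv_is_derive. Qed.

Lemma partials_conv u k s : loc_integrable setT u -> test_function setT k ->
  partials s (conv u k) = conv u (partials s k).
Proof.
move=> lu tk; elim: s => //= i s ih.
by rewrite -/(partials s _) ih partial_conv//; exact: test_partials.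
Qed.

Lemma Ck_conv u k n : loc_integrable setT u -> test_function setT k -> Ck n (conv u k).
Proof.
move=> lu; elim: n k => [|n ih] k tk; first by split => //; exact: conv_continuous.
apply: (CkSP (df := fun i => conv u (partial i k))).
- exact: conv_continuous.
- by move=> i x; exact: conv_is_derive.
- by move=> i; apply: ih; exact: test_partial.
Qed.

End Convolution.

(** * The mollifier *)

Lemma sigma_finite_area (R : realType) : @sigma_finite _ (mplane R) R setT (@area R).
Proof.
exists (fun n => square n%:R).
  apply/seteqP; split => // x _; exists (Num.truncn (`|x.1| + `|x.2|)).+1 => //.
  have h : `|x.1| + `|x.2| <= (Num.truncn (`|x.1| + `|x.2|)).+1%:R.
    by apply/ltW; have /andP[_] := truncn_itv (addr_ge0 (normr_ge0 x.1) (normr_ge0 x.2)).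
  apply/squareP; split; apply: le_trans h; by rewrite ?lerDl ?lerDr.
by move=> n; split; [exact: measurable_square|exact: area_square].
Qed.

Definition bump0 (R : realType) (e : R) : plane R -> R := bump (- e, - e) (e, e) 0.

(** The bump on the square of half-side [e], divided by its integral; the latter is written as the
    convolution with the constant 1 at the origin. *)
HB.lock Definition rho (R : realType) (e : R) (z : plane R) : R :=
  (conv (fun=> 1) (bump0 e) 0)^-1 * bump0 e z.

HB.instance Definition _ (R : realType) :=
  Measure.copy (@area R) (@lebesgue_measure R \x @lebesgue_measure R)%E.
HB.instance Definition _ (R : realType) :=
  @Measure_isSigmaFinite.Build _ (mplane R) R (@area R) (@sigma_finite_area R).

Section Mollifier.
Context {R : realType}.
Implicit Types (f g k u w : plane R -> R) (x y z : plane R) (i : 'I_2) (e M L : R).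

Lemma area_fubini (f : plane R * plane R -> \bar R) :
  @measurable_fun _ _ (mplane R * mplane R)%type _ setT f -> (forall p, (0 <= f p)%E) ->
  @measurable_fun _ _ (mplane R) _ setT (fun x => \int[area]_y f (x, y))%E /\
  (\int[area]_x (\int[area]_y f (x, y)) = \int[area]_y (\int[area]_x f (x, y)))%E.
Proof.
move=> mf f0.
split; first exact: (@measurable_fun_fubini_tonelli_F _ _ (mplane R) (mplane R) R (@area R) f mf f0).
exact: (@fubini_tonelli _ _ (mplane R) (mplane R) R (@area R) (@area R) f mf f0).
Qed.

Lemma loc_integrable_cst (c : R) : loc_integrable setT (fun _ : plane R => c).
Proof. by apply: continuous_loc_integrable => // x; exact: cvg_cst. Qed.

Lemma Rintegral_reflect k x : \int[area]_y k (x - y) = conv (fun=> 1) k x.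
Proof. by apply: eq_Rintegral => y _; rewrite mul1r. Qed.

(* Translation invariance of the area, for smooth integrands: the derivative of
   the integral with respect to the shift vanishes. *)
Lemma conv1_cst k x : test_function setT k -> conv (fun=> 1) k x = conv (fun=> 1) k 0.
Proof.
move=> tk; have l1 := loc_integrable_cst 1.
have d0 i z : partial i (conv (fun=> 1) k) z = 0.
  rewrite partial_conv// -Rintegral_reflect.
  have [hC _ _] := tk.
  have := integral_partial i measurableT (test_reflect z tk).
  rewrite (partial_reflect _ _ (hC 1%N)).
  have E : (fun y => - partial i k (z - y)) = (fun y => (-1) * partial i k (z - y)).
    by apply/funext => y; rewrite mulN1r.
  rewrite E RintegralZl//; last first.
    by apply: test_integrable => //; apply: test_reflect; exact: test_partial.
  by rewrite mulN1r => /eqP; rewrite oppr_eq0 => /eqP.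
have := @lipschitz2 R (conv (fun=> 1) k) 0 x 0
  (fun i z => Ck_is_derive (Ck_conv 1%N l1 tk) z i).
rewrite mul0r => /(_ _)/wrap[|]; first by move=> i z; rewrite d0 normr0.
by rewrite normr_le0 subr_eq0 => /eqP.
Qed.

Lemma test_bump0 e : test_function setT (bump0 e).
Proof. exact: test_bump. Qed.

(** A zero integral would make the bump vanish almost everywhere, hence everywhere by continuity,
    whereas it is positive at the origin. *)
Lemma bump0_mass e : 0 < e -> 0 < conv (fun=> 1) (bump0 e) 0.
Proof.
move=> e0; rewrite lt_neqAle; apply/andP; split; last first.
  by apply: Rintegral_ge0 => y _; rewrite mul1r bump_ge0.
apply/negP => /eqP/esym h0.
have tb := test_reflect 0 (test_bump0 e); have cb := test_continuous tb.
have ib := test_integrable measurableT tb.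
have : (\int[area]_y `|(bump0 e (0 - y))%:E| = 0)%E.
  transitivity (\int[area]_y (bump0 e (0 - y))%:E)%E.
    by apply: eq_integral => x _; rewrite gee0_abs// lee_fin bump_ge0.
  by rewrite -(fineK (integrable_fin_num measurableT ib)); congr EFin; rewrite -h0 -Rintegral_reflect.
have mb : pmeasurable_fun setT (fun y => (bump0 e (0 - y))%:E).
  by apply/measurable_EFinP; exact: continuous_measurable2.
move=> /(ae_eq_integral_abs area measurableT mb).1 w0.
have U0 : [set y | bump0 e (0 - y) != 0] = set0.
  apply: negligible_open0.
    have -> : [set y | bump0 e (0 - y) != 0] = (fun y => bump0 e (0 - y)) @^-1` (~` [set 0]).
      by apply/seteqP; split => y /= /eqP.
    apply: open_comp; first by move=> y _; exact: cb.
    by apply: closed_openC; exact: closed_eq.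
  have : {ae area, forall y, bump0 e (0 - y) = 0}.
    by apply: filterS w0 => y e' ; have := e' I; case.
  by apply: negligibleS => y /= + e'; rewrite e' eqxx.
have : [set y | bump0 e (0 - y) != 0] 0.
  rewrite /= subr0 /bump0 /bump /coord/= !mulr0 !add0r !mulr1n !mul1r !opprK.
  by rewrite !mulf_neq0// /flat e0 expr0 mul1r gt_eqF// expR_gt0.
by rewrite U0.
Qed.

Lemma test_rho e : test_function setT (rho e).
Proof.
have -> : rho e = fun z => (conv (fun=> 1) (bump0 e) 0)^-1 * bump0 e z.
  by apply/funext => z; rewrite rho.unlock.
by apply: test_mulr; [move=> k; exact: Ck_cst|exact: test_bump0].
Qed.

Lemma rho_ge0 e z : 0 < e -> 0 <= rho e z.
Proof. by move=> e0; rewrite rho.unlock mulr_ge0 ?bump_ge0// invr_ge0 ltW// bump0_mass. Qed.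

Lemma rho_off e z : ~ square e z -> rho e z = 0.
Proof.
move=> nz; rewrite rho.unlock /bump0 bump_off ?mulr0// => /open_rectangle_sub_box h.
by apply: nz.
Qed.

(** Lets [rho e (x - y)] be integrated in [x] as well as in [y], which is needed once the order of
    integration has been exchanged. *)
Lemma rho_sym e z : rho e (- z) = rho e z.
Proof.
rewrite rho.unlock /bump0 /bump /coord/= !mulrN !opprK !mulNr !opprK; congr (_ * _).
by congr (_ * _); rewrite mulrC.
Qed.

Lemma rho_mass e x : 0 < e -> \int[area]_y rho e (x - y) = 1.
Proof.
move=> e0; under eq_Rintegral do rewrite rho.unlock.
rewrite RintegralZl//; last first.
  by apply: test_integrable => //; apply: test_reflect; exact: test_bump0.
by rewrite Rintegral_reflect conv1_cst ?mulVf ?gt_eqF ?bump0_mass//; exact: test_bump0.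
Qed.

Lemma rho_mass_integral e x : 0 < e -> (\int[area]_y (rho e (x - y))%:E = 1)%E.
Proof.
move=> e0; have ir := test_integrable measurableT (test_reflect x (test_rho e)).
by rewrite -(fineK (integrable_fin_num measurableT ir)); congr EFin; exact: rho_mass.
Qed.

Lemma conv_off u k M x : (forall y, u y != 0 -> ~ square M (x - y)) ->
  (forall z, ~ square M z -> k z = 0) -> conv u k x = 0.
Proof.
move=> h k0; transitivity (\int[area]_(y in (setT : set (plane R))) (0 : R)).
  apply: eq_Rintegral => y _; have [->|uy] := eqVneq (u y) 0; first by rewrite mul0r.
  by rewrite k0 ?mulr0//; exact: h.
by rewrite Rintegral_cst// mul0r.
Qed.

(** The definition of the weak derivative is applied to the test function [k (x - .)]. *)
Lemma weak_conv s u g k : is_weak_deriv setT s u g -> test_function setT k ->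
  partials s (conv u k) = conv g k.
Proof.
move=> [lu lg h] tk; rewrite partials_conv//; apply/funext => x.
have := h _ (test_reflect x tk); have [hC _ _] := tk.
rewrite partials_reflect// => e.
have : (-1) ^+ size s * conv u (partials s k) x = (-1) ^+ size s * conv g k x.
  rewrite -[X in _ = _ * X]/(\int[area]_y (g y * k (x - y))) -e -RintegralZl//.
    by apply: eq_Rintegral => y _; ring.
  by apply: conv_integrable => //; exact: test_partials.
by move=> /mulfI; apply; rewrite signr_eq0.
Qed.

Lemma conv_rho_le g L e x : loc_integrable setT g -> 0 < e ->
  {ae area, forall y, `|g y| <= L} -> `|conv g (rho e) x| <= L.
Proof.
move=> lg e0 gL; have ir := test_integrable measurableT (test_reflect x (test_rho e)).
have ig := conv_integrable x lg (test_rho e).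
have [mg _] := lg.
apply: (@le_trans _ _ (\int[area]_y `|g y * rho e (x - y)|)); first exact: le_normr_Rintegral.
rewrite -[leRHS]mulr1 -(rho_mass x e0) -RintegralZl//.
apply: (ae_le_Rintegral _ _ _ _ _).2 => //.
- apply: measurableT_comp => //; apply: measurable_funM => //.
  exact: continuous_test_reflect (test_rho e).
- exact: integrable_scale.
- by apply: filterS gL => y gy _; rewrite normrM (ger0_norm (rho_ge0 _ e0)) ler_wpM2r ?rho_ge0.
Qed.

Lemma cvg_conv_rho u x (d : R) : continuous u -> 0 < d ->
  exists2 e0, 0 < e0 & forall e, 0 < e <= e0 -> `|conv u (rho e) x - u x| <= d.
Proof.
move=> cu d0; have lu : loc_integrable setT u by exact: continuous_loc_integrable.
have nx : nbhs x [set y | `|u x - u y| < d].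
  by have /cvgrPdist_lt /(_ _ d0) := cu x.
have [e1 e10 h1] := nbhs_square nx; exists (e1 / 2); first by rewrite divr_gt0.
move=> e /andP[e0 ee]; have tr := test_rho e.
have ir := test_integrable measurableT (test_reflect x tr).
have ig := conv_integrable x lu tr.
have -> : conv u (rho e) x - u x = \int[area]_y ((u y - u x) * rho e (x - y)).
  rewrite -[X in _ - X]mulr1 -(rho_mass x e0) -RintegralZl// -RintegralB//; last first.
    exact: integrable_scale.
  by apply: eq_Rintegral => y _; rewrite mulrBl.
have idiff : area.-integrable setT (EFin \o (fun y => (u y - u x) * rho e (x - y))).
  have := integrable_sub measurableT ig (integrable_scale (u x) measurableT ir).
  by congr (_.-integrable _ _); apply/funext => y /=; rewrite mulrBl.
apply: (@le_trans _ _ (\int[area]_y `|(u y - u x) * rho e (x - y)|)).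
  exact: le_normr_Rintegral.
rewrite -[leRHS]mulr1 -(rho_mass x e0) -RintegralZl//.
apply: le_Rintegral => //; [exact: integrable_norm|exact: integrable_scale|].
move=> y _; rewrite normrM (ger0_norm (rho_ge0 _ e0)).
have [/squareP[/= a b]|n] := pselect (square e (x - y)); last by rewrite rho_off// !mulr0.
by rewrite ler_wpM2r ?rho_ge0// distrC ltW//; apply: h1; lra.
Qed.

(* Jensen's inequality for the probability density rho e (x - .). *)
Lemma conv_rho_sqr g e x : loc_integrable setT g -> square_integrable setT g -> 0 < e ->
  area.-integrable setT (EFin \o (fun y => g y ^+ 2 * rho e (x - y))) /\
  conv g (rho e) x ^+ 2 <= \int[area]_y (g y ^+ 2 * rho e (x - y)).
Proof.
move=> lg [mg ig2] e0; have tr := test_rho e.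
have ir := test_integrable measurableT (test_reflect x tr).
have ig := conv_integrable x lg tr.
have i2 : area.-integrable setT (EFin \o (fun y => g y ^+ 2 * rho e (x - y))).
  apply: loc_integrable_test (test_reflect x tr) => //.
  split; first exact: measurable_funX.
  by move=> K cK _; apply: integrableS ig2 => //; exact: compact_measurable2.
split => //; set m := conv g (rho e) x.
have : 0 <= \int[area]_y ((g y - m) ^+ 2 * rho e (x - y)).
  by apply: Rintegral_ge0 => y _; rewrite mulr_ge0 ?sqr_ge0 ?rho_ge0.
have -> : \int[area]_y ((g y - m) ^+ 2 * rho e (x - y)) =
    \int[area]_y ((g y ^+ 2 * rho e (x - y) - (m *+ 2) * (g y * rho e (x - y))) +
      m ^+ 2 * rho e (x - y)).
  by apply: eq_Rintegral => y _; ring.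
rewrite RintegralD//; last 2 first.
- by apply: integrable_sub => //; exact: integrable_scale.
- exact: integrable_scale.
rewrite RintegralB//; last exact: integrable_scale.
have -> : \int[area]_y (m *+ 2 * (g y * rho e (x - y))) = m *+ 2 * m by rewrite RintegralZl.
have -> : \int[area]_y (m ^+ 2 * rho e (x - y)) = m ^+ 2 by rewrite RintegralZl// rho_mass// mulr1.
move: (\int[area]_y _) => a; rewrite -mulr_natr; lra.
Qed.

(** Jensen's inequality at every point, then Tonelli's theorem: integrating [rho e (x - y)] in [x]
    leaves the integral of [g ^+ 2]. *)
Lemma conv_rho_L2 g e D : pmeasurable D -> loc_integrable setT g -> square_integrable setT g -> 0 < e ->
  \int[area]_(x in D) (conv g (rho e) x) ^+ 2 <= \int[area]_x (g x) ^+ 2.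
Proof.
move=> mD lg hg e0; have [mg ig2] := hg; have tr := test_rho e.
have cc := conv_continuous lg tr.
pose F (p : plane R * plane R) : \bar R := (g p.2 ^+ 2 * rho e (p.1 - p.2))%:E.
have F0 p : (0 <= F p)%E by rewrite lee_fin mulr_ge0 ?sqr_ge0 ?rho_ge0.
have msub : @measurable_fun _ _ (mplane R * mplane R)%type (mplane R) setT
    (fun p => p.1 - p.2).
  apply: measurable_fun_pair => /=.
  - by apply: measurable_funB; [exact: (measurableT_comp measurable_fst measurable_fst)
      |exact: (measurableT_comp measurable_fst measurable_snd)].
  - by apply: measurable_funB; [exact: (measurableT_comp measurable_snd measurable_fst)
      |exact: (measurableT_comp measurable_snd measurable_snd)].
have mF : @measurable_fun _ _ (mplane R * mplane R)%type _ setT F.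
  apply/measurable_EFinP; apply: measurable_funM.
    by apply: measurable_funX; exact: (measurableT_comp mg measurable_snd).
  apply: (measurableT_comp _ msub); apply: continuous_measurable2 => //.
  exact: test_continuous tr.
have FT : (\int[area]_x (\int[area]_y F (x, y)) = \int[area]_y (\int[area]_x F (x, y)))%E.
  exact: (area_fubini mF F0).2.
have ii : (\int[area]_x (\int[area]_y F (x, y)) = \int[area]_x (g x ^+ 2)%:E)%E.
  rewrite FT; apply: eq_integral => y _ /=.
  under eq_integral => x _ do rewrite /F/= EFinM -rho_sym opprB.
  have := integralZl measurableT (test_integrable measurableT (test_reflect y tr)) (g y ^+ 2).
  by move=> ->; rewrite rho_mass_integral// mule1.
have mc : pmeasurable_fun setT (fun x => (conv g (rho e) x ^+ 2)%:E).
  by apply/measurable_EFinP; apply: measurable_funX; exact: continuous_measurable2.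
have cF : (\int[area]_x (conv g (rho e) x ^+ 2)%:E <= \int[area]_x (g x ^+ 2)%:E)%E.
  rewrite -ii; apply: ge0_le_integral => //.
  - by move=> x _; rewrite lee_fin sqr_ge0.
  - exact: (area_fubini mF F0).1.
  - move=> x _; have [h1 h2] := conv_rho_sqr x lg hg e0.
    rewrite -[X in (_ <= X)%E](fineK (integrable_fin_num measurableT h1)) lee_fin.
    exact: h2.
have fg := integrable_fin_num measurableT ig2.
rewrite -lee_fin /Rintegral [X in (_ <= X)%E]fineK//.
have DT : (\int[area]_(x in D) (conv g (rho e) x ^+ 2)%:E <=
    \int[area]_x (conv g (rho e) x ^+ 2)%:E)%E.
  by apply: ge0_subset_integral => // x _; rewrite lee_fin sqr_ge0.
rewrite fineK; first exact: le_trans DT cF.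
rewrite ge0_fin_numE; last by apply: integral_ge0 => x _; rewrite lee_fin sqr_ge0.
apply: le_lt_trans (le_trans DT cF) _.
by rewrite -ge0_fin_numE// integral_ge0// => x _; rewrite lee_fin sqr_ge0.
Qed.

End Mollifier.

(** * Products with W^2_oo functions *)

Section WeakLipschitz.
Context {R : realType}.
Implicit Types (D K : set (plane R)) (f g u psi chi eta : plane R -> R) (x y z : plane R) (i j : 'I_2).

Lemma Winf_le D m f (c : R) : (Winf_semi D m f <= c%:E)%E -> forall s : m.-tuple 'I_2,
  {ae area, forall x, D x -> `|weak_deriv D s f x| <= c}.
Proof.
move=> fc s; have := ess_sup_ge area (fun x => `|(weak_deriv D s f \_ D) x|%:E).
apply: filterS => x h Dx.
have : (`|(weak_deriv D s f \_ D) x|%:E <= c%:E)%E.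
  apply: le_trans h (le_trans _ fc); rewrite /Winf_semi.
  by rewrite (bigD1 s)//= le_max lexx.
by rewrite lee_fin /patch mem_set.
Qed.

(** The mollified function has classical partial derivatives that are averages of [g], hence bounded
    by [L]; by continuity of [f] its values converge at [x] and at [y]. *)
Lemma weak_lipschitz f (L : R) : continuous f ->
  (forall i, exists2 g, is_weak_deriv setT [:: i] f g & {ae area, forall x, `|g x| <= L}) ->
  forall x y, `|f x - f y| <= L * dist1 x y.
Proof.
move=> cf h x y; have lf : loc_integrable setT f by exact: continuous_loc_integrable.
apply/ler_addgt0Pr => d d0; have d20 : 0 < d / 2 by rewrite divr_gt0.
have [e1 e10 h1] := cvg_conv_rho x cf d20; have [e2 e20 h2] := cvg_conv_rho y cf d20.
pose e := Num.min e1 e2.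
have e0 : 0 < e by rewrite lt_min e10.
have c1 := h1 e; have c2 := h2 e.
rewrite e0 ge_min lexx in c1; rewrite e0 ge_min lexx orbT in c2.
have tr := test_rho e.
have l3 : `|conv f (rho e) x - conv f (rho e) y| <= L * dist1 x y.
  apply: lipschitz2; first by move=> i z; exact: (Ck_is_derive (Ck_conv 1%N lf tr)).
  move=> i z; have [g hg gL] := h i; have pE := weak_conv hg tr.
  rewrite /= in pE; rewrite pE.
  by apply: conv_rho_le => //; have [] := hg.
have -> : f x - f y = - (conv f (rho e) x - f x) + (conv f (rho e) x - conv f (rho e) y) +
   (conv f (rho e) y - f y) by ring.
apply: le_trans (ler_normD _ _) _; apply: le_trans (lerD (ler_normD _ _) (lexx _)) _.
by rewrite normrN; have := c1 isT; have := c2 isT; lra.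
Qed.

Lemma loc_integrable_mulr D f g : pmeasurable D -> loc_integrable D f -> continuous g ->
  loc_integrable D (fun x => f x * g x).
Proof.
move=> mD [mf fi] cg; split.
  by apply: measurable_funM => //; exact: continuous_measurable2.
move=> K cK KD; have mK := compact_measurable2 cK.
have [M M0 gM] := compact_bounded_fun cK cg.
apply: (@integrable_le _ _ _ (fun x => M * f x)) => //.
- by apply: measurable_funM; [exact: measurable_funS mf|exact: continuous_measurable2].
- by apply: integrable_scale => //; exact: fi.
- by move=> x Kx; rewrite !normrM mulrC ler_wpM2r// (le_trans (gM _ Kx))// ler_norm.
Qed.

Lemma loc_integrable_add D f g : pmeasurable D -> loc_integrable D f -> loc_integrable D g ->
  loc_integrable D (fun x => f x + g x).
Proof.
move=> mD lf lg; have := loc_integrableZD 1 mD lf lg.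
by under eq_fun do rewrite mul1r.
Qed.

(** The derivative of [f] is tested against [chi * eta], which is again a test function. *)
Lemma weak_leibniz f g chi i : is_weak_deriv setT [:: i] f g -> test_function setT chi ->
  is_weak_deriv setT [:: i] (fun x => f x * chi x) (fun x => g x * chi x + f x * partial i chi x).
Proof.
move=> [lf lg h] tc; have tci := test_partial i tc.
have cc := test_continuous tc; have cci := test_continuous tci; have [hC _ _] := tc.
split.
- exact: loc_integrable_mulr.
- by apply: loc_integrable_add => //; exact: loc_integrable_mulr.
move=> eta te; have [hE _ _] := te; have tei := test_partial i te.
have tce : test_function setT (fun x => chi x * eta x) by exact: test_mulr.
have [hCi _ _] := tci.
have t1 : test_function setT (fun x => chi x * partial i eta x) by exact: test_mulr.
have t2 : test_function setT (fun x => partial i chi x * eta x) by exact: test_mulr.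
have i1 := loc_integrable_test measurableT lf t1.
have i2 := loc_integrable_test measurableT lf t2.
have i3 := loc_integrable_test measurableT lg tce.
have := h _ tce; rewrite /= (partialM _ (hC 1%N) (hE 1%N)) expr1 !mulN1r.
have -> : (fun x => f x * (chi x * partial i eta x + eta x * partial i chi x)) =
    (fun x => f x * (chi x * partial i eta x) + f x * (partial i chi x * eta x)).
  by apply/funext => x; ring.
rewrite RintegralD// => e.
have -> : \int[area]_x (f x * chi x * partial i eta x) =
    \int[area]_x (f x * (chi x * partial i eta x)).
  by apply: eq_Rintegral => x _; rewrite mulrA.
have -> : \int[area]_x ((g x * chi x + f x * partial i chi x) * eta x) =
    \int[area]_x (g x * (chi x * eta x) + f x * (partial i chi x * eta x)).
  by apply: eq_Rintegral => x _; ring.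
by rewrite RintegralD// opprD -e addrK.
Qed.

(** Both derivatives of [f] are evaluated on [partial j chi] and [chi] respectively. This allows the
    first-order product rule to be iterated. *)
Lemma weak_deriv_peel D f g h i j : is_weak_deriv D [:: i] f g -> is_weak_deriv D [:: i; j] f h ->
  is_weak_deriv D [:: j] g h.
Proof.
move=> [_ lg e1] [_ lh e2]; split => // chi tc.
move: (e1 _ (test_partial j tc)) (e2 _ tc) => /= ->.
move: (Rintegral _ _ _) (Rintegral _ _ _) => a b; rewrite sqrrN expr1n !expr1; lra.
Qed.

Lemma weak_deriv_cons D f g h i j : is_weak_deriv D [:: i] f g -> is_weak_deriv D [:: j] g h ->
  is_weak_deriv D [:: i; j] f h.
Proof.
move=> [lf _ e1] [_ lh e2]; split => // chi tc.
move: (e1 _ (test_partial j tc)) (e2 _ tc) => /= -> ->.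
by rewrite mulrA -exprD.
Qed.

(** The product rule for the second derivative of [psi * chi], where [G s] stands for the weak
    derivative of [psi] along [s]. *)
Definition leibniz2 (G : seq 'I_2 -> plane R -> R) psi chi i j x : R :=
  G [:: i; j] x * chi x + G [:: i] x * partial j chi x +
  (G [:: j] x * partial i chi x + psi x * partial j (partial i chi) x).

Lemma weak_leibniz2 psi chi (G : seq 'I_2 -> plane R -> R) i j :
  (forall s, (size s <= 2)%N -> is_weak_deriv setT s psi (G s)) -> test_function setT chi ->
  is_weak_deriv setT [:: i; j] (fun x => psi x * chi x) (leibniz2 G psi chi i j).
Proof.
move=> hG tc; apply: (weak_deriv_cons (weak_leibniz (hG [:: i] isT) tc)).
have h1 := weak_leibniz (weak_deriv_peel (hG [:: i] isT) (hG [:: i; j] isT)) tc.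
have h2 := weak_leibniz (hG [:: j] isT) (test_partial i tc).
have := is_weak_derivZD 1 measurableT h1 h2.
by under eq_fun do rewrite mul1r; under [X in is_weak_deriv _ _ _ X]eq_fun do rewrite mul1r.
Qed.

Lemma compact_thicken D K : open D -> compact K -> K `<=` D ->
  exists2 e : R, 0 < e & forall x y, K x -> square e (y - x) -> D y.
Proof.
move=> oD /compact_near_coveringP cK KD.
have := cK R (0 : R)^'+ (fun e x => forall y, square e (y - x) -> D y) _.
case.
  move=> x Kx; have [r r0 xr] := nbhs_square (open_nbhs_nbhs (conj oD (KD _ Kx))).
  have r20 : 0 < r / 2 by rewrite divr_gt0.
  exists ([set y | `|x - y| < r / 2], [set e | e < r / 2]) => /=.
    split; first by apply/nbhs_ballP; exists (r / 2) => //= y; rewrite -ball_normE.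
    by apply: nbhs_right_lt.
  move=> [z e] /= [xz er] y /squareP[/= a b].
  have [h1 h2] := dist1_norm z x; apply: xr.
    have -> : x.1 - y.1 = (x.1 - z.1) - (y.1 - z.1) by ring.
    by rewrite (le_lt_trans (ler_normB _ _))//; lra.
  have -> : x.2 - y.2 = (x.2 - z.2) - (y.2 - z.2) by ring.
  by rewrite (le_lt_trans (ler_normB _ _))//; lra.
move=> e /= e0 he; exists (e / 2); first by rewrite divr_gt0.
have := he (e / 2) _ _.
move=> H x y Kx; apply: (H _ _ _ Kx); last by rewrite divr_gt0.
by rewrite /= sub0r normrN gtr0_norm ?divr_gt0//; lra.
Qed.

(** The mollification vanishes outside the sum of [K] and the square of half-side [e], a compact set
    that stays inside [D] for small [e]. *)
Lemma test_conv D K f : open D -> compact K -> K `<=` D -> continuous f ->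
  (forall x, ~ K x -> f x = 0) ->
  exists2 e0 : R, 0 < e0 & forall e, 0 < e <= e0 -> test_function D (conv f (rho e)).
Proof.
move=> oD cK KD cf f0; have lf : loc_integrable setT f by exact: continuous_loc_integrable.
have [e0 e00 he] := compact_thicken oD cK KD; exists e0 => // e /andP[ep ee].
pose K' := (fun p : plane R * plane R => p.1 + p.2) @` (K `*` square e).
apply: (@test_functionI _ _ K').
- by move=> k; apply: Ck_conv => //; exact: test_rho.
- apply: continuous_compact; last first.
    by apply: compact_setX => //; apply: compact_setX; exact: segment_compact.
  by apply: continuous_subspaceT => p; exact: add_continuous.
- move=> _ [[a b] [/= Ka sb] <-]; apply: (he a) => //; rewrite addrC addKr.
  by move/squareP : sb => [s1 s2]; apply/squareP; split; lra.
- move=> x nx; apply: (@conv_off _ _ _ e); last by move=> z; exact: rho_off.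
  move=> y fy sq; apply: nx; exists (y, x - y); last by rewrite /= addrC subrK.
  by split => //=; apply: contrapT => /f0 e1; rewrite e1 eqxx in fy.
Qed.

End WeakLipschitz.

(** * Energy of a mollified product *)

Section MollifiedProduct.
Context {R : realType}.
Implicit Types (D F : set (plane R)) (psi chi : plane R -> R) (x : plane R) (i j : 'I_2) (c : nat -> R).

(** A bound for the square of [leibniz2], by [(p + q + r + t)^2 <= 4 (p^2 + q^2 + r^2 + t^2)]; here
    [c k] bounds the derivatives of order [k] of [psi]. *)
Definition leibniz_bound c chi i j x : R :=
  4 * (c 2 ^+ 2 * chi x ^+ 2 + c 1 ^+ 2 * partial j chi x ^+ 2 +
    (c 1 ^+ 2 * partial i chi x ^+ 2 + c 0 ^+ 2 * partial j (partial i chi) x ^+ 2)).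

Lemma leibniz_bound_ge0 c chi i j x : 0 <= leibniz_bound c chi i j x.
Proof. by rewrite /leibniz_bound mulr_ge0// !addr_ge0// mulr_ge0// sqr_ge0. Qed.

Let comb0r (a b d e p q r t : R) : p = 0 -> q = 0 -> r = 0 -> t = 0 ->
  a * p + b * q + (d * r + e * t) = 0.
Proof. by move=> -> -> -> ->; rewrite !mulr0 !addr0. Qed.

Let comb0l (a b d e p q r t : R) : a = 0 -> b = 0 -> d = 0 -> e = 0 ->
  a * p + b * q + (d * r + e * t) = 0.
Proof. by move=> -> -> -> ->; rewrite !mul0r !addr0. Qed.

Let sqr0 (p : R) : p = 0 -> p ^+ 2 = 0.
Proof. by move=> ->; rewrite expr0n. Qed.

Lemma leibniz2_le (G : seq 'I_2 -> plane R -> R) c psi chi i j x :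
  (forall s, s \in [:: [:: i; j]; [:: i]; [:: j]] -> `|G s x| <= c (size s)) -> `|psi x| <= c 0 ->
  leibniz2 G psi chi i j x ^+ 2 <= leibniz_bound c chi i j x.
Proof.
move=> hG hpsi; rewrite /leibniz2 /leibniz_bound.
have sq (a b d : R) : `|a| <= b -> (a * d) ^+ 2 <= b ^+ 2 * d ^+ 2.
  move=> ab; rewrite exprMn ler_wpM2r ?sqr_ge0// -[leLHS]real_normK ?num_real//.
  by rewrite lerXn2r ?nnegrE// (le_trans _ ab).
have h1 := sq _ _ (chi x) (hG [:: i; j] _).
have h2 := sq _ _ (partial j chi x) (hG [:: i] _).
have h3 := sq _ _ (partial i chi x) (hG [:: j] _).
rewrite !inE !eqxx ?orbT in h1 h2 h3; have {}h1 := h1 isT; have {}h2 := h2 isT; have {}h3 := h3 isT.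
have h4 := sq _ _ (partial j (partial i chi) x) hpsi.
have four (p q r t : R) : (p + q + (r + t)) ^+ 2 <= 4 * (p ^+ 2 + q ^+ 2 + (r ^+ 2 + t ^+ 2)).
  have := sqr_ge0 (p - q); have := sqr_ge0 (p - r); have := sqr_ge0 (p - t).
  have := sqr_ge0 (q - r); have := sqr_ge0 (q - t); have := sqr_ge0 (r - t).
  by lra.
apply: le_trans (four _ _ _ _) _; apply: ler_wpM2l => //.
by apply: lerD; apply: lerD.
Qed.

Lemma leibniz_bound_integrable c chi i j D F : pmeasurable D -> pmeasurable F ->
  test_function setT chi ->
  area.-integrable D (EFin \o (fun x => leibniz_bound c chi i j x * \1_F x)).
Proof.
move=> mD mF tc; have sq eta : test_function setT eta ->
    area.-integrable D (EFin \o (fun x => eta x ^+ 2)).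
  move=> te; have te2 := test_sqr_integrable measurableT te.
  exact: integrableS te2.
have ib : area.-integrable D (EFin \o leibniz_bound c chi i j).
  apply: integrable_scale => //; apply: integrable_add => //; apply: integrable_add => //;
    apply: integrable_scale => //; apply: sq => //; try exact: test_partial.
  by apply: test_partial; exact: test_partial.
have mb : pmeasurable_fun D (leibniz_bound c chi i j).
  by apply/measurable_EFinP; exact: measurable_int ib.
apply: integrable_le ib _ => //.
  by apply: measurable_funM => //; exact: measurable_indic.
move=> x _; rewrite normrM ler_piMr// indicE; case: (x \in F); rewrite ?normr1 ?normr0//.
Qed.

(** Locality: combined with [weak_deriv_eq0], a function vanishing on an open subset has weak
    derivatives vanishing almost everywhere there. *)
Lemma weak_deriv_sub D D' s f : open D -> open D' -> D' `<=` D -> has_weak_deriv D s f ->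
  {ae area, forall x, D' x -> weak_deriv D' s f x = weak_deriv D s f x}.
Proof.
move=> oD oD' DD /weak_derivP h; apply: weak_derivE => //.
by apply: is_weak_derivS h => //; exact: open_measurable2.
Qed.

(* [psi * chi] is merely a W^2_oo function, while H^2_0 is the closure of the
   test functions: mollifying it yields test functions of no greater energy. *)
Lemma mollified_product D F psi chi c : open D -> closed F -> test_function D chi ->
  continuous psi -> (forall s, (size s <= 2)%N -> has_weak_deriv setT s psi) ->
  (forall k, (k <= 2)%N -> (Winf_semi D k psi <= (c k)%:E)%E) ->
  (forall x, D x -> ~ F x -> psi x = 0) ->
  exists2 e0, 0 < e0 & forall e, 0 < e <= e0 ->
    test_function D (conv (fun x => psi x * chi x) (rho e)) /\
    Hsq D 2 (conv (fun x => psi x * chi x) (rho e)) <=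
      \sum_(i < 2) \sum_(j < 2) \int[area]_(x in D) (leibniz_bound c chi i j x * \1_F x).
Proof.
move=> oD clF tc cpsi hw hc psi0; have mD := open_measurable2 oD.
have mF := closed_measurable2 clF.
have tcT := test_sub (@subsetT _ D) tc; have cchi := test_continuous tc.
have /test_functionP[hC [K [cK KD chi0 chis0]]] := tc.
have cu : continuous (fun x => psi x * chi x) by move=> x; apply: cvgM; [exact: cpsi|exact: cchi].
have u0 x : ~ K x -> psi x * chi x = 0 by move=> /chi0 ->; rewrite mulr0.
have [e0 e00 he0] := test_conv oD cK KD cu u0.
exists e0 => // e ee; have tz := he0 e ee; split => //.
have /andP[ep _] := ee.
pose G s := weak_deriv setT s psi.
have hG s : (size s <= 2)%N -> is_weak_deriv setT s psi (G s) by move=> /hw/weak_derivP.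
have hW i j := weak_leibniz2 i j hG tcT.
have GD s : (size s <= 2)%N -> {ae area, forall x, D x -> `|G s x| <= c (size s)}.
  move=> s2; have h1 := weak_deriv_sub openT oD (@subsetT _ D) (hw _ s2).
  have h2 := Winf_le (hc _ s2) (in_tuple s).
  by apply: filterS2 h1 h2 => x e1 e2 Dx; rewrite /G -e1// e2.
have oDF : open (D `&` ~` F) by apply: openI => //; exact: closed_openC.
(* [F] is closed, so locality applies to [D] minus [F]; this is the origin of the indicator of [F]
   in the bound. *)
have GF s : (size s <= 2)%N -> {ae area, forall x, (D `&` ~` F) x -> G s x = 0}.
  move=> s2; have h1 := weak_deriv_sub openT oDF (@subsetT _ _) (hw _ s2).
  have h2 : {ae area, forall x, (D `&` ~` F) x -> weak_deriv (D `&` ~` F) s psi x = 0}.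
    apply: weak_deriv_eq0 => //; last by move=> x [Dx nF]; exact: psi0.
    exists (G s); apply: is_weak_derivS (hG _ s2) => //; exact: open_measurable2.
  by apply: filterS2 h1 h2 => x e1 e2 Dx; rewrite /G -e1// e2.
have psiD : {ae area, forall x, D x -> `|psi x| <= c 0}.
  have lpsi : loc_integrable D psi by exact: continuous_loc_integrable.
  have h1 := weak_derivE oD (is_weak_deriv0 lpsi).
  have h2 := Winf_le (hc 0%N isT) [tuple].
  by apply: filterS2 h1 h2 => x e1 e2 Dx; rewrite -e1// e2.
have ae2 (P : seq 'I_2 -> plane R -> Prop) : (forall s, (size s <= 2)%N ->
    {ae area, forall x, P s x}) -> forall i j,
    {ae area, forall x, forall s, s \in [:: [:: i; j]; [:: i]; [:: j]] -> P s x}.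
  move=> hP i j; apply: filterS3 (hP [:: i; j] isT) (hP [:: i] isT) (hP [:: j] isT).
  by move=> x p1 p2 p3 s; rewrite !inE => /or3P[] /eqP ->.
have Wle i j : {ae area, forall x, setT x ->
    leibniz2 G psi chi i j x ^+ 2 <= leibniz_bound c chi i j x * \1_F x}.
  have := ae2 _ GD i j; have := ae2 _ GF i j.
  apply: filterS3 psiD => x p1 p2 p3 _.
  (* The inequality has to hold on the whole plane, over which the L2 bound for mollifications
     integrates. Outside [D], [chi] and its derivatives vanish. *)
  have [Dx|nDx] := pselect (D x); last first.
    have nK : ~ K x by move=> /KD.
    have d1 : partial j chi x = 0 by exact: (chis0 [:: j] x nK).
    have d2 : partial i chi x = 0 by exact: (chis0 [:: i] x nK).
    have d3 : partial j (partial i chi) x = 0 by exact: (chis0 [:: j; i] x nK).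
    have -> : leibniz2 G psi chi i j x = 0 by apply: comb0r => //; exact: chi0.
    by rewrite expr0n mulr_ge0 ?leibniz_bound_ge0// indicE; case: (x \in F).
  have [Fx|nFx] := pselect (F x).
    rewrite indicE mem_set// mulr1; apply: leibniz2_le; last exact: p1.
    by move=> s sI; exact: p3.
  have g0 s (sI : s \in [:: [:: i; j]; [:: i]; [:: j]]) : G s x = 0 by exact: p2.
  have -> : leibniz2 G psi chi i j x = 0.
    by apply: comb0l; [by apply: g0; rewrite !inE eqxx|by apply: g0; rewrite !inE eqxx orbT|by apply: g0; rewrite !inE eqxx !orbT|exact: psi0].
  by rewrite expr0n mulr_ge0 ?leibniz_bound_ge0// indicE; case: (x \in F).
have W2 i j : [/\ loc_integrable setT (leibniz2 G psi chi i j),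
    square_integrable setT (leibniz2 G psi chi i j) &
    \int[area]_x leibniz2 G psi chi i j x ^+ 2 <=
      \int[area]_(x in D) (leibniz_bound c chi i j x * \1_F x)].
  have [_ lW _] := hW i j; have [mW _] := lW.
  have ib := leibniz_bound_integrable c i j measurableT mF tcT.
  have mW2 : pmeasurable_fun setT (fun x => leibniz2 G psi chi i j x ^+ 2).
    exact: measurable_funX.
  have [h1 h2] := ae_le_Rintegral measurableT mW2 ib (fun x _ => sqr_ge0 _) (Wle i j).
  split => //; rewrite (@Rintegral_off _ setT D)// => x nDx.
  have nK : ~ K x by move=> /KD.
  have d1 : partial j chi x = 0 by exact: (chis0 [:: j] x nK).
  have d2 : partial i chi x = 0 by exact: (chis0 [:: i] x nK).
  have d3 : partial j (partial i chi) x = 0 by exact: (chis0 [:: j; i] x nK).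
  have -> : leibniz_bound c chi i j x = 0.
    rewrite /leibniz_bound -[RHS](mulr0 4); congr (_ * _).
    by apply: comb0r; apply: sqr0 => //; exact: chi0.
  by rewrite mul0r.
(* [sform_test] reverses the order of differentiation, so the sums over the two directions are
   exchanged to match the right-hand side. *)
rewrite Hsq2E exchange_big; apply: ler_sum => i _; apply: ler_sum => j _ /=.
rewrite sform_test// (_ : rev [:: j; i] = [:: i; j])// (weak_conv (hW i j) (test_rho e)).
have [l1 s1 h1] := W2 i j.
by apply: le_trans h1; exact: conv_rho_L2.
Qed.

Let sum_comb (a b d p : R) (q : 'I_2 -> R) (r : 'I_2 -> 'I_2 -> R) :
  \sum_i \sum_j 4 * (a * p + b * q j + (b * q i + d * r i j)) =
  4 * (4 * a * p + 4 * b * (\sum_i q i) + d * (\sum_i \sum_j r i j)).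
Proof. by rewrite !big_ord_recl !big_ord0; ring. Qed.

Let Rintegral_comb D (a b d e : R) (f g h k : plane R -> R) : pmeasurable D ->
  area.-integrable D (EFin \o f) -> area.-integrable D (EFin \o g) ->
  area.-integrable D (EFin \o h) -> area.-integrable D (EFin \o k) ->
  \int[area]_(x in D) (4 * (a * f x + b * g x + (d * h x + e * k x))) =
  4 * (a * (\int[area]_(x in D) f x) + b * (\int[area]_(x in D) g x) +
      (d * (\int[area]_(x in D) h x) + e * (\int[area]_(x in D) k x))).
Proof.
move=> mD fi gi hi ki.
have sc (t : R) u : area.-integrable D (EFin \o u) -> area.-integrable D (EFin \o (fun x => t * u x)).
  exact: integrable_scale.
have i1 := integrable_add mD (sc a _ fi) (sc b _ gi).
have i2 := integrable_add mD (sc d _ hi) (sc e _ ki).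
rewrite (RintegralZl _ mD (integrable_add mD i1 i2)) (RintegralD mD i1 i2).
rewrite (RintegralD mD (sc a _ fi) (sc b _ gi)) (RintegralD mD (sc d _ hi) (sc e _ ki)).
by rewrite !RintegralZl.
Qed.

(** The zeroth-order term occurs for each of the four pairs [(i, j)]; a first-order term occurs
    through [i] and through [j], twice each. Hence the two inner factors 4. *)
Lemma leibniz_bound_test D chi c : open D -> test_function D chi ->
  \sum_(i < 2) \sum_(j < 2) \int[area]_(x in D) leibniz_bound c chi i j x =
  4 * (4 * c 2 ^+ 2 * Hsq D 0 chi + 4 * c 1 ^+ 2 * Hsq D 1 chi + c 0 ^+ 2 * Hsq D 2 chi).
Proof.
move=> oD tc; have mD := open_measurable2 oD.
have E i j : \int[area]_(x in D) leibniz_bound c chi i j x =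
    4 * (c 2 ^+ 2 * (\int[area]_(x in D) chi x ^+ 2) +
         c 1 ^+ 2 * (\int[area]_(x in D) partial j chi x ^+ 2) +
        (c 1 ^+ 2 * (\int[area]_(x in D) partial i chi x ^+ 2) +
         c 0 ^+ 2 * (\int[area]_(x in D) partial j (partial i chi) x ^+ 2))).
  apply: Rintegral_comb => //; apply: test_sqr_integrable => //; try exact: test_partial.
  by apply: test_partial; exact: test_partial.
transitivity (\sum_i \sum_j 4 * (c 2 ^+ 2 * (\int[area]_(x in D) chi x ^+ 2) +
         c 1 ^+ 2 * (\int[area]_(x in D) partial j chi x ^+ 2) +
        (c 1 ^+ 2 * (\int[area]_(x in D) partial i chi x ^+ 2) +
         c 0 ^+ 2 * (\int[area]_(x in D) partial j (partial i chi) x ^+ 2)))).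
  by apply: eq_bigr => i _; apply: eq_bigr => j _; exact: E.
rewrite (Hsq_test0 oD tc) (Hsq_test1 oD tc) (Hsq_test2 oD tc).
exact: (sum_comb _ _ _ _ (fun i => \int[area]_(x in D) partial i chi x ^+ 2)
  (fun i j => \int[area]_(x in D) partial j (partial i chi) x ^+ 2)).
Qed.

End MollifiedProduct.

(** * Additive Schwarz operators on finite-dimensional spaces *)

Lemma continuous_sum_fun (R : realType) (T : topologicalType) (I : Type) (r : seq I)
    (F : I -> T -> R) : (forall i, continuous (F i)) ->
  continuous (fun x => \sum_(i <- r) F i x).
Proof.
move=> cF; elim: r => [|i r ih].
  have -> : (fun x => \sum_(i <- [::]) F i x) = fun=> 0 by apply/funext => x; rewrite big_nil.
  by move=> x; exact: cvg_cst.
have -> : (fun x => \sum_(j <- i :: r) F j x) = (fun x => F i x + \sum_(j <- r) F j x).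
  by apply/funext => x; rewrite big_cons.
by move=> x; apply: cvgD; [exact: cF|exact: ih].
Qed.

Lemma continuousM_fun (R : realType) (T : topologicalType) (f g : T -> R) :
  continuous f -> continuous g -> continuous (fun x => f x * g x).
Proof. by move=> cf cg x; apply: cvgM; [exact: cf|exact: cg]. Qed.

Section FiniteDimensional.
Context {R : realType} {X : lmodType R}.
(** A symmetric positive definite form on a subspace with basis [e] and coordinates [ev]. The
    subspace is a set, not a type, since the spaces to come are sets of functions on the plane; the
    coordinates will be nodal values. *)
Variables (a : X -> X -> R) (V : set X) (n : nat) (e : 'I_n -> X) (ev : 'I_n -> X -> R).
Hypothesis V0 : V 0.
Hypothesis VZD : forall c u v, V u -> V v -> V (c *: u + v).
Hypothesis aC : forall u v, a u v = a v u.
Hypothesis aZD : forall c u v w, V u -> V v -> V w -> a (c *: u + v) w = c * a u w + a v w.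
Hypothesis a_ge0 : forall v, V v -> 0 <= a v v.
Hypothesis a_eq0 : forall v, V v -> a v v = 0 -> v = 0.
Hypothesis Ve : forall k, V (e k).
Hypothesis ev_span : forall v, V v -> v = \sum_k ev k v *: e k.
Hypothesis ev_free : forall (c : 'I_n -> R) k, ev k (\sum_l c l *: e l) = c k.

Let VD u v : V u -> V v -> V (u + v).
Proof. by move=> Vu Vv; rewrite -[u]scale1r; exact: VZD. Qed.

Let VZ c u : V u -> V (c *: u).
Proof. by move=> Vu; rewrite -[_ *: _]addr0; exact: VZD. Qed.

Let Vsum (I : Type) (r : seq I) (F : I -> X) : (forall i, V (F i)) -> V (\sum_(i <- r) F i).
Proof. by move=> VF; elim/big_rec: _ => // i u _ Vu; exact: VD. Qed.

Let Vcomb (c : 'I_n -> R) : V (\sum_l c l *: e l).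
Proof. by apply: Vsum => i; exact: VZ. Qed.

Lemma form0l w : V w -> a 0 w = 0.
Proof.
move=> Vw; have := aZD 1 V0 V0 Vw; rewrite scale1r addr0 mul1r => /eqP.
by rewrite -[X in X == _]addr0 (inj_eq (addrI _)) eq_sym => /eqP.
Qed.

Lemma formDl u v w : V u -> V v -> V w -> a (u + v) w = a u w + a v w.
Proof. by move=> Vu Vv Vw; have := aZD 1 Vu Vv Vw; rewrite scale1r mul1r. Qed.

Lemma formZl c u w : V u -> V w -> a (c *: u) w = c * a u w.
Proof. by move=> Vu Vw; have := aZD c Vu V0 Vw; rewrite addr0 form0l// addr0. Qed.

Lemma form_suml (I : Type) (r : seq I) (F : I -> X) w : (forall i, V (F i)) -> V w ->
  a (\sum_(i <- r) F i) w = \sum_(i <- r) a (F i) w.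
Proof.
move=> VF Vw; elim: r => [|i r ih]; first by rewrite !big_nil form0l.
by rewrite !big_cons formDl// ?ih//; exact: Vsum.
Qed.

Lemma form_cauchy u v : V u -> V v -> a u v ^+ 2 <= a u u * a v v.
Proof.
move=> Vu Vv; have [u0|u0] := eqVneq (a u u) 0.
  by rewrite (a_eq0 Vu u0) form0l// expr0n mulr_ge0// ?a_ge0// form0l.
have up : 0 < a u u by rewrite lt_neqAle eq_sym u0 a_ge0.
have := a_ge0 (VZD (- (a u v / a u u)) Vu Vv); set t := - _ => h.
have Vw := VZD t Vu Vv.
move: h; rewrite (aZD _ Vu Vv Vw) ![a _ (t *: u + v)]aC (aZD _ Vu Vv Vu) (aZD _ Vu Vv Vv).
rewrite (aC v u) => h.
have : 0 <= a u u * (t * (t * a u u + a u v) + (t * a u v + a v v)) by rewrite mulr_ge0// ltW.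
have E : a u u * t = - a u v by rewrite /t mulrN mulrC divfK.
clear Vw; move: t E h; move: (a u u) (a u v) (a v v) {u0} up => A B C A0 t E h.
have -> : A * (t * (t * A + B) + (t * B + C)) = (A * t) * (A * t) + 2 * (A * t) * B + A * C by ring.
rewrite E; lra.
Qed.

(** The Gram matrix of the basis is invertible because the form is definite, and solving with it
    gives the coordinates of the representative. *)
Lemma riesz (l : X -> R) : (forall c u v, V u -> V v -> l (c *: u + v) = c * l u + l v) ->
  exists2 u, V u & forall w, V w -> a u w = l w.
Proof.
move=> lZD; have l0 : l 0 = 0.
  have := lZD 1 0 0 V0 V0; rewrite scale1r addr0 mul1r => /eqP.
  by rewrite -[X in X == _]addr0 (inj_eq (addrI _)) eq_sym => /eqP.
pose G : 'M[R]_n := \matrix_(i, j) a (e i) (e j).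
have aG (c : 'rV[R]_n) j : a (\sum_l c 0 l *: e l) (e j) = (c *m G) 0 j.
  rewrite form_suml//; last by move=> i; exact: VZ.
  by rewrite mxE; apply: eq_bigr => i _; rewrite mxE formZl.
have GU : G \in unitmx.
  rewrite -row_free_unit; apply: inj_row_free => c cG.
  set v := \sum_l c 0 l *: e l.
  have vj j : a v (e j) = 0 by rewrite aG cG mxE.
  have v0 : v = 0.
    apply: a_eq0; first exact: Vcomb.
    rewrite {2}/v aC form_suml//; [|by move=> i; exact: VZ|exact: Vcomb].
    by apply: big1 => i _; rewrite formZl//; [rewrite (aC (e i)) vj mulr0|exact: Vcomb].
  have vk k : c 0 k = 0.
    have := ev_free (c 0) k; rewrite -/v v0 => <-.
    by have := ev_free (fun=> 0) k; rewrite big1// => i _; rewrite scale0r.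
  by apply/rowP => k; rewrite mxE vk.
pose c := (\row_j l (e j)) *m invmx G.
exists (\sum_k c 0 k *: e k); first exact: Vcomb.
have cl j : a (\sum_k c 0 k *: e k) (e j) = l (e j).
  by rewrite aG /c -mulmxA mulVmx// mulmx1 mxE.
have lsum (d : 'I_n -> R) : l (\sum_k d k *: e k) = \sum_k d k * l (e k).
  suff [] : V (\sum_k d k *: e k) /\ l (\sum_k d k *: e k) = \sum_k d k * l (e k) by [].
  elim/big_rec2: _ => [//|i x y _ [Vy ly]].
  by split; [exact: VZD|rewrite lZD// ly].
move=> w Vw; rewrite (ev_span Vw) aC form_suml//; last by move=> i; exact: VZ.
by rewrite lsum; apply: eq_bigr => i _; rewrite formZl// aC cl.
Qed.

(** A linear coordinate is represented by some [u], and the Cauchy-Schwarz inequality gives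
    [K = a u u]. This constant depends on the space; it only ever multiplies errors that tend to
    0. *)
Lemma ev_bounded k : (forall c u v, V u -> V v -> ev k (c *: u + v) = c * ev k u + ev k v) ->
  exists2 K, 0 <= K & forall v, V v -> ev k v ^+ 2 <= K * a v v.
Proof.
move=> evZD; have [u Vu hu] := riesz evZD.
by exists (a u u); [exact: a_ge0|move=> v Vv; rewrite -hu// form_cauchy].
Qed.

Let vect (c : 'rV[R]_n) := \sum_l c 0 l *: e l.

Let quad (b : X -> X -> R) (c : 'rV[R]_n) := \sum_i \sum_j c 0 i * c 0 j * b (e i) (e j).

Let continuous_quad b : continuous (quad b).
Proof.
apply: continuous_sum_fun => i; apply: continuous_sum_fun => j.
have cc k : continuous (fun c : 'rV[R]_n => c 0 k) by exact: coord_continuous.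
have c1 : continuous (fun _ : 'rV[R]_n => b (e i) (e j)) by exact: cst_continuous.
exact: (continuousM_fun (continuousM_fun (cc i) (cc j)) c1).
Qed.

Let sphere := [set c : 'rV[R]_n | \sum_i c 0 i ^+ 2 = 1].

Let compact_sphere : compact sphere.
Proof.
apply: bounded_closed_compact.
  exists 1; split => // M M1 c /= c1.
  rewrite (le_trans _ (ltW M1))// [leLHS](_ : _ = mx_norm c)// mx_normrE; apply/bigmax_leP; split => // -[i j] _ /=.
  rewrite (ord1 i) -(@ler_pXn2r _ 2)// ?nnegrE// expr1n -c1 (bigD1 j)//=.
  by rewrite real_normK ?num_real// lerDl sumr_ge0// => k _; exact: sqr_ge0.
have -> : sphere = (fun c : 'rV[R]_n => \sum_i c 0 i ^+ 2) @^-1` [set 1] by [].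
apply: closed_comp; last exact: closed_eq.
have cc k : continuous (fun c : 'rV[R]_n => c 0 k) by exact: coord_continuous.
by move=> c _; apply: continuous_sum_fun => i {}c; exact: (continuousM_fun (cc i) (cc i)).
Qed.

(** The quotient of [a (T v) v] by [a v v], written in coordinates, is continuous on the compact
    Euclidean sphere and attains its maximum there; by homogeneity this is the maximum over [V], and
    a maximizer is an eigenvector. *)
Lemma rayleigh_max (T : X -> X) (v0 : X) : V v0 -> v0 <> 0 ->
  (forall v, V v -> V (T v)) ->
  (forall c u v, V u -> V v -> T (c *: u + v) = c *: T u + T v) ->
  (forall u v, V u -> V v -> a (T u) v = a u (T v)) ->
  exists lambda v, [/\ V v, v <> 0, T v = lambda *: v &
    forall u, V u -> a (T u) u <= lambda * a u u].
Proof.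
move=> Vv0 v00 VT TZD Ts.
have Vvect c : V (vect c) by exact: Vcomb.
have T0 : T 0 = 0.
  have := TZD 1 _ _ V0 V0; rewrite !scale1r addr0 => /eqP.
  by rewrite -[X in X == _]addr0 (inj_eq (addrI _)) eq_sym => /eqP.
have Tsum (d : 'I_n -> R) : T (\sum_k d k *: e k) = \sum_k d k *: T (e k).
  suff [] : V (\sum_k d k *: e k) /\ T (\sum_k d k *: e k) = \sum_k d k *: T (e k) by [].
  elim/big_rec2: _ => [//|i x y _ [Vy ly]].
  by split; [exact: VZD|rewrite TZD// ly].
have quada c : quad a c = a (vect c) (vect c).
  rewrite /quad {1}/vect form_suml//; last by move=> i; exact: VZ.
  apply: eq_bigr => i _; rewrite formZl// aC form_suml//; last by move=> j; exact: VZ.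
  by rewrite mulr_sumr; apply: eq_bigr => j _; rewrite formZl// mulrA (aC (e j)).
have quadT c : quad (fun u v => a (T u) v) c = a (T (vect c)) (vect c).
  rewrite /quad {1}/vect Tsum form_suml//; last by move=> i; apply: VZ; exact: VT.
  apply: eq_bigr => i _; rewrite formZl//; last exact: VT.
  rewrite aC form_suml//; [|by move=> j; exact: VZ|exact: VT].
  rewrite mulr_sumr; apply: eq_bigr => j _; rewrite formZl//; last exact: VT.
  by rewrite mulrA (aC (e j)).
have qpos c : sphere c -> quad a c != 0.
  move=> sc; apply/eqP; rewrite quada => /(a_eq0 (Vvect c)) vc0.
  have c0 k : c 0 k = 0.
    have := ev_free (c 0) k; rewrite -/(vect c) vc0 => <-.
    by have := ev_free (fun=> 0) k; rewrite big1// => i _; rewrite scale0r.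
  move: sc; rewrite /sphere/= big1; first by move=> /esym/eqP; rewrite oner_eq0.
  by move=> i _; rewrite c0 expr0n.
have norm_sphere u : V u -> u <> 0 -> exists2 t : R, t != 0 & exists2 c, sphere c & u = t *: vect c.
  move=> Vu u0; pose s := \sum_i ev i u ^+ 2.
  have s0 : 0 <= s by apply: sumr_ge0 => i _; exact: sqr_ge0.
  have sn : s != 0.
    apply/eqP => /eqP; rewrite psumr_eq0; last by move=> i _; exact: sqr_ge0.
    move=> /allP h; apply: u0; rewrite (ev_span Vu); apply: big1 => i _.
    by have := h i; rewrite mem_index_enum sqrf_eq0 => /(_ isT)/eqP ->; rewrite scale0r.
  have sp : 0 < s by rewrite lt_neqAle eq_sym sn.
  exists (Num.sqrt s); first by rewrite sqrtr_eq0 -ltNge.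
  have ss : Num.sqrt s != 0 by rewrite sqrtr_eq0 -ltNge.
  exists (\row_i (ev i u / Num.sqrt s)).
    rewrite /sphere/= -(mulfV sn) mulr_suml; apply: eq_bigr => i _.
    by rewrite mxE exprMn exprVn sqr_sqrtr.
  rewrite {1}(ev_span Vu) /vect scaler_sumr; apply: eq_bigr => i _.
  by rewrite mxE scalerA mulrC divfK.
have [c0 sc0] : sphere !=set0.
  by have [t _ [c sc _]] := norm_sphere _ Vv0 v00; exists c.
have [c cS cmax] : exists2 c, c \in sphere & forall d, d \in sphere ->
    quad (fun u v => a (T u) v) d / quad a d <= quad (fun u v => a (T u) v) c / quad a c.
  apply: compact_EVT_max => //; first by exists c0.
  apply: continuous_in_subspaceT => d dS; rewrite inE in dS.
  have h1 := @continuous_quad (fun u v => a (T u) v) d; have h2 := @continuous_quad a d.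
  exact: (cvgM h1 (cvgV (qpos d dS) h2)).
rewrite inE in cS; set lambda := _ / _ in cmax.
have le u : V u -> a (T u) u <= lambda * a u u.
  move=> Vu; have [->|/eqP u0] := eqVneq u 0; first by rewrite T0 form0l// mulr0.
  have [t t0 [d sd ->]] := norm_sphere _ Vu u0.
  have Tt : T (t *: vect d) = t *: T (vect d).
    by have := TZD t _ _ (Vvect d) V0; rewrite !addr0 T0 addr0.
  rewrite Tt !formZl//; try exact: VT; try exact: VZ.
  rewrite ![a _ (t *: _)]aC !formZl//; last exact: VT.
  rewrite [a (vect d) (T _)]aC -quadT -quada.
  have : quad (fun u v => a (T u) v) d / quad a d <= lambda by apply: cmax; rewrite inE.
  have qp : 0 < quad a d by rewrite lt_neqAle eq_sym qpos// quada a_ge0.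
  rewrite ler_pdivrMr// => h.
  have gen (l A B : R) : A <= l * B -> t * (t * A) <= l * (t * (t * B)).
    move=> AB; have -> : l * (t * (t * B)) = t ^+ 2 * (l * B) by ring.
    by rewrite mulrA -expr2; apply: ler_wpM2l => //; exact: sqr_ge0.
  exact: gen.
have vc0 : vect c <> 0.
  by move=> vc; have := qpos _ cS; rewrite quada vc form0l// eqxx.
have eq0 : a (T (vect c)) (vect c) = lambda * a (vect c) (vect c).
  by rewrite -quadT -quada /lambda divfK// qpos.
exists lambda, (vect c); split => //.
have VTc := VT _ (Vvect c).
have ker w : V w -> lambda * a (vect c) w - a (T (vect c)) w = 0.
  move=> Vw; set d := _ - _; apply/eqP; rewrite -[_ == _]negbK; apply/negP => d0.
  pose q := lambda * a w w - a (T w) w.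
  have q0 : 0 <= q by rewrite subr_ge0 le.
  (* The form [lambda * a u u - a (T u) u] is nonnegative and vanishes at the maximizer; this
     polynomial is its value at [t *: w + vect c]. Taking [t = - d] if [q = 0], and [t = - d / q]
     otherwise, contradicts [d != 0]. *)
  have main (t : R) : 0 <= t ^+ 2 * q + 2 * t * d.
    have Vtw : V (t *: w + vect c) by exact: VZD.
    have := le _ Vtw; rewrite -subr_ge0 (TZD _ _ _ Vw (Vvect c)).
    have VTw := VT _ Vw; have VT2 : V (t *: T w + T (vect c)) by exact: VZD.
    rewrite (aZD _ VTw VTc Vtw) (aZD _ Vw (Vvect c) Vtw).
    rewrite ![a _ (t *: w + vect c)]aC !aZD//.
    rewrite (aC w (T w)) (aC w (T (vect c))) (aC (vect c) (T w)) (Ts _ _ Vw (Vvect c)) (aC w (T (vect c))).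
    rewrite (aC (vect c) (T (vect c))) eq0 (aC w (vect c)) /q /d.
    move: (a w w) (a (T w) w) (a (vect c) w) (a (T (vect c)) w) (a (vect c) (vect c)) => A B C D E h.
    by apply: le_trans h _; rewrite le_eqVlt; apply/orP; left; apply/eqP; clear; ring.
  have [qz|qz] := eqVneq q 0.
    have := main (- d); rewrite qz mulr0 add0r mulrN mulNr -mulrA oppr_ge0 -expr2.
    by rewrite pmulr_rle0// leNgt exprn_even_gt0// d0.
  have qp : 0 < q by rewrite lt_neqAle eq_sym qz.
  have := main (- (d / q)).
  have -> : (- (d / q)) ^+ 2 * q + 2 * - (d / q) * d = - (d ^+ 2 / q) by field.
  by rewrite oppr_ge0 leNgt divr_gt0// exprn_even_gt0.
have Vz : V (- lambda *: vect c + T (vect c)) by exact: VZD.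
apply/eqP; rewrite -subr_eq0 addrC -scaleNr; apply/eqP; apply: a_eq0 => //.
rewrite (aZD _ (Vvect c) VTc Vz); have := ker _ Vz.
by move=> /eqP; rewrite subr_eq0 => /eqP <-; rewrite mulNr addNr.
Qed.

(** * The abstract Schwarz bound *)

Section AdditiveSchwarz.
(** [P j] is the projection onto [W j] orthogonal for [a], that is, the local solve
    [I_j A_j^-1 I_j^t] composed with the stiffness operator; [T] is the preconditioned operator. *)
Variables (J : nat) (W : 'I_J -> set X) (P : 'I_J -> X -> X).
Hypothesis WV : forall j, W j `<=` V.
Hypothesis WZD : forall j c u v, W j u -> W j v -> W j (c *: u + v).
Hypothesis PW : forall j v, V v -> W j (P j v).
Hypothesis PE : forall j v w, V v -> W j w -> a (P j v) w = a v w.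

Let T v := \sum_j P j v.

Let PV j v : V v -> V (P j v).
Proof. by move=> Vv; apply: WV; exact: PW. Qed.

Let TV v : V v -> V (T v).
Proof. by move=> Vv; apply: Vsum => j; exact: PV. Qed.

(** Linearity follows from uniqueness: the difference of the two sides lies in [W j] and is
    orthogonal to itself. *)
Let PZD j c u v : V u -> V v -> P j (c *: u + v) = c *: P j u + P j v.
Proof.
move=> Vu Vv; have Vw := VZD c Vu Vv.
have Wz : W j (- 1 *: P j (c *: u + v) + (c *: P j u + P j v)).
  by apply: WZD; [exact: PW|apply: WZD; exact: PW].
apply/esym/eqP; rewrite -subr_eq0 addrC -scaleN1r; apply/eqP; apply: a_eq0; first exact: WV Wz.
have Vz := WV Wz; have VPu := PV j Vu; have VPv := PV j Vv; have VPw := PV j Vw.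
rewrite (aZD _ VPw (VZD _ VPu VPv) Vz) (aZD _ VPu VPv Vz) !PE// (aZD _ Vu Vv Vz).
by rewrite mulN1r addNr.
Qed.

Let TZD c u v : V u -> V v -> T (c *: u + v) = c *: T u + T v.
Proof.
by move=> Vu Vv; rewrite /T scaler_sumr -big_split; apply: eq_bigr => j _; exact: PZD.
Qed.

Let TE u v : V u -> V v -> a (T u) v = \sum_j a (P j u) (P j v).
Proof.
move=> Vu Vv; rewrite /T form_suml//; last by move=> j; exact: PV.
by apply: eq_bigr => j _; rewrite [RHS]aC (PE Vv (PW j Vu)) aC.
Qed.

Variables (K C : R).
Hypothesis K0 : 0 < K.
Hypothesis C0 : 0 < C.
Hypothesis overlap : forall w : 'I_J -> X, (forall j, W j (w j)) ->
  a (\sum_j w j) (\sum_j w j) <= K * \sum_j a (w j) (w j).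
Hypothesis stable : forall v, V v -> exists w : 'I_J -> X,
  [/\ forall j, W j (w j), v = \sum_j w j & \sum_j a (w j) (w j) <= C * a v v].

Let energy_ge0 v : V v -> 0 <= a (T v) v.
Proof. by move=> Vv; rewrite TE//; apply: sumr_ge0 => j _; apply: a_ge0; exact: PV. Qed.

(** The overlap hypothesis for [w_j = P j v] gives [a (T v) (T v) <= K * a (T v) v]; by the
    Cauchy-Schwarz inequality the square of [a (T v) v] is at most [K * a (T v) v * a v v], and one
    factor cancels. *)
Let energy_le v : V v -> a (T v) v <= K * a v v.
Proof.
move=> Vv; have s0 := energy_ge0 Vv.
have h1 : a (T v) (T v) <= K * a (T v) v.
  by rewrite (TE Vv Vv); apply: overlap => j; exact: PW.
have h2 := form_cauchy (TV Vv) Vv.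
have [s1|s1] := eqVneq (a (T v) v) 0; first by rewrite s1 mulr_ge0 ?a_ge0// ltW.
have sp : 0 < a (T v) v by rewrite lt_neqAle eq_sym s1.
rewrite -(ler_pM2l sp) -expr2 (le_trans h2)//.
by rewrite mulrCA mulrA ler_wpM2r ?a_ge0.
Qed.

(** Lions' argument: [a v v] is the sum of the [a (P j v) (w j)], each estimated by Young's
    inequality with weight [C]. The terms in [w j] then add up to at most [a v v], which is absorbed
    on the left. *)
Let energy_ge v : V v -> a v v <= C * a (T v) v.
Proof.
move=> Vv; have [w [Ww vE wC]] := stable Vv.
have E : a v v = \sum_j a (P j v) (w j).
  rewrite {1}vE form_suml//; last by move=> j; exact: WV.
  by apply: eq_bigr => j _; rewrite PE// aC.
have amgm j : 2 * a (P j v) (w j) <= C * a (P j v) (P j v) + C^-1 * a (w j) (w j).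
  have Vp := PV j Vv; have Vw := WV (Ww j).
  have Vz := VZD (- C) Vp Vw; have := a_ge0 Vz.
  rewrite (aZD _ Vp Vw Vz) ![a _ (- C *: _ + _)]aC !aZD// (aC (w j)).
  move: (a (P j v) (P j v)) (a (P j v) (w j)) (a (w j) (w j)) => A B D h.
  rewrite -(ler_pM2l C0) mulrDr [C * (C^-1 * D)]mulrA mulfV ?gt_eqF// mul1r.
  by rewrite -subr_ge0; apply: le_trans h _; rewrite le_eqVlt; apply/orP; left; apply/eqP; ring.
have : 2 * a v v <= C * a (T v) v + C^-1 * (C * a v v).
  rewrite {1}E mulr_sumr; apply: le_trans (ler_sum _ (fun j _ => amgm j)) _.
  rewrite big_split/= -!mulr_sumr -(TE Vv Vv) lerD2l.
  by apply: ler_wpM2l => //; rewrite invr_ge0 ltW.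
by rewrite mulrA mulVf ?gt_eqF// mul1r; lra.
Qed.

Lemma schwarz_condition v0 : V v0 -> v0 <> 0 ->
  let S := [set l : R | exists v, [/\ V v, v <> 0 & T v = l *: v]] in
  exists lmax lmin : R, [/\ S lmax /\ ubound S lmax, S lmin /\ lbound S lmin, 0 < lmin &
    lmax / lmin <= K * C].
Proof.
move=> Vv0 v00 S.
have Ts u v : V u -> V v -> a (T u) v = a u (T v).
  by move=> Vu Vv; rewrite [RHS]aC !TE//; apply: eq_bigr => j _; rewrite aC.
have pos v : V v -> v <> 0 -> 0 < a v v.
  move=> Vv v1; rewrite lt_neqAle a_ge0// andbT eq_sym; apply/eqP => /(a_eq0 Vv).
  exact: v1.
have eigE l v : V v -> T v = l *: v -> a (T v) v = l * a v v.
  by move=> Vv ->; rewrite formZl.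
have [lmax [v1 [Vv1 v10 Tv1 max1]]] := rayleigh_max Vv0 v00 TV TZD Ts.
(* The smallest eigenvalue of [T] is minus the largest eigenvalue of [- T]. *)
have NV v : V v -> V (- T v).
  by move=> Vv; rewrite -scaleN1r; apply: VZ; exact: TV.
have NZD c u v : V u -> V v -> - T (c *: u + v) = c *: - T u + - T v.
  by move=> Vu Vv; rewrite TZD// opprD scalerN.
have aN u v : V u -> V v -> a (- u) v = - a u v.
  by move=> Vu Vv; rewrite -scaleN1r formZl// mulN1r.
have Ns u v : V u -> V v -> a (- T u) v = a u (- T v).
  by move=> Vu Vv; rewrite [RHS]aC !aN//; try exact: TV; rewrite [a (T v) _]aC Ts.
have [m [v2 [Vv2 v20 Tv2 max2]]] := rayleigh_max Vv0 v00 NV NZD Ns.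
have Tv2' : T v2 = - m *: v2 by rewrite scaleNr -Tv2 opprK.
have min2 u : V u -> - m * a u u <= a (T u) u.
  by move=> Vu; have := max2 u Vu; rewrite aN//; [rewrite mulNr; lra|exact: TV].
have p1 := pos _ Vv1 v10; have p2 := pos _ Vv2 v20.
have lmaxK : lmax <= K.
  by rewrite -(ler_pM2r p1) -(eigE _ _ Vv1 Tv1); exact: energy_le.
have lminC : 1 <= C * - m.
  by rewrite -(ler_pM2r p2) mul1r -mulrA -(eigE _ _ Vv2 Tv2'); exact: energy_ge.
have lmin0 : 0 < - m by rewrite -(pmulr_rgt0 _ C0) (lt_le_trans ltr01).
exists lmax, (- m); split => //.
- split; first by exists v1.
  move=> l [v [Vv v1' Tv]]; rewrite -(ler_pM2r (pos _ Vv v1')) -(eigE _ _ Vv Tv).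
  exact: max1.
- split; first by exists v2.
  move=> l [v [Vv v1' Tv]]; rewrite -(ler_pM2r (pos _ Vv v1')) -(eigE _ _ Vv Tv).
  exact: min2.
- rewrite ler_pdivrMr// (le_trans lmaxK)// -mulrA ler_peMr// ltW//.
Qed.

End AdditiveSchwarz.

End FiniteDimensional.

(** * Interpolation and nodal bases *)

Local Notation patch := Defs.patch.

Section Interpolation.
Context {R : realType}.
Variables (Omega : set (plane R)) (h Cq Cphi CPi : R) (G : gfem R).
Hypothesis spec : gfem_spec Omega h Cq Cphi CPi G.
Implicit Types (u v zeta : plane R -> R) (x p : plane R) (i : 'I_(patch_count G)).

Lemma local_interpP i zeta : local_space i (local_interp i zeta) /\
  forall x, local_nodes i x -> local_interp i zeta x = zeta x.
Proof.
have [p [[hp hn] _]] := local_nodes_unisolvent spec i zeta.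
rewrite /local_interp; case: xgetP => [q _ [hq hqn]|/(_ p)/(_ (conj hp hn))//].
by split => // x ix; apply: hqn; rewrite inE.
Qed.

Lemma local_interp_eq i zeta q : local_space i q ->
  (forall x, local_nodes i x -> q x = zeta x) -> local_interp i zeta = q.
Proof.
move=> hq hqn; have [p [_ hu]] := local_nodes_unisolvent spec i zeta.
have [h1 h2] := local_interpP i zeta.
have e1 : p = local_interp i zeta by apply: hu; split => // x; rewrite inE => /h2.
by rewrite -e1; apply: hu; split => // x; rewrite inE => /hqn.
Qed.

(** At a node in the flat region of patch [i], the nonnegative functions other than [phi i] sum to
    [1 - 1 = 0]. Hence nodal values of a function of [V_h] are those of a single local
    polynomial. *)
Lemma node_flat i p : local_nodes i p ->
  [/\ Omega p, patch i p, phi i p = 1 & forall k, k != i -> phi k p = 0].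
Proof.
move=> /(local_nodes_flat spec)[Op [pi p1]]; split => // k ki.
have := phi_sum1 spec Op; rewrite (bigD1 i)//= p1 => /eqP.
rewrite -[X in _ == X]addr0 (inj_eq (addrI _)) psumr_eq0; last first.
  by move=> l _; exact: (phi_ge0 spec).
by move=> /allP /(_ k); rewrite mem_index_enum ki => /(_ isT)/eqP.
Qed.

Lemma sum_at_node i p (q : 'I_(patch_count G) -> plane R -> R) : local_nodes i p ->
  \sum_k phi k p * q k p = q i p.
Proof.
move=> /node_flat[_ _ p1 p0]; rewrite (bigD1 i)//= p1 mul1r big1 ?addr0// => k ki.
by rewrite p0// mul0r.
Qed.

Lemma interp_node zeta p : nodes G p -> interp Omega G zeta p = zeta p.
Proof.
move=> [i _ ip]; have [Op _ _ _] := node_flat ip.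
rewrite /interp patchE mem_set//.
under eq_bigr do rewrite mulrC.
by rewrite (sum_at_node (fun k => local_interp k zeta) ip); exact: (local_interpP i zeta).2.
Qed.

Lemma interp_Vh zeta : Vh Omega G (interp Omega G zeta).
Proof.
exists (fun i => local_interp i zeta); first by move=> i; exact: (local_interpP i zeta).1.
rewrite /interp; congr (_ \_ _); apply/funext => x.
by apply: eq_bigr => i _; rewrite mulrC.
Qed.

Lemma interp_id v : Vh Omega G v -> interp Omega G v = v.
Proof.
move=> [q hq vE]; have li i : local_interp i v = q i.
  apply: local_interp_eq => // x ix; have [Ox _ _ _] := node_flat ix.
  by rewrite vE patchE mem_set// (sum_at_node _ ix).
rewrite /interp {2}vE; congr (_ \_ _); apply/funext => x.
by apply: eq_bigr => i _; rewrite li mulrC.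
Qed.

Lemma eq_interp u v : (forall p, nodes G p -> u p = v p) -> interp Omega G u = interp Omega G v.
Proof.
move=> uv; rewrite /interp; congr (_ \_ _); apply/funext => x; apply: eq_bigr => i _.
congr (_ * _); have [h1 h2] := local_interpP i v.
by rewrite (@local_interp_eq i u (local_interp i v))// => y iy; rewrite h2// uv//; exists i.
Qed.

Lemma interpZD c u v : interp Omega G (c *: u + v) = c *: interp Omega G u + interp Omega G v.
Proof.
have li i : local_interp i (c *: u + v) = c *: local_interp i u + local_interp i v.
  have [hu1 hu2] := local_interpP i u; have [hv1 hv2] := local_interpP i v.
  apply: local_interp_eq; first by have [_] := local_space_linear spec i; apply.
  by move=> x ix; rewrite -[LHS]/(c * local_interp i u x + local_interp i v x) hu2// hv2.
apply/funext => x; rewrite -[RHS]/(c * interp Omega G u x + interp Omega G v x).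
rewrite /interp !patchE; case: ifPn => _; last by rewrite mulr0 addr0.
rewrite mulr_sumr -big_split; apply: eq_bigr => i _ /=; rewrite li.
by rewrite -[X in X * _]/(c * local_interp i u x + local_interp i v x) mulrDl mulrA.
Qed.

Lemma interp0 : interp Omega G 0 = 0.
Proof.
have := interpZD 1 0 0; rewrite !scale1r addr0 => /eqP.
by rewrite -[X in X == _]addr0 (inj_eq (addrI _)) eq_sym => /eqP.
Qed.

Lemma interp_sum (I : Type) (r : seq I) (F : I -> plane R -> R) :
  interp Omega G (\sum_(i <- r) F i) = \sum_(i <- r) interp Omega G (F i).
Proof.
elim: r => [|i r ih]; first by rewrite !big_nil interp0.
by rewrite !big_cons -[F i]scale1r interpZD ih !scale1r.
Qed.

(** [V_h] is the range of the linear projection [interp]. *)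
Lemma VhZD c u v : Vh Omega G u -> Vh Omega G v -> Vh Omega G (c *: u + v).
Proof. by move=> /interp_id <- /interp_id <-; rewrite -interpZD; exact: interp_Vh. Qed.

Lemma finite_nodes : finite_set (nodes G).
Proof. by apply: bigcup_finite => // i _; exact: (local_nodes_finite spec). Qed.

(** The common form of the truncated space, where [M] is [N], and of the local subspaces, where [M]
    is the part of [N] inside a subdomain. *)
Definition node_space (M : set (plane R)) : set (plane R -> R) :=
  [set v | Vh Omega G v /\ forall p, nodes G p -> ~ M p -> v p = 0].

Lemma node_spaceZD M c u v : node_space M u -> node_space M v -> node_space M (c *: u + v).
Proof.
move=> [Vu u0] [Vv v0]; split; first exact: VhZD.
by move=> p np nM; rewrite -[LHS]/(c * u p + v p) u0// v0// mulr0 addr0.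
Qed.

Lemma node_space0 M : node_space M 0.
Proof. by split => //; rewrite -interp0; exact: interp_Vh. Qed.

Definition nodal_basis p : plane R -> R := interp Omega G (fun q => if q == p then 1 else 0).

(** The Lagrange basis attached to the points of [M], delivered in the form that the
    finite-dimensional lemmas take as hypotheses, with evaluation at the listed nodes as
    coordinates. *)
Lemma node_space_basis M : M `<=` nodes G -> exists2 s : seq (plane R), uniq s &
  [/\ forall p, p \in s <-> M p,
      forall k : 'I_(size s), node_space M (nodal_basis (tnth (in_tuple s) k)),
      forall v, node_space M v ->
        v = \sum_k v (tnth (in_tuple s) k) *: nodal_basis (tnth (in_tuple s) k) &
      forall (c : 'I_(size s) -> R) (k : 'I_(size s)),
        (\sum_l c l *: nodal_basis (tnth (in_tuple s) l)) (tnth (in_tuple s) k) = c k].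
Proof.
move=> MN; have /finite_seqP[s0 Ms0] := sub_finite_set MN finite_nodes.
have ms p : p \in undup s0 <-> M p by rewrite mem_undup Ms0.
exists (undup s0); first exact: undup_uniq.
set s := undup s0; pose t := tnth (in_tuple s).
have tM k : M (t k) by apply/ms; exact: mem_tnth.
have inj k l : (t k == t l) = (k == l) by rewrite (inj_eq (elimT (tuple_uniqP (in_tuple s)) (undup_uniq _))).
have bt k p : nodes G p -> nodal_basis (t k) p = if p == t k then 1 else 0.
  by move=> np; rewrite /nodal_basis interp_node.
have sumE (c : 'I_(size s) -> R) p :
    (\sum_l c l *: nodal_basis (t l)) p = \sum_l c l * nodal_basis (t l) p by rewrite fct_sumE.
split => //.
- move=> k; split; first exact: interp_Vh.
  by move=> p np nM; rewrite bt//; case: eqP => // e; case: nM; rewrite e; exact: tM.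
- move=> v [Vv v0]; rewrite -{1}(interp_id Vv).
  have -> : \sum_k v (t k) *: nodal_basis (t k) =
      interp Omega G (\sum_k v (t k) *: nodal_basis (t k)).
    rewrite interp_sum; apply: eq_bigr => k _.
    by have := interpZD (v (t k)) (nodal_basis (t k)) 0; rewrite interp0 !addr0 => ->;
      rewrite (interp_id (interp_Vh _)).
  apply: eq_interp => p np; rewrite sumE.
  have [/ms ps|nM] := pselect (M p).
    have /tnthP[k pk] : p \in in_tuple s by [].
    rewrite pk (bigD1 k)//= bt; last exact: MN.
    rewrite eqxx mulr1 big1 ?addr0// => l lk; rewrite bt; last exact: MN.
    by rewrite inj eq_sym (negbTE lk) mulr0.
  rewrite v0// big1// => k _; rewrite bt//; case: eqP => [e|_]; last by rewrite mulr0.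
  by case: nM; rewrite e; exact: tM.
- move=> c k; rewrite sumE (bigD1 k)//= bt; last exact: MN.
  rewrite eqxx mulr1 big1 ?addr0// => l lk; rewrite bt; last exact: MN.
  by rewrite inj eq_sym (negbTE lk) mulr0.
Qed.

Lemma truncated_spaceE N : truncated_space Omega G N = node_space N.
Proof.
by apply/seteqP; split => v [Vv v0]; split => // p; [move=> np nN|move=> [np nN]]; exact: v0.
Qed.

Lemma local_subspaceE N D : local_subspace Omega G N D = node_space (N `&` D).
Proof.
rewrite /local_subspace truncated_spaceE; apply/seteqP; split => v.
  move=> [[Vv v0] vD]; split => // p np /not_andP[nN|nD]; [exact: v0|exact: vD].
by move=> [Vv v0]; split; [split => // p np nN; apply: v0 => // -[]|
  move=> p np nD; apply: v0 => // -[]].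
Qed.

End Interpolation.

(** * Overlap of the local spaces *)

Lemma card_bigcup_le (T I : finType) (A : {pred I}) (F : I -> {set T}) :
  (#|(\bigcup_(i in A) F i)%SET| <= \sum_(i in A) #|F i|)%N.
Proof.
elim/big_rec2: _ => [|i n S _ ih]; first by rewrite cards0.
by apply: leq_trans (leq_add (leqnn _) ih); rewrite leq_card_setU.
Qed.

(* The nodes of distinct patches are h/(Cphi Cq) apart in the 1-norm, because
   phi_i drops from 1 to 0 between them; hence a cell of side h/(2 Cphi Cq)
   meets the nodes of at most one patch. *)
Definition cells_per_side {R : realType} (Cq Cphi : R) : nat :=
  (Num.truncn (4 * Cq ^+ 2 * Cphi)).+1.

(* 9 is the dimension of the space of biquadratic polynomials. *)
Definition node_overlap {R : realType} (Cq Cphi : R) (Nc : nat) : nat :=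
  cells_per_side Cq Cphi * cells_per_side Cq Cphi * (9 * Nc).

Section OverlapCounting.
Context {R : realType}.
Variables (Omega : set (plane R)) (h Cq Cphi CPi : R) (G : gfem R).
Hypothesis spec : gfem_spec Omega h Cq Cphi CPi G.
Hypotheses (h0 : 0 < h) (Cq0 : 0 < Cq) (Cphi0 : 0 < Cphi).
Implicit Types (x y p : plane R) (i : 'I_(patch_count G)).

(** The lower bound [h / Cq] for the patch diameter turns the derivative bound [Cphi / diam] into
    [Cphi * Cq / h]. *)
Lemma phi_lipschitz i x y : `|phi i x - phi i y| <= Cphi * Cq / h * dist1 x y.
Proof.
have [phic phiw _] := phi_W2inf spec i.
have /andP[dl _] := patch_diam spec i.
have dle : Cphi * diam (patch i) ^- 1 <= Cphi * Cq / h.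
  rewrite -mulrA ler_pM2l// -invf_div expr1 lef_pV2// posrE ?divr_gt0//.
  by apply: lt_le_trans dl; rewrite divr_gt0.
apply: weak_lipschitz => // d.
exists (weak_deriv setT [:: d] (phi i)); first by apply: weak_derivP; exact: phiw.
have := Winf_le (@phi_bound _ _ _ _ _ _ _ spec i 1%N isT) [tuple d].
by apply: filterS => z /(_ I) /le_trans; apply.
Qed.

Lemma nodes_separated i k x y : i != k -> local_nodes i x -> local_nodes k y ->
  h <= Cphi * Cq * dist1 x y.
Proof.
move=> ik /(node_flat spec)[_ _ x1 _] /(node_flat spec)[_ _ _ /(_ i ik) y0].
have := phi_lipschitz i x y; rewrite x1 y0 subr0 normr1 mulrAC.
by rewrite ler_pdivlMr// mul1r.
Qed.

Lemma patch_dist i x y : patch i x -> patch i y ->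
  `|x.1 - y.1| <= Cq * h /\ `|x.2 - y.2| <= Cq * h.
Proof.
have /andP[_ du] := patch_diam spec i.
move=> ix iy; have le_edist : Defs.edist x y <= Cq * h.
  apply: le_trans du; apply: ub_le_sup; last by exists (x, y).
  (* [diam] is a supremum, so a distance is bounded by it only after the set of distances is shown
     to be bounded; the sum of the side lengths is such a bound. *)
  exists (((patch_hi i).1 - (patch_lo i).1) + ((patch_hi i).2 - (patch_lo i).2)).
  move=> _ [[z w] [/= [/andP[z1 z2] /andP[z3 z4]] [/andP[w1 w2] /andP[w3 w4]]] <-].
  have c0 : 0 <= (patch_hi i).1 - (patch_lo i).1 + ((patch_hi i).2 - (patch_lo i).2) by lra.
  rewrite /Defs.edist -[leRHS]ger0_norm// -sqrtr_sqr ler_wsqrtr//= [leRHS]sqrrD [leRHS]addrAC.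
  have sq (a b : R) : - b <= a <= b -> a ^+ 2 <= b ^+ 2 by move=> ?; nra.
  have /sq e1 : - ((patch_hi i).1 - (patch_lo i).1) <= z.1 - w.1 <= (patch_hi i).1 - (patch_lo i).1.
    by lra.
  have /sq e2 : - ((patch_hi i).2 - (patch_lo i).2) <= z.2 - w.2 <= (patch_hi i).2 - (patch_lo i).2.
    by lra.
  apply: ler_wpDr; last exact: lerD.
  by rewrite mulrn_wge0// mulr_ge0//; lra.
by split; apply: le_trans le_edist; rewrite -sqrtr_sqr ler_wsqrtr// ?lerDl ?lerDr sqr_ge0.
Qed.

(** Only patches that carry a node are considered, since the separation argument compares nodes;
    [V_i] may be trivial. *)
Definition node_patch x i : Prop := patch i x /\ exists p, local_nodes i p.

(** One node [nd i] is chosen per patch. Its offset from [x] lies in a square of side [2 * Cq * h],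
    which is cut into cells of side [h / (2 * L)]: the quotient is [4 * Cq ^+ 2 * Cphi]. Two nodes
    in one cell would be closer than [h / L] in the 1-norm, so distinct patches occupy distinct
    cells. *)
Lemma node_patch_count x : (#|[pred i | `[< node_patch x i >]]| <=
  cells_per_side Cq Cphi * cells_per_side Cq Cphi)%N.
Proof.
set K := cells_per_side Cq Cphi; pose L := Cphi * Cq; have L0 : 0 < L by rewrite mulr_gt0.
pose nd i := xget 0 [set p : plane R | local_nodes i p].
have ndP i : node_patch x i -> local_nodes i (nd i) /\
    (`|(nd i).1 - x.1| <= Cq * h /\ `|(nd i).2 - x.2| <= Cq * h).
  move=> [xi [p ip]]; have li : local_nodes i (nd i).
    by rewrite /nd; case: xgetP => // /(_ p).
  by split => //; apply: patch_dist xi; have [] := node_flat spec li.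
pose cell (t : R) : 'I_K := inord (Num.truncn ((t + Cq * h) / (h / (2 * L)))).
have cell_inj s t : `|s| <= Cq * h -> `|t| <= Cq * h -> cell s = cell t -> `|s - t| < h / (2 * L).
  move=> sC tC /(congr1 val); pose u (r : R) := (r + Cq * h) / (h / (2 * L)).
  have c0 : 0 < h / (2 * L) by rewrite divr_gt0// mulr_gt0.
  have u0 r : `|r| <= Cq * h -> 0 <= u r.
    by rewrite ler_norml => /andP[r1 _]; apply: divr_ge0; [lra|exact: ltW].
  have uK r : `|r| <= Cq * h -> (Num.truncn (u r) < K)%N.
    move=> rC; rewrite ltnS; apply: le_truncn.
    rewrite /u ler_pdivrMr// /L; move: rC; rewrite ler_norml => /andP[_ r2].
    have -> : 4 * Cq ^+ 2 * Cphi * (h / (2 * (Cphi * Cq))) = 2 * (Cq * h).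
      by field; rewrite !gt_eqF.
    by lra.
  rewrite /cell /= !inordK; [|exact: uK|exact: uK] => e.
  have /andP[s1 s2] := truncn_itv (u0 _ sC); have /andP[t1 t2] := truncn_itv (u0 _ tC).
  move: s1 s2 t1 t2; rewrite -/(u s) -/(u t) in e *; rewrite e -natr1 => s1 s2 t1 t2.
  have -> : s - t = (u s - u t) * (h / (2 * L)).
    by rewrite /u; field; rewrite !gt_eqF.
  rewrite normrM (gtr0_norm c0) gtr_pMl// ltr_norml; lra.
pose f i := (cell ((nd i).1 - x.1), cell ((nd i).2 - x.2)).
rewrite -[leqRHS](_ : #|{: 'I_K * 'I_K}| = _); last by rewrite card_prod card_ord.
rewrite -(@card_in_imset _ _ f); first exact: max_card.
move=> i k; rewrite !inE => ix kx.
have [ni [i1 i2]] := ndP _ ix; have [nk [k1 k2]] := ndP _ kx; case.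
move=> /(cell_inj _ _ i1 k1) d1 /(cell_inj _ _ i2 k2) d2; apply/eqP; apply/negPn/negP => ik.
have := nodes_separated ik ni nk; rewrite -/L /dist1.
have hL : h = L * (h / (2 * L) + h / (2 * L)) by field; rewrite gt_eqF.
rewrite {1}hL ler_pM2l// => le; move: d1 d2.
have cancel (a b c : R) : a - c - (b - c) = a - b by ring.
rewrite !cancel; lra.
Qed.

(** Local functions that are 1 at one node and 0 at the others factor the identity matrix through
    the coefficients of the 9 monomials, which bounds its size by 9. *)
Lemma local_nodes_le9 i (s : seq (plane R)) : uniq s -> {in s, forall p, local_nodes i p} ->
  (size s <= 9)%N.
Proof.
move=> us sn; pose t := tnth (in_tuple s).
have inj k l : (t k == t l) = (k == l) by rewrite (inj_eq (elimT (tuple_uniqP (in_tuple s)) us)).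
have /choice[c cP] (k : 'I_(size s)) : exists c : 'I_3 -> 'I_3 -> R, forall l,
    \sum_(a < 3) \sum_(b < 3) c a b * (t l).1 ^+ a * (t l).2 ^+ b = (l == k)%:R.
  have [h1 h2] := local_interpP spec i (fun q => (q == t k)%:R).
  have [c cE] := local_space_biquadratic spec h1; exists c => l.
  by rewrite -cE h2 ?inj//; apply: sn; exact: mem_tnth.
pose e (m : 'I_#|{: 'I_3 * 'I_3}|) : 'I_3 * 'I_3 := enum_val m.
pose A := \matrix_(k < size s, m < #|{: 'I_3 * 'I_3}|) c k (e m).1 (e m).2.
pose B := \matrix_(m < #|{: 'I_3 * 'I_3}|, k < size s) ((t k).1 ^+ (e m).1 * (t k).2 ^+ (e m).2).
have AB : A *m B = 1%:M.
  apply/matrixP => k l; rewrite !mxE eq_sym -(cP k l) pair_bigA.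
  rewrite [RHS](reindex e); last exact/onW_bij/enum_val_bij.
  by apply: eq_bigr => m _; rewrite !mxE mulrA.
by have := mulmx1_min AB; rewrite card_prod card_ord.
Qed.

Definition node_patch_in (D : set (plane R)) x i : Prop :=
  patch i x /\ exists2 p, local_nodes i p & D p.

(** A subdomain is reached from [x] through a patch containing [x], then a node of that patch, then
    a subdomain containing that node. The three numbers of choices are multiplied. *)
Lemma node_patch_in_count (J : finType) (D : J -> set (plane R)) (Nc : nat) x :
  (forall y, Omega y -> (#|[pred j | `[< D j y >]]| <= Nc)%N) ->
  (#|[pred j | `[< exists i, node_patch_in (D j) x i >]]| <= node_overlap Cq Cphi Nc)%N.
Proof.
move=> DN.
have /choice[s sP] i : exists s : seq (plane R), uniq s /\ forall p, p \in s <-> local_nodes i p.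
  have /finite_seqP[s sE] := local_nodes_finite spec i.
  by exists (undup s); split; [exact: undup_uniq|move=> p; rewrite mem_undup sE].
pose A := [pred i | `[< node_patch x i >]].
pose F i : {set J} := 
  (\bigcup_(m in 'I_(size (s i))) [set j | `[< D j (tnth (in_tuple (s i)) m) >]])%SET.
have F9 i : (#|F i| <= 9 * Nc)%N.
  apply: leq_trans (card_bigcup_le _ _) _; have [us si] := sP i.
  apply: (@leq_trans (\sum_(m in 'I_(size (s i))) Nc)).
    apply: leq_sum => m _; apply: leq_trans (DN (tnth (in_tuple (s i)) m) _).
      by rewrite cardsE.
    have : local_nodes i (tnth (in_tuple (s i)) m) by apply/si; exact: mem_tnth.
    by case/(node_flat spec).
  rewrite sum_nat_const card_ord leq_mul2r (@local_nodes_le9 i) ?orbT//.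
  by move=> p /si.
have : [pred j | `[< exists i, node_patch_in (D j) x i >]] \subset (\bigcup_(i in A) F i)%SET.
  apply/fintype.subsetP => j; rewrite inE => -[i [xi [p ip Dp]]].
  apply/finset.bigcupP; exists i; first by rewrite inE; split => //; exists p.
  have [_ /(_ p)[_ /(_ ip) ps]] := sP i.
  have /tnthP[m pm] : p \in in_tuple (s i) by [].
  by apply/finset.bigcupP; exists m => //; rewrite finset.in_set -pm; apply/asboolP.
move=> /subset_leq_card /leq_trans; apply; apply: leq_trans (card_bigcup_le _ _) _.
apply: (@leq_trans (\sum_(i in A) (9 * Nc))); first exact: leq_sum.
by rewrite sum_nat_const leq_mul2r node_patch_count orbT.
Qed.

End OverlapCounting.

(** * From pointwise overlap to energies *)

Section EnergyOverlap.
Context {R : realType}.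
Implicit Types (D : set (plane R)) (u v : plane R -> R) (s : seq 'I_2).

Lemma ae_coord_neq (i : 'I_2) (t : R) : {ae area, forall x : plane R, coord i x != t}.
Proof.
pose A : set (plane R) := if i == 0 then [set t] `*` setT else setT `*` [set t].
exists A; split.
- by rewrite /A; case: ifP => _; exact: measurableX.
- rewrite /A /area; case: ifP => _; rewrite product_measure1E//=; have := @lebesgue_measure_set1 R t.
    by move=> ->; rewrite mul0e.
  by move=> ->; rewrite mule0.
- move=> x /= /negP; rewrite negbK /A /coord; case: ifP => _ /eqP; by [].
Qed.

Lemma ae_closed_box (lo hi : plane R) :
  {ae area, forall x, closed_box lo hi x -> open_rectangle lo hi x}.
Proof.
have two i a b : {ae area, forall x : plane R, coord i x != a /\ coord i x != b}.
  by have := ae_coord_neq i b; have := ae_coord_neq i a; apply: filterS2.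
have := two 1 lo.2 hi.2; have := two 0 lo.1 hi.1.
apply: filterS2 => x /= [x1 x2] [x3 x4] [] /=; rewrite !in_itv/= => /andP[h1 h2] /andP[h3 h4].
by split; apply/andP; split; rewrite lt_neqAle ?h1 ?h2 ?h3 ?h4 andbT// eq_sym.
Qed.

(** The Cauchy-Schwarz inequality for [n] terms with sum [S], in the form that the sum of the
    squares [(n * a j - S) ^+ 2] is nonnegative. *)
Lemma sqr_sum_support (J : finType) (A : {pred J}) (a : J -> R) (K : nat) :
  (forall j, j \notin A -> a j = 0) -> (#|A| <= K)%N ->
  (\sum_j a j) ^+ 2 <= K%:R * \sum_j a j ^+ 2.
Proof.
move=> a0 AK.
have e1 : \sum_j a j = \sum_(j in A) a j.
  by rewrite (bigID (mem A))/= [X in _ + X]big1 ?addr0// => j /a0.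
have e2 : \sum_j a j ^+ 2 = \sum_(j in A) a j ^+ 2.
  by rewrite (bigID (mem A))/= [X in _ + X]big1 ?addr0// => j /a0 ->; rewrite expr0n.
rewrite e2; apply: (@le_trans _ _ (#|A|%:R * \sum_(j in A) a j ^+ 2)); last first.
  by rewrite ler_wpM2r ?ler_nat// sumr_ge0// => j _; exact: sqr_ge0.
have [/eqP/card0_eq A0|n0] := boolP (#|A| == 0)%N.
  by rewrite e1 !big_pred0// expr0n mulr0.
set S := \sum_j a j; set n : R := #|A|%:R; have n1 : 0 < n by rewrite ltr0n lt0n.
have : 0 <= \sum_(j in A) (n * a j - S) ^+ 2 by rewrite sumr_ge0// => j _; exact: sqr_ge0.
have -> : \sum_(j in A) (n * a j - S) ^+ 2 =
    \sum_(j in A) (n ^+ 2 * a j ^+ 2 - 2 * n * S * a j + S ^+ 2).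
  by apply: eq_bigr => j _; ring.
rewrite big_split sumrB/= -!mulr_sumr -e1 -/S sumr_const.
have -> : n ^+ 2 * \sum_(j in A) a j ^+ 2 - 2 * n * S * S + S * (S *+ #|A|) =
    n * (n * \sum_(j in A) a j ^+ 2 - S ^+ 2).
  by rewrite -[S *+ _]mulr_natl -/n; ring.
by rewrite pmulr_rge0// subr_ge0.
Qed.

Lemma Hspace0 D k : open D -> Hspace D k 0.
Proof. by move=> oD; exact: (@test_Hspace _ _ _ (fun=> 0) oD (test_cst0 D)). Qed.

Lemma Hspace_sum D k (I : Type) (r : seq I) (w : I -> plane R -> R) : open D ->
  (forall j, Hspace D k (w j)) -> Hspace D k (\sum_(j <- r) w j).
Proof.
move=> oD wk; elim/big_rec: _ => [|j v _ vk]; first exact: Hspace0.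
by rewrite -[w j]scale1r; exact: HspaceZD.
Qed.

Lemma weak_deriv_sum D k s (I : Type) (r : seq I) (w : I -> plane R -> R) : open D ->
  (size s <= k)%N -> (forall j, Hspace D k (w j)) ->
  {ae area, forall x, D x ->
    weak_deriv D s (\sum_(j <- r) w j) x = \sum_(j <- r) weak_deriv D s (w j) x}.
Proof.
move=> oD sk wk; have hw u : Hspace D k u -> has_weak_deriv D s u by move=> /(_ s sk)[].
elim: r => [|j r ih].
  rewrite big_nil; have := weak_deriv_eq0 oD (hw _ (Hspace0 oD)) (fun x _ => erefl).
  by apply: filterS => x h Dx; rewrite big_nil h.
have h := weak_derivZD 1 oD (hw _ (wk j)) (hw _ (Hspace_sum r oD wk)).
rewrite big_cons -[w j]scale1r; move: h ih; apply: filterS2 => x h1 h2 Dx.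
by rewrite big_cons h1// mul1r h2.
Qed.

(** At almost every point, at most [K] of the weak derivatives are nonzero, and the square of their
    sum is estimated before integrating. *)
Lemma Hsq_sum_overlap D m (J : finType) (w : J -> plane R -> R) (near : J -> plane R -> Prop)
    (K : nat) : open D -> (forall j, Hspace D m (w j)) ->
  (forall j s, (size s <= m)%N ->
    {ae area, forall x, D x -> ~ near j x -> weak_deriv D s (w j) x = 0}) ->
  (forall x, (#|[pred j | `[< near j x >]]| <= K)%N) ->
  Hsq D m (\sum_j w j) <= K%:R * \sum_j Hsq D m (w j).
Proof.
move=> oD wm w0 nK.
under [X in _ <= _ * X]eq_bigr do rewrite HsqE.
rewrite HsqE exchange_big mulr_sumr; apply: ler_sum => s _.
have sm : (size s <= m)%N by rewrite size_tuple.
have mD := open_measurable2 oD.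
have sq j := (Hspace_weak (wm j) sm).2.
rewrite sform.unlock.
pose F j x := weak_deriv D s (w j) x ^+ 2.
have Fi j : area.-integrable D (EFin \o F j) by exact: (sq j).2.
have [Si SE] := Rintegral_sum (index_enum J) mD Fi.
have KE : K%:R * \sum_j \int[area]_(x in D) F j x =
    \int[area]_(x in D) (K%:R * \sum_j F j x).
  by rewrite RintegralZl// SE.
rewrite -[leRHS]/(K%:R * \sum_j \int[area]_(x in D) F j x) KE.
have [_ wS] := Hspace_weak (Hspace_sum (index_enum J) oD wm) sm.
apply: (ae_le_Rintegral mD _ (integrable_scale _ mD Si) _ _).2.
- by have [m1 _] := wS; exact: measurable_funM.
- by move=> x _; exact: sqr_ge0.
have sE := weak_deriv_sum (index_enum J) oD sm wm.
have w0' : {ae area, forall x, forall j, D x -> ~ near j x -> weak_deriv D s (w j) x = 0}.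
  by apply: filter_forall => j; exact: w0.
move: sE w0'; apply: filterS2 => x e h Dx.
rewrite (e Dx) -expr2; apply: sqr_sum_support (nK x) => j jn; apply: h => // nj.
by move/negP: jn; apply; rewrite inE.
Qed.

End EnergyOverlap.

(** * Supports of the local spaces *)

Section LocalEnergies.
Context {R : realType}.
Variables (Omega : set (plane R)) (h Cq Cphi CPi : R) (G : gfem R).
Hypothesis spec : gfem_spec Omega h Cq Cphi CPi G.
Hypothesis oO : open Omega.

Lemma Vh_Hspace v : Vh Omega G v -> Hspace Omega 2 v.
Proof. by move=> /(Vh_conforming spec)/H20_Hspace. Qed.

(** On a patch without a node in [M] all nodal values of [w] are 0, and by unisolvence its local
    polynomial is 0. *)
Lemma node_space_eq0 M w x : node_space Omega G M w ->
  ~ (exists i, node_patch_in (G := G) M x i) -> w x = 0.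
Proof.
move=> [Vw w0] nx; rewrite -(interp_id spec Vw) /interp patchE; case: ifP => // _.
rewrite big1// => i _.
have [xi|xi] := pselect (patch i x); last first.
  have [->|/(phi_supp spec)//] := eqVneq (phi i x) 0; by rewrite mulr0.
rewrite (@local_interp_eq _ _ _ _ _ _ _ spec i w 0) ?mul0r//.
  by have [] := local_space_linear spec i.
move=> p ip; rewrite w0//; first by exists i.
by move=> Mp; apply: nx; exists i; split => //; exists p.
Qed.

(** Locality needs an open set on which [w] vanishes, so closed boxes are removed in place of the
    open patches; the two differ by a set of zero area. *)
Lemma node_space_deriv_eq0 M w s : node_space Omega G M w -> (size s <= 2)%N ->
  {ae area, forall x, Omega x -> ~ (exists i, node_patch_in (G := G) M x i) ->
    weak_deriv Omega s w x = 0}.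
Proof.
move=> Mw s2.
pose B (i : 'I_(patch_count G)) : set (plane R) := if `[< exists2 p, local_nodes i p & M p >]
  then closed_box (patch_lo i) (patch_hi i) else set0.
pose C := \bigcup_(i in [set: 'I_(patch_count G)]) B i.
have cC : closed C.
  apply: closed_bigcup => [|i _]; first exact: finite_finset.
  rewrite /B; case: asboolP => _; last exact: closed0.
  by apply: compact_closed2; exact: compact_closed_box.
have oU : open (Omega `\` C) by apply: openI => //; exact: closed_openC.
have UO : Omega `\` C `<=` Omega by move=> x [].
have hw : has_weak_deriv Omega s w by have [] := Vh_Hspace Mw.1 s2.
have hwU : has_weak_deriv (Omega `\` C) s w.
  exists (weak_deriv Omega s w).
  by apply: (is_weak_derivS _ _ UO); [exact: open_measurable2..|exact: weak_derivP].
have w0 : forall x, (Omega `\` C) x -> w x = 0.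
  move=> x [_ xC]; apply: (node_space_eq0 Mw) => -[i [xi Mi]]; apply: xC.
  by exists i => //; rewrite /B; case: asboolP => // _; exact: open_rectangle_sub_box.
have e1 := weak_deriv_eq0 oU hwU w0.
have e2 := weak_deriv_sub oO oU UO hw.
have e3 : {ae area, forall x, forall i,
    closed_box (patch_lo i) (patch_hi i) x -> patch (G := G) i x}.
  by apply: filter_forall => i; exact: ae_closed_box.
move: e1 e2 e3; apply: filterS3 => x h1 h2 h3 Ox nx.
have Ux : (Omega `\` C) x.
  split => // -[i _]; rewrite /B; case: asboolP => // Mi /h3 xi.
  by apply: nx; exists i.
by rewrite -h2// h1.
Qed.

Hypotheses (h0 : 0 < h) (Cq0 : 0 < Cq) (Cphi0 : 0 < Cphi).

Lemma node_space_overlap (J : finType) (M D : J -> set (plane R)) (Nc : nat)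
    (w : J -> plane R -> R) : (forall j, M j `<=` D j) ->
  (forall y, Omega y -> (#|[pred j | `[< D j y >]]| <= Nc)%N) ->
  (forall j, node_space Omega G (M j) (w j)) ->
  Hsq Omega 2 (\sum_j w j) <= (node_overlap Cq Cphi Nc)%:R * \sum_j Hsq Omega 2 (w j).
Proof.
move=> MD DN Mw.
apply: (@Hsq_sum_overlap _ _ _ _ _ (fun j x => exists i, node_patch_in (G := G) (D j) x i)) => //.
- by move=> j; exact: Vh_Hspace (Mw j).1.
- move=> j s s2; have := node_space_deriv_eq0 (Mw j) s2; apply: filterS => x + Ox nx.
  apply => // -[i [xi [p ip Mp]]]; apply: nx; exists i; split => //; exists p => //.
  exact: MD.
- by move=> x; exact: (node_patch_in_count spec h0 Cq0 Cphi0 x DN).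
Qed.

End LocalEnergies.

(** * Stable decomposition *)

Section StableInterpolation.
Context {R : realType}.
Implicit Types (D : set (plane R)) (u v chi zeta : plane R -> R).

Lemma test_subr D chi zeta : test_function D chi -> test_function D zeta ->
  test_function D (chi - zeta).
Proof.
move=> tc tz; have := test_add tc (test_mulr (fun k => Ck_cst k (-1)) tz).
by congr test_function; apply/funext => x; rewrite mulN1r.
Qed.

Lemma Hsq0 D m : open D -> Hsq D m 0 = 0 :> R.
Proof.
move=> oD; rewrite HsqE big1// => s _.
have sm : (size s <= m)%N by rewrite size_tuple.
have := sformZ2 1 oD sm (Hspace0 oD) (Hspace0 oD).
by rewrite scale1r addr0; lra.
Qed.

Lemma HsqZ D m (c : R) u : open D -> Hspace D m u -> Hsq D m (c *: u) = c ^+ 2 * Hsq D m u.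
Proof.
move=> oD um; rewrite !HsqE mulr_sumr; apply: eq_bigr => s _.
have sm : (size s <= m)%N by rewrite size_tuple.
have u0 : sform D s u 0 = 0.
  by have := sformZD 1 oD sm (Hspace0 oD) (Hspace0 oD) um; rewrite scale1r addr0 sformC; lra.
have := sformZ2 c oD sm um (Hspace0 oD); rewrite addr0 u0 mulr0 addr0 => ->.
by have := Hsq0 m oD; rewrite HsqE => /eqP; rewrite psumr_eq0 => [/allP/(_ s)|i _];
  [rewrite mem_index_enum => /(_ isT)/eqP ->; rewrite addr0|exact: sform_ge0].
Qed.

Lemma H20_test D chi : open D -> test_function D chi -> H20 D chi.
Proof.
move=> oD tc; split.
- exact: test_continuous tc.
- by move=> x; exact: test_function_off.
- exact: test_Hspace.
- move=> e e0; exists chi => //; rewrite subrr /Hnorm big1 ?sqrtr0// => m _.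
  by have := Hsq0 m oD; rewrite Hsq.unlock.
Qed.

Lemma H20_sub_test D v chi : open D -> H20 D v -> test_function D chi -> H20 D (v - chi).
Proof.
move=> oD [cv voff vH va] tc; have [cc coff cH _] := H20_test oD tc; split.
- by move=> x; apply: continuousB; [exact: cv|exact: cc].
- by move=> x Dx; rewrite -[LHS]/(v x - chi x) voff// coff// subrr.
- exact: HspaceB.
- move=> e /va[xi txi xiE]; exists (xi - chi); first exact: test_subr.
  by rewrite opprB addrA subrK.
Qed.

Lemma Hsq_sum_le D m (J : finType) (w : J -> plane R -> R) : open D ->
  (forall j, Hspace D m (w j)) ->
  Hsq D m (\sum_j w j) <= #|J|%:R * \sum_j Hsq D m (w j).
Proof.
move=> oD wm; apply: (@Hsq_sum_overlap _ _ _ _ _ (fun _ _ => True)) => //.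
  by move=> j s _; apply: aeW => x _ /(_ I).
by move=> x; exact: max_card.
Qed.

Lemma common_radius (T : eqType) (s : seq T) (Q : T -> R -> Prop) :
  (forall p, p \in s -> exists2 e0, 0 < e0 & forall e, 0 < e <= e0 -> Q p e) ->
  exists2 e0, 0 < e0 & forall p, p \in s -> forall e, 0 < e <= e0 -> Q p e.
Proof.
elim: s => [_|p s ih h]; first by exists 1.
have [q qs|e1 e10 h1] := ih; first by apply: h; rewrite inE qs orbT.
have [|e2 e20 h2] := h p; first by rewrite inE eqxx.
exists (Num.min e1 e2); first by rewrite lt_min e10.
move=> q; rewrite inE => /predU1P[-> e|qs e]; rewrite le_min => /and3P[e0 h3 h4].
  by apply: h2; rewrite e0.
by apply: h1 => //; rewrite e0.
Qed.

Variables (Omega : set (plane R)) (h Cq Cphi CPi : R) (G : gfem R).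
Hypothesis spec : gfem_spec Omega h Cq Cphi CPi G.
Hypothesis oO : open Omega.
Hypothesis bO : bounded_set Omega.
Hypotheses (h0 : 0 < h) (CPi0 : 0 < CPi).

(** Only the H^2 term on the left of the interpolation property is kept, and its factor [h ^+ 2]
    cancels. *)
Lemma interp_Hsq zeta : H20 Omega zeta ->
  Hsq Omega 2 (interp Omega G zeta) <= CPi ^+ 2 * Hsq Omega 2 zeta.
Proof.
move=> /(interp_stable spec) st.
have le : Hsemi Omega 2 (interp Omega G zeta) <= CPi * Hsemi Omega 2 zeta.
  rewrite -(@ler_pM2l _ (h ^+ 2)) ?exprn_gt0// mulrA [h ^+ 2 * CPi]mulrC.
  apply: le_trans st; rewrite lerDr sumr_ge0// => m _.
  by rewrite mulr_ge0// ?exprn_ge0 ?sqrtr_ge0// ltW.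
rewrite Hsq.unlock -exprMn ler_pXn2r// nnegrE ?sqrtr_ge0//.
by rewrite mulr_ge0 ?sqrtr_ge0// ltW.
Qed.

Lemma bilin_eq0 v : Vh Omega G v -> bilin Omega v v = 0 -> v = 0.
Proof.
move=> Vv; rewrite bilin_sqr//; last exact: (Vh_Hspace spec).
by apply: H20_eq0 => //; exact: (Vh_conforming spec).
Qed.

Lemma bilin_ge0 v : Vh Omega G v -> 0 <= bilin Omega v v.
Proof. by move=> Vv; rewrite bilin_sqr ?Hsq_ge0//; exact: (Vh_Hspace spec). Qed.

Lemma bilinZD_Vh c u v w : Vh Omega G u -> Vh Omega G v -> Vh Omega G w ->
  bilin Omega (c *: u + v) w = c * bilin Omega u w + bilin Omega v w.
Proof. by move=> Vu Vv Vw; apply: bilinZD => //; exact: (Vh_Hspace spec). Qed.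

Lemma node_bounded p : nodes G p -> exists2 K, 0 <= K &
  forall v, Vh Omega G v -> v p ^+ 2 <= K * Hsq Omega 2 v.
Proof.
move=> np; have [s us [sP sb sspan sfree]] := node_space_basis spec (@subset_refl _ (nodes G)).
have /tnthP[k ->] : p \in in_tuple s by apply/sP.
have [K K0 KP] := @ev_bounded R _ (bilin Omega) (node_space Omega G (nodes G)) _ _
  (fun l v => v (tnth (in_tuple s) l)) (node_space0 spec _) (@node_spaceZD _ _ _ _ _ _ _ spec _)
  (bilinC Omega) (fun c u v w Vu Vv Vw => bilinZD_Vh c Vu.1 Vv.1 Vw.1)
  (fun v Vv => bilin_ge0 Vv.1) (fun v Vv => bilin_eq0 Vv.1) sb sspan sfree k
  (fun c u v _ _ => erefl).
exists K => // v Vv; rewrite -bilin_sqr//; last exact: (Vh_Hspace spec).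
by apply: KP; split => // q nq /(_ nq).
Qed.

(* Point values are bounded by the energy on the finite-dimensional space V_h;
   applied to [interp (v - chi)], this replaces the Sobolev embedding. *)
Lemma nodal_convergence v d : H20 Omega v -> 0 < d -> exists2 e, 0 < e &
  forall chi, test_function Omega chi -> Hsq Omega 2 (v - chi) < e ->
    forall p, nodes G p -> `|v p - chi p| <= d.
Proof.
move=> Hv d0; have [s sE] := (finite_seqP (nodes G)).1 (finite_nodes spec).
have [e e0 eP] : exists2 e, 0 < e & forall p, p \in s -> forall r, 0 < r <= e ->
    forall chi, test_function Omega chi -> Hsq Omega 2 (v - chi) < r -> `|v p - chi p| <= d.
  apply: common_radius => p ps; have np : nodes G p by rewrite sE.
  have [K K0 KP] := node_bounded np.
  have K1 : 0 < K * CPi ^+ 2 + 1 by rewrite ltr_wpDl// mulr_ge0// exprn_ge0// ltW.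
  exists (d ^+ 2 / (K * CPi ^+ 2 + 1)); first by rewrite divr_gt0// exprn_gt0.
  move=> r /andP[r0 rle] chi tc hr; have Hvc := H20_sub_test oO Hv tc.
  rewrite -ler_sqr ?nnegrE ?normr_ge0 ?(ltW d0)// real_normK ?num_real//.
  rewrite -[v p - chi p]/((v - chi) p) -(interp_node spec (v - chi) np).
  apply: le_trans (KP _ (interp_Vh spec _)) _.
  apply: le_trans (ler_wpM2l K0 (interp_Hsq Hvc)) _; rewrite mulrA.
  apply: le_trans (ler_wpM2l _ (ltW (lt_le_trans hr rle))) _.
    by rewrite mulr_ge0// exprn_ge0// ltW.
  rewrite mulrA ler_pdivrMr// mulrC ler_wpM2l ?exprn_ge0 ?(ltW d0)//.
  by rewrite lerDl.
exists e => // chi tc he p; rewrite sE => ps.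
by apply: (eP p ps e) => //; rewrite e0 lexx.
Qed.

(** An expansion in the nodal basis. [B] depends on the discretization and does not reach the final
    constant, because [d] will be chosen after it. *)
Lemma interp_small : exists2 B, 0 <= B & forall f (d : R), 0 <= d ->
  (forall p, nodes G p -> `|f p| <= d) -> Hsq Omega 2 (interp Omega G f) <= B * d ^+ 2.
Proof.
have [s us [sP sb sspan sfree]] := node_space_basis spec (@subset_refl _ (nodes G)).
pose t := tnth (in_tuple s); pose b k := nodal_basis Omega G (t k).
exists ((size s)%:R * \sum_k Hsq Omega 2 (b k)).
  by rewrite mulr_ge0// sumr_ge0// => k _; exact: Hsq_ge0.
move=> f d d0 fd; have /sspan -> : node_space Omega G (nodes G) (interp Omega G f).
  by split; [exact: (interp_Vh spec _)|move=> p np /(_ np)].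
have bH k : Hspace Omega 2 (b k) by exact: (Vh_Hspace spec (sb k).1).
have cbH (c : R) k : Hspace Omega 2 (c *: b k).
  by have := HspaceZD c oO (bH k) (Hspace0 oO); rewrite addr0.
apply: le_trans (Hsq_sum_le oO (fun k => cbH _ k)) _.
rewrite card_ord -mulrA ler_wpM2l// mulr_suml; apply: ler_sum => k _.
have nk : nodes G (t k) by apply/sP; exact: mem_tnth.
rewrite HsqZ// mulrC ler_wpM2l ?Hsq_ge0// (interp_node spec)//.
by rewrite -real_normK ?num_real// ler_sqr ?nnegrE ?normr_ge0// fd.
Qed.

End StableInterpolation.

Local Notation sub_count := Defs.sub_count.

Lemma open_open_rectangle (R : realType) (lo hi : plane R) : open (open_rectangle lo hi).
Proof.
rewrite open_rectangleE openE => -[a b] [/= a1 b1].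
exists (`]lo.1, hi.1[%classic, `]lo.2, hi.2[%classic) => //=.
by split; apply: open_nbhs_nbhs; split => //; exact: itv_open.
Qed.

(* If Omega is contained in [-M, M]^2, its Poincare constant is at most 4 M^2
   and delta is at most 4 M CH Cdelta. *)
Definition energy_constant (R : realType) (M CH Cdelta Cdag : R) : R :=
  4 * Cdag ^+ 2 * (4 * (4 * M ^+ 2) ^+ 2 + 4 * (4 * M ^+ 2) * (4 * M * CH * Cdelta) ^+ 2 +
    (4 * M * CH * Cdelta) ^+ 4).

Lemma energy_constant_gt0 (R : realType) (M CH Cdelta Cdag : R) :
  0 < M -> 0 < CH -> 0 < Cdelta -> 0 < Cdag -> 0 < energy_constant M CH Cdelta Cdag.
Proof. by move=> *; rewrite /energy_constant !(mulr_gt0, addr_gt0, exprn_gt0). Qed.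

(** * The energy of the localized interpolants *)

Section StableDecomposition.
Context {R : realType}.
Variables (Omega : set (plane R)) (h Cq Cphi CPi : R) (G : gfem R).
Variables (H delta CH Cdelta Cdag : R) (Nc : nat) (P : decomposition R) (M : R).
Hypothesis spec : gfem_spec Omega h Cq Cphi CPi G.
Hypothesis dspec : decomposition_spec Omega G h H delta CH Cdelta Cdag Nc P.
Hypothesis oO : open Omega.
Hypothesis OM : Omega `<=` square M.
Hypothesis bO : bounded_set Omega.
Hypothesis O0 : Omega !=set0.
Hypotheses (h0 : 0 < h) (CPi0 : 0 < CPi) (CH0 : 0 < CH) (Cdelta0 : 0 < Cdelta)
  (Cdag0 : 0 < Cdag).
Hypotheses (M0 : 0 < M).

Lemma sub_Omega (j : 'I_(sub_count P)) : subdomain j `<=` Omega.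
Proof. by move=> x; rewrite (sub_regular dspec) => -[]. Qed.

(** The support condition speaks of the closure of [D_j], whereas the local subspace is defined by
    nodes outside [D_j] itself. If [psi j x] is nonzero it is so near [x], which puts [x] in the
    interior of the closure, and within [Omega] this interior is [D_j] by [sub_regular]. *)
Lemma psi_off (j : 'I_(sub_count P)) x : Omega x -> ~ subdomain j x -> psi j x = 0.
Proof.
move=> Ox; rewrite (sub_regular dspec) => nx; apply: contrapT => px.
apply: nx; split => //; have [cpsi _ _] := psi_W2inf dspec j.
have Un : nbhs x (psi j @^-1` [set t | t != 0]).
  by apply: cpsi; apply: open_nbhs_nbhs; split; [exact: open_neq|exact/eqP].
have On : nbhs x Omega by exact: open_nbhs_nbhs.
rewrite /interior; move: Un On; apply: filterS2 => y /= /eqP py Oy.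
by apply: contrapT => ny; apply: py; apply: (psi_supp dspec).
Qed.

Lemma psi_le1 (j : 'I_(sub_count P)) x : Omega x -> 0 <= psi j x <= 1.
Proof.
move=> Ox; rewrite (psi_ge0 dspec)/= -(psi_sum1 dspec (subset_closure Ox)) (bigD1 j)//=.
by rewrite lerDl sumr_ge0// => k _; exact: (psi_ge0 dspec).
Qed.

(** A point of [Omega] in the closure of [D_j] but not in [D_j] lies on the boundary of a patch, by
    alignment; these boundaries have zero area, so the overlap bound for the open subdomains carries
    over. *)
Lemma subdomain_closure_overlap : {ae area, forall x, Omega x ->
  \sum_(j < sub_count P) \1_(closure (subdomain j)) x <= Nc%:R :> R}.
Proof.
have : {ae area, forall x, forall i, closed_box (patch_lo i) (patch_hi i) x -> patch (G := G) i x}.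
  by apply: filter_forall => i; exact: ae_closed_box.
apply: filterS => x px Ox; apply: le_trans (_ : _ <= #|[pred j | `[< subdomain (d := P) j x >]]|%:R) _.
  rewrite -sum1_card natr_sum [leRHS]big_mkcond/=; apply: ler_sum => j _.
  rewrite indicE; have [|_] := boolP (x \in closure (subdomain j)); last by case: ifP.
  rewrite inE => cx; rewrite ifT// inE; apply: contrapT => nx.
  have : (Omega `&` boundary (subdomain j)) x.
    by split => //; split => // /interior_subset.
  move=> /(sub_aligned dspec)[i _ [ci ni]]; apply: ni.
  have oi : open (patch i) by exact: open_open_rectangle.
  rewrite ((interior_id (patch i)).1 oi); apply: px.
  have := closure_subset (@open_rectangle_sub_box _ (patch_lo i) (patch_hi i)) ci.
  rewrite -((closure_id (closed_box (patch_lo i) (patch_hi i))).1 _)//.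
  by apply: compact_closed2; exact: compact_closed_box.
by rewrite ler_nat; exact: (sub_overlap dspec).
Qed.

(** Through [H <= CH * diam D_j]: a subset of the square has diameter at most [2 sqrt 2 M], rounded
    up to [4 * M]. *)
Lemma delta_le_diameter : delta <= 4 * M * CH * Cdelta.
Proof.
have [x Ox] := O0; have [j _ _] : (\bigcup_(j in setT) subdomain (d := P) j) x.
  by rewrite -(sub_cover dspec).
have dM : diam (subdomain j) <= 4 * M.
  have le4 y z : subdomain j y -> subdomain j z -> Defs.edist y z <= 4 * M.
    move=> /sub_Omega/OM/squareP[y1 y2] /sub_Omega/OM/squareP[z1 z2].
    have M4 : 0 <= 4 * M by rewrite mulr_ge0// ltW.
    rewrite /Defs.edist -[leRHS]ger0_norm// -sqrtr_sqr ler_wsqrtr//.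
    have sq (a b : R) : `|a| <= M -> `|b| <= M -> (a - b) ^+ 2 <= 4 * M ^+ 2.
      by rewrite !ler_norml; nra.
    by have := sq _ _ y1 z1; have := sq _ _ y2 z2; have := sqr_ge0 M; rewrite exprMn; lra.
  have [D0|] := eqVneq (subdomain j) set0.
    by rewrite /diam D0 setX0 image_set0 sup0 mulr_ge0// ltW.
  move=> /set0P[y Dy]; apply: ge_sup; first by exists (Defs.edist y y), (y, y).
  by move=> _ [[u v] [/= Du Dv]] <-; exact: le4.
have /andP[Hle _] := sub_diam dspec j.
apply: le_trans (delta_le dspec) _; rewrite mulrC ler_pM2r//.
by rewrite -ler_pdivrMr//; exact: le_trans Hle dM.
Qed.

Let c k : R := Cdag * delta ^- k.
Let K0 := energy_constant M CH Cdelta Cdag.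

Lemma delta_gt0 : 0 < delta. Proof. exact: lt_le_trans h0 (delta_ge dspec). Qed.

(** After multiplication by [delta ^+ 4], the first and second order seminorms of [chi] have the
    coefficients [delta ^+ 2] and [delta ^+ 4], bounded by powers of [4 * M * CH * Cdelta]; the
    Poincare inequality expresses the lower seminorms by the second. *)
Lemma leibniz_energy chi : test_function Omega chi ->
  4 * (4 * c 2 ^+ 2 * Hsq Omega 0 chi + 4 * c 1 ^+ 2 * Hsq Omega 1 chi + c 0 ^+ 2 * Hsq Omega 2 chi)
    <= K0 * delta ^- 4 * Hsq Omega 2 chi.
Proof.
move=> tc; have d0 := delta_gt0.
have p1 := Hsq_test_step0 oO OM tc; have p2 := Hsq_test_step1 oO OM tc.
have q2 := Hsq_ge0 Omega 2 chi; have q1 := Hsq_ge0 Omega 1 chi.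
have dd := delta_le_diameter.
rewrite /K0 /energy_constant /c.
move: (Hsq Omega 0 chi) (Hsq Omega 1 chi) (Hsq Omega 2 chi) p1 p2 q1 q2 => A0 A1 A2 p1 p2 q1 q2.
set d := 4 * M * CH * Cdelta in dd *; set m := 4 * M ^+ 2 in p1 p2 *.
have m0 : 0 <= m by rewrite mulr_ge0// exprn_ge0// ltW.
have A0le : A0 <= m ^+ 2 * A2.
  by apply: le_trans p1 _; rewrite expr2 -mulrA ler_wpM2l.
rewrite -(ler_pM2l (exprn_gt0 4 d0)).
have -> : delta ^+ 4 * (4 * Cdag ^+ 2 * (4 * m ^+ 2 + 4 * m * d ^+ 2 + d ^+ 4) * delta ^- 4 * A2) =
    4 * Cdag ^+ 2 * (4 * m ^+ 2 + 4 * m * d ^+ 2 + d ^+ 4) * A2.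
  by field; rewrite gt_eqF.
have -> : delta ^+ 4 * (4 * (4 * (Cdag * delta ^- 2) ^+ 2 * A0 + 4 * (Cdag * delta ^- 1) ^+ 2 * A1
    + (Cdag * delta ^- 0) ^+ 2 * A2)) =
    4 * Cdag ^+ 2 * (4 * A0 + 4 * delta ^+ 2 * A1 + delta ^+ 4 * A2).
  by rewrite expr0 expr1; field; rewrite gt_eqF.
rewrite -[leRHS]mulrA; apply: ler_wpM2l; first by rewrite mulr_ge0// sqr_ge0.
have d2 : delta ^+ 2 <= d ^+ 2 by rewrite ler_pXn2r ?nnegrE// ltW// (lt_le_trans d0).
have d4 : delta ^+ 4 <= d ^+ 4 by rewrite ler_pXn2r ?nnegrE// ltW// (lt_le_trans d0).
have b1 : delta ^+ 2 * A1 <= d ^+ 2 * (m * A2) by apply: ler_pM => //; exact: sqr_ge0.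
have b2 : delta ^+ 4 * A2 <= d ^+ 4 * A2 by exact: ler_wpM2r.
move: (d ^+ 4) (d ^+ 2) (delta ^+ 4) (delta ^+ 2) b1 b2 => ? ? ? ? b1 b2.
by clearbody m d; lra.
Qed.

(** The indicators are summed under the integral, where they give at most [Nc] almost everywhere;
    the number of subdomains does not enter. *)
Lemma overlap_energy chi : test_function Omega chi ->
  \sum_(j < sub_count P) \sum_(i < 2) \sum_(k < 2)
    \int[area]_(x in Omega) (leibniz_bound c chi i k x * \1_(closure (subdomain j)) x)
  <= Nc%:R * (K0 * delta ^- 4 * Hsq Omega 2 chi).
Proof.
move=> tc; have tcT := test_sub (@subsetT _ Omega) tc; have mO := open_measurable2 oO.
apply: le_trans (ler_wpM2l (ler0n _ Nc) (leibniz_energy tc)).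
rewrite -(leibniz_bound_test c oO tc) mulr_sumr exchange_big; apply: ler_sum => i _ /=.
rewrite mulr_sumr exchange_big; apply: ler_sum => k _ /=.
pose F (j : 'I_(sub_count P)) x : R :=
  leibniz_bound c chi i k x * \1_(closure (subdomain j)) x.
have Fi j : area.-integrable Omega (EFin \o F j).
  by apply: leibniz_bound_integrable => //; apply: closed_measurable2; exact: closed_closure.
have [Si SE] := Rintegral_sum (index_enum 'I_(sub_count P)) mO Fi.
have Li : area.-integrable Omega (EFin \o leibniz_bound c chi i k).
  have := @leibniz_bound_integrable R c chi i k Omega setT mO measurableT tcT.
  by congr (_.-integrable _ _); apply/funext => x /=; rewrite indicT mulr1.
rewrite -[leLHS]/(\sum_j \int[area]_(x in Omega) F j x) -SE -RintegralZl//.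
apply: (ae_le_Rintegral mO _ (integrable_scale _ mO Li) _ _).2.
- by apply/measurable_EFinP; exact: measurable_int Si.
- move=> x _; rewrite sumr_ge0// => j _; rewrite mulr_ge0 ?leibniz_bound_ge0//.
- have := subdomain_closure_overlap; apply: filterS => x le Ox.
  by rewrite -mulr_sumr mulrC ler_wpM2r ?leibniz_bound_ge0 ?le.
Qed.

Lemma mollified_nodes chi (j : 'I_(sub_count P)) (d : R) : test_function Omega chi -> 0 < d ->
  exists zeta, [/\ test_function Omega zeta,
    Hsq Omega 2 zeta <= \sum_(i < 2) \sum_(k < 2)
      \int[area]_(x in Omega) (leibniz_bound c chi i k x * \1_(closure (subdomain j)) x) &
    forall p, nodes G p -> `|zeta p - psi j p * chi p| <= d].
Proof.
move=> tc d0; have [cpsi wpsi _] := psi_W2inf dspec j.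
have [e1 e10 h1] := @mollified_product R Omega (closure (subdomain j)) (psi j) chi c oO
  (@closed_closure _ _) tc cpsi wpsi (@psi_bound _ _ _ _ _ _ _ _ _ _ _ dspec j)
  (fun x Ox nx => psi_supp dspec (conj Ox nx)).
have [s sE] := (finite_seqP (nodes G)).1 (finite_nodes spec).
have cf : continuous (fun x => psi j x * chi x).
  by apply: continuousM_fun => //; exact: test_continuous tc.
have [e2 e20 h2] := @common_radius R _ s
  (fun p e => `|conv (fun x => psi j x * chi x) (rho e) p - psi j p * chi p| <= d)
  (fun p _ => cvg_conv_rho p cf d0).
have e0 : 0 < Num.min e1 e2 <= e1 by rewrite lt_min e10 e20 ge_min lexx.
have [tz Hz] := h1 _ e0.
exists (conv (fun x => psi j x * chi x) (rho (Num.min e1 e2))); split => // p; rewrite sE => ps.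
by apply: h2 => //; rewrite lt_min e10 e20 ge_min lexx orbT.
Qed.

(** The interpolant of [psi j * v] is that of a test function [zeta j] plus that of a function with
    nodal values at most [2 * d]. The energies of the [zeta j] are summed by [overlap_energy], and
    everything else is made smaller than an arbitrary [eta]. *)
Lemma localized_energy v : Vh Omega G v ->
  \sum_(j < sub_count P) Hsq Omega 2 (interp Omega G (fun x => psi j x * v x))
  <= 4 * CPi ^+ 2 * (Nc%:R * (K0 * delta ^- 4)) * Hsq Omega 2 v.
Proof.
move=> Vv; have Hv := Vh_conforming spec Vv.
have [B B0 BP] := interp_small spec oO.
set Q := Nc%:R * (K0 * delta ^- 4).
have Q0 : 0 <= Q.
  have K00 : 0 < K0 by exact: energy_constant_gt0.
  by apply: mulr_ge0 => //; apply/ltW/divr_gt0 => //; exact: exprn_gt0 delta_gt0.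
apply/ler_addgt0Pr => eta eta0; pose J : R := (sub_count P)%:R.
(* The nodal errors contribute [2 * B * (2 * d) ^+ 2] for each of the [J] subdomains, hence the 8;
   the minimum with 1 gives [d ^+ 2 <= d]. *)
pose d := Num.min 1 (eta / 2 / (8 * (B * J) + 1)).
have BJ : 0 < 8 * (B * J) + 1 by rewrite ltr_wpDl// !mulr_ge0.
have d0 : 0 < d by rewrite lt_min ltr01 !divr_gt0.
have dE : 8 * (B * J) * d ^+ 2 <= eta / 2.
  have d1 : d <= 1 by rewrite ge_min lexx.
  have d2 : d * (8 * (B * J) + 1) <= eta / 2 by rewrite -ler_pdivlMr// ge_min lexx orbT.
  have BJ0 : 0 <= 8 * (B * J) by rewrite !mulr_ge0.
  have : 8 * (B * J) * d ^+ 2 <= 8 * (B * J) * d by rewrite ler_wpM2l// expr2 ler_piMl// ltW.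
  by move: d2; rewrite mulrDr mulr1 [d * _]mulrC; lra.
(* One factor 2 comes from splitting each interpolant in two, the other from replacing [v] by
   [chi]. *)
set L := 4 * CPi ^+ 2 * Q.
have L0 : 0 <= L by apply: mulr_ge0 => //; apply: mulr_ge0 => //; exact: sqr_ge0.
have [e1 e10 h1] := nodal_convergence spec oO bO h0 CPi0 Hv d0.
(* [e1] keeps [chi] close to [v] at the nodes; the other bound makes the energy error [L * e] at
   most [eta / 2]. *)
pose e := Num.min e1 (eta / 2 / (L + 1)).
have L1 : 0 < L + 1 by rewrite ltr_wpDl.
have e0 : 0 < e by rewrite lt_min e10 !divr_gt0.
have eL : L * e <= eta / 2.
  have : e * (L + 1) <= eta / 2 by rewrite -ler_pdivlMr// ge_min lexx orbT.
  by rewrite mulrDr mulr1 mulrC; lra.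
have [chi tc chiE] := H20_approx Hv e0.
have chi1 : Hsq Omega 2 (v - chi) < e1 by apply: lt_le_trans (chiE 2%N isT) _; rewrite ge_min lexx.
have chi_nodes := h1 chi tc chi1.
have /choice[zeta zP] := fun j => mollified_nodes j tc d0.
have chiH := H20_Hspace (H20_test oO tc); have vH := H20_Hspace Hv.
have chi_le : Hsq Omega 2 chi <= 2 * e + 2 * Hsq Omega 2 v.
  rewrite -[in leLHS](subrK v chi).
  apply: le_trans (HsqD_le oO (HspaceB oO chiH vH) vH) _.
  by rewrite lerD2r ler_pM2l// HsqB_sym// ltW// chiE.
have piece j : Hsq Omega 2 (interp Omega G (fun x => psi j x * v x)) <=
    2 * CPi ^+ 2 * Hsq Omega 2 (zeta j) + 8 * (B * d ^+ 2).
  have [tz _ zn] := zP j; set w := fun x => psi j x * v x.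
  have -> : interp Omega G w = interp Omega G (zeta j) + interp Omega G (w - zeta j).
    by have := interpZD spec 1 (zeta j) (w - zeta j); rewrite !scale1r addrC subrK.
  apply: le_trans (HsqD_le oO (Vh_Hspace spec (interp_Vh spec _)) (Vh_Hspace spec (interp_Vh spec _))) _.
  have z1 := interp_Hsq spec h0 CPi0 (H20_test oO tz).
  have z2 : Hsq Omega 2 (interp Omega G (w - zeta j)) <= B * (2 * d) ^+ 2.
    apply: BP => [|p np]; first by rewrite mulr_ge0// ltW.
    have -> : (w - zeta j) p = psi j p * (v p - chi p) - (zeta j p - psi j p * chi p).
      by rewrite -[LHS]/(psi j p * v p - zeta j p); ring.
    have Op : Omega p by have [i _ /(node_flat spec)[]] := np.
    have /andP[q0 q1] := psi_le1 j Op.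
    apply: le_trans (ler_normB _ _) _; rewrite normrM ger0_norm//.
    have t1 := zn p np; have t2 := chi_nodes p np.
    have : psi j p * `|v p - chi p| <= 1 * d by exact: ler_pM.
    lra.
  rewrite exprMn in z2; lra.
apply: le_trans (ler_sum _ (fun j _ => piece j)) _.
rewrite big_split/= -mulr_sumr sumr_const card_ord -[_ *+ sub_count P]mulr_natr -/J.
have zsum : \sum_j Hsq Omega 2 (zeta j) <= Q * (2 * e + 2 * Hsq Omega 2 v).
  apply: (@le_trans _ _ (Q * Hsq Omega 2 chi)); last exact: ler_wpM2l.
  rewrite /Q -mulrA; apply: le_trans (overlap_energy tc); apply: ler_sum => j _.
  by have [] := zP j.
have : 2 * CPi ^+ 2 * \sum_j Hsq Omega 2 (zeta j) <= L * e + L * Hsq Omega 2 v.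
  have -> : L * e + L * Hsq Omega 2 v = 2 * CPi ^+ 2 * (Q * (2 * e + 2 * Hsq Omega 2 v)).
    by rewrite /L; ring.
  by apply: ler_wpM2l => //; rewrite mulr_ge0// sqr_ge0.
have -> : 8 * (B * d ^+ 2) * J = 8 * (B * J) * d ^+ 2 by ring.
lra.
Qed.

End StableDecomposition.

(** * The condition number of the preconditioned operator *)

(** By [riesz] a solution exists, so the choice operator in [stiffness_inv] returns a solution and
    not its default value. *)
Lemma stiffness_invP (R : realType) (Omega : set (plane R)) (h Cq Cphi CPi : R) (G : gfem R)
    (M : set (plane R)) (l : (plane R -> R) -> R) :
  gfem_spec Omega h Cq Cphi CPi G -> open Omega -> bounded_set Omega -> M `<=` nodes G ->
  (forall c u v, Vh Omega G u -> Vh Omega G v -> l (c *: u + v) = c * l u + l v) ->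
  node_space Omega G M (stiffness_inv Omega (node_space Omega G M) l) /\
  forall w, node_space Omega G M w ->
    bilin Omega (stiffness_inv Omega (node_space Omega G M) l) w = l w.
Proof.
move=> spec oO bO MN lZD; have [s us [sP sb sspan sfree]] := node_space_basis spec MN.
have [u Mu uE] := @riesz R _ (bilin Omega) (node_space Omega G M) _ _
  (fun k v => v (tnth (in_tuple s) k)) (node_space0 spec _) (@node_spaceZD _ _ _ _ _ _ _ spec _)
  (bilinC Omega) (fun c u v w Mu Mv Mw => bilinZD_Vh spec oO c Mu.1 Mv.1 Mw.1)
  (fun v Mv => bilin_eq0 spec oO bO Mv.1) sb sspan sfree l (fun c u v Mu Mv => lZD c u v Mu.1 Mv.1).
by rewrite /stiffness_inv; case: xgetP => [w _ //|/(_ u)[]].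
Qed.

Theorem theorem5p1 (R : realType) (Omega : set (R * R))
    (Cq Cphi CPi CH Cdelta Cdag : R) (Nc : nat) :
  bounded_polygonal_domain Omega ->
  0 < Cq -> 0 < Cphi -> 0 < CPi -> 0 < CH -> 0 < Cdelta -> 0 < Cdag ->
  exists C : R, 0 < C /\
    forall (h H delta : R) (G : gfem R) (P : decomposition R)
           (N : set (R * R)),
      0 < h -> 0 < H ->
      gfem_spec Omega h Cq Cphi CPi G ->
      decomposition_spec Omega G h H delta CH Cdelta Cdag Nc P ->
      N `<=` nodes G ->
      (exists v, truncated_space Omega G N v /\ v <> 0) ->
      let S := eigenvalues (truncated_space Omega G N)
                 (fun v => one_level Omega G N P (stiffness Omega v)) in
      exists lmax lmin : R,
        [/\ is_largest S lmax, is_smallest S lmin, 0 < lmin &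
            lmax / lmin <= C * delta ^- 4].
Proof.
move=> [oO _ O0 bO _] Cq0 Cphi0 CPi0 CH0 Cdelta0 Cdag0.
have [M M0 OM] := bounded_sub_square bO.
(* The added 1, like [Nc.+1] in the next constant, ensures positivity even for [Nc = 0]. *)
pose K : R := (node_overlap Cq Cphi Nc)%:R + 1.
pose A : R := 4 * CPi ^+ 2 * (Nc.+1%:R * energy_constant M CH Cdelta Cdag).
have K0 : 0 < K by rewrite ltr_wpDl.
have E0 : 0 < energy_constant M CH Cdelta Cdag by exact: energy_constant_gt0.
have A0 : 0 < A by apply: mulr_gt0; [apply: mulr_gt0 => //; exact: exprn_gt0|exact: mulr_gt0].
exists (K * A); split; first exact: mulr_gt0.
move=> h H delta G P N h0 H0 spec dspec NN [v0 [Nv0 v00]] S.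
have delta0 : 0 < delta by exact: (delta_gt0 dspec).
have [s us [sP sb sspan sfree]] := node_space_basis spec NN.
pose W j := local_subspace Omega G N (subdomain (d := P) j).
have WE j : W j = node_space Omega G (N `&` subdomain j) by exact: local_subspaceE.
pose T j v := stiffness_inv Omega (W j) (stiffness Omega v).
have TP j v : node_space Omega G N v -> W j (T j v) /\
    forall w, W j w -> bilin Omega (T j v) w = bilin Omega v w.
  move=> Nv; rewrite /T WE; apply: (stiffness_invP spec oO bO) => [p [/NN]//|c u w Vu Vw].
  by rewrite /stiffness ![bilin Omega v _]bilinC (bilinZD_Vh spec oO)//; exact: Nv.1.
have WN j : W j `<=` node_space Omega G N.
  by move=> v; rewrite WE => -[Vv vn]; split => // p np nN; apply: vn => // -[].
have WZD j c u v : W j u -> W j v -> W j (c *: u + v).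
  by rewrite WE; exact: node_spaceZD spec _ _ _ _.
have Vh_W j v : W j v -> Hspace Omega 2 v by rewrite WE => -[/(Vh_Hspace spec)].
have overlap (w : 'I_(Defs.sub_count P) -> plane R -> R) : (forall j, W j (w j)) ->
    bilin Omega (\sum_j w j) (\sum_j w j) <= K * \sum_j bilin Omega (w j) (w j).
  move=> Ww; have wH j := Vh_W j _ (Ww j).
  rewrite bilin_sqr//; last exact: Hspace_sum.
  under [X in _ <= _ * X]eq_bigr do rewrite bilin_sqr//.
  apply: (@le_trans _ _ ((node_overlap Cq Cphi Nc)%:R * \sum_j Hsq Omega 2 (w j))).
    apply: (@node_space_overlap _ _ _ _ _ _ _ spec oO h0 Cq0 Cphi0 _
      (fun j => N `&` subdomain j) (subdomain (d := P))) => //.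
    - by move=> y; exact: (sub_overlap dspec).
    - by move=> j; rewrite -WE.
  by rewrite ler_wpM2r ?lerDl// sumr_ge0// => j _; exact: Hsq_ge0.
have stable v : node_space Omega G N v -> exists w : 'I_(Defs.sub_count P) -> plane R -> R,
    [/\ forall j, W j (w j), v = \sum_j w j &
      \sum_j bilin Omega (w j) (w j) <= A * delta ^- 4 * bilin Omega v v].
  (* Nodal values decide both requirements: [v] vanishes at nodes outside [N] and [psi j] at nodes
     outside [D_j], while the [psi j] sum to 1 at every node and [v] is its own interpolant. *)
  move=> [Vv vN]; exists (fun j => interp Omega G (fun x => psi j x * v x)).
  have wV (j : 'I_(Defs.sub_count P)) := interp_Vh spec (fun x => psi j x * v x).
  split=> [j||].
  - rewrite WE; split=> // p np /not_andP nD; rewrite (interp_node spec)//.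
    have Op : Omega p by have [i _ /(node_flat spec)[]] := np.
    case: nD => [/(vN p np) ->|/(psi_off dspec oO Op) ->]; first by rewrite mulr0.
    by rewrite mul0r.
  - rewrite -(interp_sum spec) -{1}(interp_id spec Vv); apply: (eq_interp spec) => p np.
    have Op : Omega p by have [i _ /(node_flat spec)[]] := np.
    by rewrite fct_sumE -mulr_suml (psi_sum1 dspec) ?mul1r//; exact: subset_closure.
  under eq_bigr do rewrite (bilin_sqr oO (Vh_Hspace spec (wV _))).
  rewrite (bilin_sqr oO (Vh_Hspace spec Vv)).
  apply: le_trans (localized_energy spec dspec oO OM bO O0 h0 CPi0 CH0 Cdelta0 Cdag0 M0 Vv) _.
  apply: ler_wpM2r; first exact: Hsq_ge0.
  rewrite /A -[leRHS]mulrA -[Nc.+1%:R * _ * _]mulrA.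
  apply: ler_wpM2l; first by apply: mulr_ge0 => //; exact: sqr_ge0.
  apply: ler_wpM2r; last by rewrite ler_nat.
  by apply/ltW/divr_gt0 => //; exact: exprn_gt0.
have C0 : 0 < A * delta ^- 4 by rewrite divr_gt0// exprn_gt0.
have V0 : node_space Omega G N v0 by rewrite -(truncated_spaceE Omega G N).
have := @schwarz_condition R _ (bilin Omega)
  (node_space Omega G N) _ _ (fun k v => v (tnth (in_tuple s) k)) (node_space0 spec _)
  (@node_spaceZD _ _ _ _ _ _ _ spec _) (bilinC Omega)
  (fun c u v w Mu Mv Mw => bilinZD_Vh spec oO c Mu.1 Mv.1 Mw.1)
  (fun v Mv => bilin_ge0 spec oO Mv.1) (fun v Mv => bilin_eq0 spec oO bO Mv.1) sb sspan sfree
  _ W T WN WZD (fun j v Nv => (TP j v Nv).1) (fun j v w Nv => (TP j v Nv).2 w)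
  K (A * delta ^- 4) K0 C0 overlap stable v0 V0 v00.
by rewrite /S truncated_spaceE mulrA.
Qed.
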